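(* Let $\mathcal{D}=(d_1,\ldots,d_r)$ be positive integers, $N=\sum_i d_i$. The Poincaré polynomial $P_{\mathrm{Tor}}$ of the ranks of $\mathbb{Z}_2$'s in $H^*(\mathrm{Fl}_{2\mathcal{D}}(\mathbb{R}^{2N});\mathbb{Z})$ is given by $$P_{\mathrm{Tor}}(\mathrm{Fl}_{2\mathcal{D}})=\frac{t}{t+1}\left(\frac{\prod_{j=1}^{2N}(1-t^j)}{\prod_{i=1}^r\prod_{j=1}^{2d_i}(1-t^j)}-\frac{\prod_{j=1}^N(1-t^{4j})}{\prod_{i=1}^r\prod_{j=1}^{d_i}(1-t^{4j})}\right).$$
   Context: $\mathrm{Fl}_{2\mathcal{D}}=\mathrm{Fl}_{2\mathcal{D}}(\mathbb{R}^{2N})$ is the manifold of flags $F_1\subset\cdots\subset F_r=\mathbb{R}^{2N}$ of real subspaces with $\dim F_i=2(d_1+\cdots+d_i)$. $P_{\mathrm{Tor}}=\sum_i \tau_i t^i$, where $\tau_i$ is the number of $\mathbb{Z}_2$ summands in $H^i(\mathrm{Fl}_{2\mathcal{D}};\mathbb{Z})$ (all torsion in this group is of order 2). *)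

(* Defs.v *)
From HB Require Import structures.
From mathcomp Require Import all_boot all_order all_algebra.
From mathcomp Require Import all_classical all_reals all_analysis.
Import Order.TTheory GRing.Theory Num.Theory numFieldNormedType.Exports.

Set Implicit Arguments.
Unset Strict Implicit.
Unset Printing Implicit Defensive.

Local Open Scope classical_set_scope.
Local Open Scope ring_scope.

(** * Singular cohomology with integer coefficients *)

Definition simplex (R : realType) (n : nat) : set 'rV[R]_n.+1 :=
  [set x | (forall i, 0 <= x 0 i) /\ \sum_i x 0 i = 1].

Arguments simplex R n _ : clear implicits.

Section Face.
Context {R : realType} {n : nat}.
Implicit Types (i : 'I_n.+2) (x : simplex R n).

(* The affine embedding onto the facet opposite to the i-th vertex: it inserts
   a zero barycentric coordinate at position i. *)
Definition face_row i x : 'rV[R]_n.+2 :=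
  \row_j oapp (fun k => set_val x 0 k) 0 (unlift i j).

Lemma face_row_simplex i x : face_row i x \in simplex R n.+1.
Proof.
have /set_mem [x0 x1] := valP x.
apply/mem_set; split=> [j|]; first by rewrite mxE; case: unlift => //= k.
rewrite (bigD1_ord i) //= mxE unlift_none /= add0r -[RHS]x1.
by apply: eq_bigr => k _; rewrite mxE liftK.
Qed.

Definition face i x : simplex R n.+1 := exist _ (face_row i x) (face_row_simplex i x).

Lemma face_continuous i : continuous (face i).
Proof.
apply/continuous_comp_initial.
have coord (a : 'I_1) (j : 'I_n.+2) :
    continuous (fun y : simplex R n => face_row i y a j : R).
  case Eu: (unlift i j) => [k|].
    rewrite (_ : (fun y => _) = (fun M : 'rV[R]_n.+1 => M 0 k) \o set_val).
      move=> x; apply: continuous_comp; first exact: initial_continuous.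
      exact: coord_continuous.
    by apply/funext => y /=; rewrite mxE Eu.
  rewrite (_ : (fun y => _) = cst 0); first exact: cst_continuous.
  by apply/funext => y /=; rewrite mxE Eu.
move=> x A [P Px sPA]; rewrite nbhs_filterE /=.
have : \forall y \near x, forall aj : 'I_1 * 'I_n.+2,
    P aj.1 aj.2 (face_row i y aj.1 aj.2).
  apply: (@filter_forall _ _
    (fun aj (y : simplex R n) => P aj.1 aj.2 (face_row i y aj.1 aj.2)) _ (nbhs_filter x)) => -[a j].
  exact: (coord a j x _ (Px a j)).
by apply: filterS => y Py; apply: sPA => a j; exact: (Py (a, j)).
Qed.

HB.instance Definition _ i :=
  @isContinuous.Build _ _ (face i) (@face_continuous i).

End Face.

Section Cohomology.
Variables (R : realType) (X : topologicalType).

Definition singular_simplex n := continuousType (simplex R n) X.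

Definition cochain n := singular_simplex n -> int.

HB.instance Definition _ n := GRing.Zmodule.on (cochain n).

Definition restrict_face n (i : 'I_n.+2) (s : singular_simplex n.+1) :
  singular_simplex n := s \o face i.

Definition coboundary n (c : cochain n) : cochain n.+1 :=
  fun s => \sum_(i < n.+2) (-1) ^+ i * c (restrict_face i s).

Lemma coboundary_is_zmod_morphism n : zmod_morphism (@coboundary n).
Proof.
move=> c e; apply/funext => s; rewrite /coboundary /=.
rewrite -[RHS]/(\sum_i _ - \sum_i _) -sumrB.
by apply: eq_bigr => i _; rewrite -mulrBr.
Qed.
HB.instance Definition _ n := GRing.isZmodMorphism.Build _ _ (@coboundary n)
  (@coboundary_is_zmod_morphism n).

Definition is_cocycle n : {pred cochain n} := fun c => coboundary c == 0.

Lemma is_cocycle_closed n : zmod_closed (@is_cocycle n).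
Proof.
split=> [|c e]; first by apply/eqP; rewrite raddf0.
move=> /eqP c0 /eqP e0; apply/eqP.
by rewrite [LHS]coboundary_is_zmod_morphism c0 e0 subrr.
Qed.
HB.instance Definition _ n :=
  GRing.isZmodClosed.Build _ (@is_cocycle n) (@is_cocycle_closed n).

Record cocycle n := Cocycle
  { cocycle_val :> cochain n; _ : cocycle_val \in @is_cocycle n }.
HB.instance Definition _ n := [isSub for @cocycle_val n].
HB.instance Definition _ n := [Choice of cocycle n by <:].
HB.instance Definition _ n := [SubChoice_isSubZmodule of cocycle n by <:].

(* C^{-1} is the trivial group. *)
Definition is_coboundary n : {pred cocycle n} :=
  match n return {pred cocycle n} with
  | 0 => fun c => c == 0
  | m.+1 => fun c => `[< exists b : cochain m, cocycle_val c = coboundary b >]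
  end.

Lemma is_coboundary_closed n : zmod_closed (@is_coboundary n).
Proof.
case: n => [|n]; split=> [|c e]; rewrite ?unfold_in /=.
- exact: eqxx.
- by move=> /eqP -> /eqP ->; apply/eqP; rewrite subrr.
- by apply/asboolP; exists 0; rewrite raddf0.
- move=> /asboolP[b cb] /asboolP[b' eb']; apply/asboolP; exists (b - b').
  by rewrite [RHS]coboundary_is_zmod_morphism -cb -eb'.
Qed.
HB.instance Definition _ n :=
  GRing.isZmodClosed.Build _ (@is_coboundary n) (@is_coboundary_closed n).

Definition cohomology n : zmodType := Quotient.quot (@is_coboundary n).

End Cohomology.

(** * Real flag manifolds *)

Section Flag.
Variables (R : realType) (r : nat) (d : 'I_r -> nat).

Definition ambient_dim : nat := (\sum_i d i)%N.

Local Notation V := 'rV[R]_ambient_dim.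

Definition flag_dim (i : 'I_r) : nat := (\sum_(j < r | j <= i) d j)%N.

(* The last member has dimension ambient_dim, so it is the whole space. *)
Definition is_flag (F : {ffun 'I_r -> {vspace V}}) : bool :=
  [forall i, \dim (F i) == flag_dim i] &&
  [forall i : 'I_r, forall j : 'I_r, (i <= j)%N ==> (F i <= F j)%VS].

Definition flag := {F : {ffun 'I_r -> {vspace V}} | is_flag F}.

Definition frame : set 'M[R]_ambient_dim := [set g | g \in unitmx].

(* The i-th subspace is spanned by the first d_1 + ... + d_i rows of g. *)
Definition frame_span (g : frame) : {ffun 'I_r -> {vspace V}} :=
  [ffun i => <<take (flag_dim i) [seq row k (set_val g) | k : 'I_ambient_dim]>>%VS].

Lemma frame_rows_free (g : frame) :
  free [seq row k (set_val g) | k : 'I_ambient_dim].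
Proof.
have ug : set_val g \in unitmx by have /set_mem := valP g.
set s := [seq _ | k : _].
have sz : size s == ambient_dim by rewrite size_map -cardE card_ord.
apply/(@freeP _ _ _ (Tuple sz)) => c c0 k.
have : \row_l c l *m set_val g = 0.
  rewrite mulmx_sum_row -[RHS]c0; apply: eq_bigr => l _; rewrite mxE.
  congr (_ *: _); rewrite /= (nth_map l) -?cardE ?card_ord//.
  by rewrite nth_ord_enum.
move/(congr1 (mulmx^~ (invmx (set_val g)))); rewrite mulmxK// mul0mx.
by move/matrixP/(_ 0 k); rewrite !mxE.
Qed.

Lemma frame_span_is_flag g : is_flag (frame_span g).
Proof.
apply/andP; split; apply/forallP => i; last first.
  apply/forallP => j; apply/implyP => ij; rewrite !ffunE; apply: sub_span => v.
  suff le_ij : (flag_dim i <= flag_dim j)%N by rewrite -(take_takel _ le_ij) => /mem_take.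
  rewrite /flag_dim [leqRHS](bigID (fun k : 'I_r => k <= i)%N) /=.
  rewrite [X in (_ <= X + _)%N](eq_bigl (fun k : 'I_r => k <= i)%N) ?leq_addr// => k.
  by case: (leqP k i) => ki; rewrite ?andbF ?andbT// (leq_trans ki ij).
rewrite ffunE; have := frame_rows_free g; set s := [seq _ | k : _] => fs.
have ft : free (take (flag_dim i) s).
  by move: fs; rewrite -[X in free X](cat_take_drop (flag_dim i)) => /catl_free.
move: ft; rewrite /free => /eqP ->; rewrite size_takel// size_map -cardE card_ord.
by rewrite /flag_dim /ambient_dim [leqRHS](bigID (fun k : 'I_r => k <= i)%N) leq_addr.
Qed.

Definition flag_of_frame (g : frame) : flag :=
  exist _ (frame_span g) (frame_span_is_flag g).

(* flag_of_frame is the orbit map of GL, so this is the quotient topology of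
   Fl = GL/P. *)
Definition flag_open (U : set flag) : Prop := open (flag_of_frame @^-1` U).

HB.instance Definition _ := Choice.on flag.

Let flag_openT : flag_open setT.
Proof. by rewrite /flag_open preimage_setT; exact: openT. Qed.

Let flag_openI : setI_closed flag_open.
Proof. by move=> U W; exact: openI. Qed.

Let flag_open_bigcup (I : Type) (U : I -> set flag) :
  (forall i, flag_open (U i)) -> flag_open (\bigcup_i U i).
Proof.
move=> oU; rewrite /flag_open preimage_bigcup.
by apply: bigcup_open => i _; exact: oU.
Qed.

HB.instance Definition _ :=
  isOpenTopological.Build flag flag_openT flag_openI flag_open_bigcup.

End Flag.

Arguments ambient_dim {r} d.
Arguments flag_dim {r} d i.
Arguments flag R {r} d.

(** * Torsion *)

Definition group_iso (A B : zmodType) : Prop :=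
  exists f : {additive A -> B}, bijective f.

Definition Z_sum_Z2 (b t : nat) : zmodType := ('rV[int]_b * 'rV['Z_2]_t)%type.

(* For a group whose torsion is killed by 2: the number of Z/2 summands is t. *)
Definition Z2_rank (A : zmodType) (t : nat) : Prop :=
  exists b, group_iso A (Z_sum_Z2 b t).

Definition is_torsion_poincare (R : realType) (X : topologicalType)
    (P : {poly int}) : Prop :=
  forall i, exists2 t, Z2_rank (cohomology R X i) t & P`_i = t%:Z.

(* Main.v *)
(* Row reduction of flags along the words w in the letters 1..r of content 2D
   stratifies Fl by the Schubert cells C_w, of codimension inv(w), each contained
   in an affine chart V_w in which it is a coordinate subspace. Excision along this
   stratification gives a cochain complex with one generator per word computing the
   integral cohomology of Fl. A minor that has no zero on C_w and changes sign under a
   reflection of V_v shows that every incidence number is even.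

   A diagonal matrix of signs acts on the complex by characters of the words. If it
   has exactly two signs -1 it is homotopic to the identity, so the part of
   the cohomology with a nontrivial character is killed by 2, that is, on this part the
   halved differential is exact. The words with trivial characters are
   the doubled words aabbcc...; their codimensions are 4 inv(abc...), so no
   differential meets them. Hence t_n + t_(n+1) is the number of words
   of inversion number n that are not doubled, and the generating functions of
   inversions over all words and over the doubled words are q-multinomial coefficients. *)

Require Import Defs.
From HB Require Import structures.
From mathcomp Require Import all_boot all_order all_fingroup all_algebra.
From mathcomp Require Import all_classical all_reals all_analysis.
From mathcomp Require Import zify ring lra.
Import Order.TTheory GRing.Theory Num.Theory numFieldNormedType.Exports.

Set Implicit Arguments.
Unset Strict Implicit.
Unset Printing Implicit Defensive.

Local Open Scope ring_scope.

(** * Chains of vertex lists *)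

(** Relative cohomology is handled through cochains that vanish on the simplices of an open set. No
    exact sequence appears as an object: each exactness step is an explicit correction of a cochain
    by a coboundary. The analytic input, that simplices may be taken small for an open cover, is
    proved on functions of vertex lists, where cones and prisms are recursions, and then carried
    over to singular cochains. The incidence numbers are never computed; only their parity and their
    equivariance are known. This is enough: exactness of the halved differential on the nontrivial
    words makes its image a saturated lattice, and the true image is twice that lattice. So the
    torsion in degree n is a power of Z/2 whose exponent is the rank of the halved differential
    entering degree n. Rank and nullity then give the recurrence for t_n, the origin of the factor
    t/(t+1). Signs come in pairs for the homotopy because one reflection has negative determinant
    and lies outside the identity component of GL. For evenness a single reflection is used, as no
    homotopy is involved there. *)

Section ListChains.
Variable E : eqType.
Implicit Types (l k : seq E) (c f g : seq E -> int).

(* The coboundary on functions of vertex lists, by recursion on the list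
   through the cone identity [d (x * k) = k - x * d k]. *)
Fixpoint ld l c : int :=
  if l is x :: l' then c l' - ld l' (fun k => c (x :: k)) else 0.

Lemma eq_ld l f g :
  (forall k, size k = (size l).-1 -> {subset k <= l} -> f k = g k) ->
  ld l f = ld l g.
Proof.
elim: l f g => //= x l IHl f g fg; congr (_ - _).
  by apply: fg => // y yl; rewrite inE yl orbT.
case: l IHl fg => [//|y l] IHl fg; apply: IHl => k /= sk kl.
apply: fg; first by rewrite /= sk.
by move=> z; rewrite !inE => /predU1P[->|/kl]; rewrite ?eqxx// inE => ->; rewrite orbT.
Qed.

Lemma ldB l f g : ld l (fun k => f k - g k) = ld l f - ld l g.
Proof.
elim: l f g => [|x l IHl] f g /=; first by rewrite subr0.
by rewrite IHl; lia.
Qed.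

(** Applying the cone identity twice cancels everything except [x * d d k], which vanishes by
    induction. *)
Lemma ldld l c : ld l (fun k => ld k c) = 0.
Proof.
elim: l c => //= x l IHl c.
by rewrite (ldB l c (fun k => ld k (fun k' => c (x :: k')))) IHl subr0 subrr.
Qed.

Lemma ld_sum l c : ld l c =
  \sum_(i < size l) (-1) ^+ i * c (take i l ++ drop i.+1 l).
Proof.
elim: l c => [|x l IHl] c /=; first by rewrite big_ord0.
rewrite big_ord_recl /= drop0 expr0 mul1r IHl -sumrN; congr (_ + _).
by apply: eq_bigr => i _; rewrite /bump leq0n add1n exprS mulN1r mulNr.
Qed.

End ListChains.

Lemma ld_map (E1 E2 : eqType) (F : E1 -> E2) l (c : seq E2 -> int) :
  ld (map F l) c = ld l (fun k => c (map F k)).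
Proof. by elim: l c => //= x l IHl c; rewrite IHl. Qed.

Section ListOperators.
Variables E E' : eqType.
Local Notation op := ((seq E' -> int) -> seq E -> int).

Definition op_additive (a : op) :=
  forall f g l, a (fun k => f k - g k) l = a f l - a g l.
Definition op_chain (a : op) :=
  forall f l, a (fun k => ld k f) l = ld l (a f).

Variables (b : seq E -> E') (al be : op).

(** Acyclic models by coning: in terms of chains, [D l = b l * (al l - be l - D (d l))]. The counter
    is the length of the list, along which the recursion descends. *)
Fixpoint cylinder_rec n (c : seq E' -> int) (l : seq E) : int :=
  if n is m.+1 then
    al (fun k => c (b l :: k)) l - be (fun k => c (b l :: k)) l -
    ld l (cylinder_rec m (fun k => c (b l :: k)))
  else 0.

Definition cylinder c l := cylinder_rec (size l) c l.

Hypotheses (alB : op_additive al) (beB : op_additive be).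
Hypotheses (ald : op_chain al) (bed : op_chain be).
Hypothesis albe0 : forall c, al c [::] = be c [::].

Lemma cylinder_recB n f g l :
  cylinder_rec n (fun k => f k - g k) l = cylinder_rec n f l - cylinder_rec n g l.
Proof.
elim: n f g l => [|n IHn] f g l /=; first by rewrite subr0.
rewrite (alB (fun k => f (b l :: k)) (fun k => g (b l :: k)) l).
rewrite (beB (fun k => f (b l :: k)) (fun k => g (b l :: k)) l).
under [in LHS]eq_ld do rewrite IHn.
by rewrite ldB; lia.
Qed.

Lemma cylinderB : op_additive cylinder.
Proof. by move=> f g l; rewrite /cylinder cylinder_recB. Qed.

(** By induction on the length, [al - be - D d] is a cycle, and the cone over a cycle with apex
    [b l] has that cycle as its boundary. On the empty list both operators agree, which starts the
    induction. *)
Lemma cylinder_homotopy c l :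
  cylinder (fun k => ld k c) l + ld l (cylinder c) = al c l - be c l.
Proof.
move sl: (size l) => n.
elim: n c l sl => [|n IHn] c l sl; first by rewrite (size0nil sl) /cylinder /= albe0; lia.
rewrite {1}/cylinder sl /=; set L := l.
set e := fun k => c (b L :: k).
rewrite (alB c (fun k => ld k e) L) (beB c (fun k => ld k e) L) ald bed.
have -> : ld L (cylinder_rec n (fun k => c k - ld k e)) =
    ld L (cylinder c) - (ld L (al e) - ld L (be e)).
  rewrite -ldB.
  rewrite -[ld L (fun k => al e k - be e k)]subr0 -(ldld L (cylinder e)) -!ldB.
  apply: eq_ld => k sk _; rewrite cylinder_recB.
  have skn : size k = n by rewrite sk sl.
  have := IHn e k skn; rewrite /cylinder skn => <-.
  rewrite -!/(cylinder _ _); lia.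
by rewrite /=; lia.
Qed.

End ListOperators.

Section Subdivision.
Variables (E : eqType) (b : seq E -> E).

(** Barycentric subdivision in cone form, [S l = b l * S (d l)]. The choice of center [b] stays
    abstract because the chain map property rests on the cone identity alone. *)
Fixpoint subdiv_rec n (c : seq E -> int) (l : seq E) : int :=
  if n is m.+1 then ld l (subdiv_rec m (fun k => c (b l :: k))) else c l.

Definition subdiv c l := subdiv_rec (size l) c l.

Lemma subdiv_recB n f g l :
  subdiv_rec n (fun k => f k - g k) l = subdiv_rec n f l - subdiv_rec n g l.
Proof.
elim: n f g l => [//|n IHn] f g l /=.
by rewrite -ldB; apply: eq_ld => k _ _; rewrite IHn.
Qed.

Lemma subdivB : op_additive subdiv.
Proof. by move=> f g l; rewrite /subdiv subdiv_recB. Qed.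

Lemma subdiv_chain : op_chain subdiv.
Proof.
move=> c l; move sl: (size l) => n.
elim: n c l sl => [|n IHn] c l sl; first by rewrite (size0nil sl).
rewrite {1}/subdiv sl /=; set L := l.
set e := fun k => c (b L :: k).
have -> : ld L (subdiv_rec n (fun k => c k - ld k e)) =
    ld L (subdiv c) - ld L (fun k => ld k (subdiv e)).
  rewrite -ldB; apply: eq_ld => k sk _; have skn : size k = n by rewrite sk sl.
  rewrite subdiv_recB {1}/subdiv skn; congr (_ - _).
  by rewrite -IHn // /subdiv skn.
by rewrite ldld subr0.
Qed.

End Subdivision.

Section Naturality.

Lemma subdiv_map (E1 E2 : eqType) (b1 : seq E1 -> E1) (b2 : seq E2 -> E2)
    (F : E1 -> E2) (c : seq E2 -> int) l :
  (forall k, b2 (map F k) = F (b1 k)) ->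
  subdiv b2 c (map F l) = subdiv b1 (fun k => c (map F k)) l.
Proof.
move=> bF; rewrite /subdiv size_map; move: (size l) => n.
elim: n c l => [//|n IHn] c l /=.
by rewrite ld_map; apply: eq_ld => k _ _; rewrite IHn /= bF.
Qed.

Lemma cylinder_map (E1 E2 E1' E2' : eqType)
    (b1 : seq E1 -> E1') (b2 : seq E2 -> E2') (F : E1 -> E2) (F' : E1' -> E2')
    (al1 be1 : (seq E1' -> int) -> seq E1 -> int)
    (al2 be2 : (seq E2' -> int) -> seq E2 -> int) c l :
  (forall k, b2 (map F k) = F' (b1 k)) ->
  (forall c k, al2 c (map F k) = al1 (fun k => c (map F' k)) k) ->
  (forall c k, be2 c (map F k) = be1 (fun k => c (map F' k)) k) ->
  cylinder b2 al2 be2 c (map F l) =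
  cylinder b1 al1 be1 (fun k => c (map F' k)) l.
Proof.
move=> bF alF beF; rewrite /cylinder size_map; move: (size l) => n.
elim: n c l => [//|n IHn] c l /=.
rewrite alF beF /= bF; congr (_ - _).
by rewrite ld_map; apply: eq_ld => k _ _; rewrite IHn /= ?bF.
Qed.

End Naturality.

Section Locality.
Variables (E E' : eqType) (K : E -> Prop) (K' : E' -> Prop).

Definition in_list (A : eqType) (P : A -> Prop) (l : seq A) :=
  forall x, x \in l -> P x.

(** Singular simplices are extended from the standard simplex to a whole vector space by a
    retraction, so their values off the simplex are artificial. Locality says that an operator never
    sees those values. *)
Definition op_local (a : (seq E' -> int) -> seq E -> int) :=
  forall c c' l, in_list K l -> (forall k, in_list K' k -> c k = c' k) ->
  a c l = a c' l.

Lemma in_list_cons (A : eqType) (P : A -> Prop) x l :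
  P x -> in_list P l -> in_list P (x :: l).
Proof. by move=> Px Pl y; rewrite inE => /predU1P[->//|]; exact: Pl. Qed.

Lemma cylinder_local (b : seq E -> E') al be :
  (forall l, l != [::] -> in_list K l -> K' (b l)) ->
  op_local al -> op_local be -> op_local (cylinder b al be).
Proof.
move=> bK alK beK c c' l Kl cc'; rewrite /cylinder; move sl: (size l) => n.
elim: n c c' l sl Kl cc' => [//|n IHn] c c' l sl Kl cc' /=.
have Kb : K' (b l) by apply: bK => //; case: l sl {Kl}.
have cb k : in_list K' k -> c (b l :: k) = c' (b l :: k).
  by move=> Kk; apply: cc'; apply: in_list_cons.
rewrite (alK _ _ _ Kl cb) (beK _ _ _ Kl cb); congr (_ - _).
apply: eq_ld => k; rewrite sl /= => sk kl; apply: IHn => //.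
by move=> x /kl; apply: Kl.
Qed.

End Locality.

Section Barycenter.
Context {R : realType} {E : normedModType R}.
Implicit Types (K : E -> Prop) (l : seq E) (c : seq E -> int).

Definition convex_closed K := forall n (a : 'I_n -> R) (p : 'I_n -> E),
  (forall i, 0 <= a i) -> \sum_i a i = 1 -> (forall i, K (p i)) ->
  K (\sum_i a i *: p i).

Definition bary l : E := (size l)%:R^-1 *: \sum_(x <- l) x.

Lemma sum_seq_ord (V : nmodType) (T : eqType) (x0 : T) (F : T -> V) (l : seq T) :
  \sum_(x <- l) F x = \sum_(i < size l) F (nth x0 l i).
Proof. by rewrite (big_nth x0) big_mkord. Qed.

Lemma bary_convex K l : convex_closed K -> l != [::] -> in_list K l -> K (bary l).
Proof.
move=> cK l0 Kl; rewrite /bary (sum_seq_ord 0) scaler_sumr.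
apply: cK => [i||i]; first by rewrite invr_ge0 ler0n.
- rewrite sumr_const card_ord -[LHS]mulr_natr mulVf// pnatr_eq0.
  by case: l l0 {Kl}.
- by apply: Kl; rewrite mem_nth.
Qed.

Lemma convex_closed_ball (b : E) rho : convex_closed (fun x => `|b - x| <= rho).
Proof.
move=> n a p a0 a1 pb.
have -> : b - \sum_i a i *: p i = \sum_i a i *: (b - p i).
  by rewrite -[b in LHS]scale1r -a1 scaler_suml -sumrB; apply: eq_bigr => i _; rewrite scalerBr.
apply: le_trans (ler_norm_sum _ _ _) _.
rewrite -[rho]mul1r -a1 mulr_suml; apply: ler_sum => i _.
by rewrite normrZ ger0_norm// ler_wpM2l.
Qed.

Lemma convex_closedI K1 K2 : convex_closed K1 -> convex_closed K2 ->
  convex_closed (fun x => K1 x /\ K2 x).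
Proof.
move=> c1 c2 n a p a0 a1 pK; split; [apply: c1 | apply: c2] => // i; by case: (pK i).
Qed.

Definition diam_le l (rho : R) := forall x y, x \in l -> y \in l -> `|x - y| <= rho.

(** The contraction factor of barycentric subdivision for simplices with [n] vertices, that is, of
    dimension [n - 1]. Division by zero makes it 0 for [n = 0]. *)
Definition mesh_ratio n : R := n.-1%:R / n%:R.

Lemma mesh_ratio_ge0 n : 0 <= mesh_ratio n.
Proof. by rewrite /mesh_ratio divr_ge0. Qed.

Lemma mesh_ratio_lt1 n : mesh_ratio n < 1.
Proof.
case: n => [|n]; first by rewrite /mesh_ratio mul0r.
by rewrite /mesh_ratio ltr_pdivrMr ?ltr0n// mul1r ltr_nat.
Qed.

Lemma mesh_ratio_le n : mesh_ratio n <= mesh_ratio n.+1.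
Proof.
case: n => [|n]; first by rewrite /mesh_ratio mul0r mesh_ratio_ge0.
rewrite /mesh_ratio /= ler_pdivrMr ?ltr0n// mulrAC ler_pdivlMr ?ltr0n//.
by rewrite -!natrM ler_nat; lia.
Qed.

(** The barycenter minus [x] is the mean of the differences [y - x], and the one with [y = x] is
    zero; hence the numerator [n - 1]. *)
Lemma bary_dist l x rho : x \in l -> diam_le l rho ->
  `|bary l - x| <= mesh_ratio (size l) * rho.
Proof.
move=> xl dl; have l0 : (size l)%:R != 0 :> R by rewrite pnatr_eq0; case: l xl {dl}.
have -> : bary l - x = (size l)%:R^-1 *: \sum_(y <- l) (y - x).
  rewrite sumrB scalerBr; congr (_ - _).
  rewrite big_const_seq count_predT iter_addr_0.
  by rewrite -scalerMnr scalerMnl -[_^-1 *+ _]mulr_natr mulVf// scale1r.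
rewrite normrZ ger0_norm ?invr_ge0// /mesh_ratio [X in _ <= X]mulrAC [X in _ <= X]mulrC.
apply: ler_wpM2l; first by rewrite invr_ge0.
rewrite (perm_big _ (perm_to_rem xl)) big_cons /= subrr add0r.
apply: le_trans (ler_norm_sum _ _ _) _.
rewrite -(size_rem xl) mulr_natl -iter_addr_0 -count_predT -big_const_seq.
rewrite big_seq [X in _ <= X]big_seq; apply: ler_sum => y /mem_rem yl.
exact: dl.
Qed.

Lemma subdiv_rec_small n c c' l K rho :
  size l = n -> convex_closed K -> in_list K l -> diam_le l rho ->
  (forall k, size k = n -> in_list K k -> diam_le k (mesh_ratio n * rho) ->
    c k = c' k) ->
  subdiv_rec bary n c l = subdiv_rec bary n c' l.
Proof.
elim: n c c' l K => [|n IHn] c c' l K sl cK Kl dl cc' /=.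
  by rewrite (size0nil sl); apply: cc'.
have l0 : l != [::] by case: l sl {Kl dl}.
have rho0 : 0 <= rho.
  case: l l0 dl {sl Kl} => // x l _ /(_ x x); rewrite subrr normr0; apply; exact: mem_head.
apply: eq_ld => k; rewrite sl /= => sk kl.
(* Intersecting [K] with a ball around the barycenter carries the distance to the new apex through
   the recursion on faces. *)
apply: (IHn _ _ _ _ sk (convex_closedI cK (@convex_closed_ball (bary l) (mesh_ratio n.+1 * rho)))).
- by move=> x /kl xl; split; [exact: Kl | rewrite -sl; exact: bary_dist].
- by move=> x y /kl xl /kl yl; apply: dl.
move=> k' sk' Kk' dk'; apply: cc'.
- by rewrite /= sk'.
- by apply: in_list_cons; [exact: bary_convex | move=> x /Kk'[]].
- move=> x y; rewrite !inE => /predU1P[->|xk] /predU1P[->|yk].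
  + by rewrite subrr normr0 mulr_ge0 ?mesh_ratio_ge0.
  + by have [] := Kk' _ yk.
  + by have [_] := Kk' _ xk; rewrite distrC.
  + by apply: le_trans (dk' _ _ xk yk) _; rewrite ler_wpM2r ?mesh_ratio_le.
Qed.

Lemma subdiv_local K : convex_closed K -> op_local K K (subdiv bary).
Proof.
move=> cK c c' l Kl cc'; rewrite /subdiv.
(* The sum of all pairwise distances is a crude bound for the diameter; any finite bound gives
   locality. *)
pose rho := \sum_(x <- l) \sum_(y <- l) `|x - y|.
apply: (@subdiv_rec_small _ _ _ _ K rho) => // [x y xl yl|k _ Kk _]; last exact: cc'.
rewrite /rho (perm_big _ (perm_to_rem xl)) big_cons (perm_big _ (perm_to_rem yl)) /=.
rewrite big_cons -addrA lerDl addr_ge0//; first exact: sumr_ge0.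
by apply: sumr_ge0 => z _; apply: sumr_ge0.
Qed.

Lemma iter_subdiv_small m c c' l K rho :
  convex_closed K -> in_list K l -> diam_le l rho ->
  (forall k, size k = size l -> in_list K k ->
    diam_le k (mesh_ratio (size l) ^+ m * rho) -> c k = c' k) ->
  iter m (subdiv bary) c l = iter m (subdiv bary) c' l.
Proof.
move=> cK; elim: m l rho => [|m IHm] l rho Kl dl cc' /=.
  by apply: cc' => // x y xl yl; rewrite mul1r; apply: dl.
apply: (subdiv_rec_small (erefl _) cK Kl dl) => k sk Kk dk.
apply: (IHm _ _ Kk dk) => k' sk' Kk' dk'; apply: cc' => //; first by rewrite sk'.
by rewrite exprSr -mulrA -sk; rewrite -sk in dk'.
Qed.

End Barycenter.

Local Open Scope classical_set_scope.

(** * Subdivision of singular simplices *)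

Lemma continuous_mx (T : topologicalType) (R : realType) m n
    (f : T -> 'M[R]_(m, n)) :
  (forall i j, continuous (fun x => f x i j)) -> continuous f.
Proof.
move=> fc x A [P Px sPA]; rewrite nbhs_filterE /=.
have : \forall y \near x, forall ij : 'I_m * 'I_n, P ij.1 ij.2 (f y ij.1 ij.2).
  apply: (@filter_forall _ _
    (fun ij (y : T) => P ij.1 ij.2 (f y ij.1 ij.2)) _ (nbhs_filter x)) => -[i j].
  exact: (fc i j x _ (Px i j)).
by apply: filterS => y Py; apply: sPA => i j; exact: (Py (i, j)).
Qed.

Lemma continuous_sum (T : topologicalType) (R : realType) (V : normedModType R)
    (I : Type) (r : seq I) (P : pred I) (f : I -> T -> V) :
  (forall i, P i -> continuous (f i)) ->
  continuous (fun x => \sum_(i <- r | P i) f i x).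
Proof.
move=> fc x; elim: r => [|i r IHr].
  rewrite (_ : (fun x => _) = cst 0); first exact: cst_continuous.
  by apply/funext => y; rewrite big_nil.
case Pi: (P i).
  rewrite (_ : (fun x => _) = (f i \+ (fun x => \sum_(i <- r | P i) f i x))).
    by apply: continuousD => //; apply: fc.
  by apply/funext => y; rewrite big_cons Pi.
by under eq_fun do rewrite big_cons Pi.
Qed.

Lemma continuous_prod (T : topologicalType) (R : realType)
    (I : Type) (r : seq I) (P : pred I) (f : I -> T -> R) :
  (forall i, P i -> continuous (f i)) ->
  continuous (fun x => \prod_(i <- r | P i) f i x).
Proof.
move=> fc x; elim: r => [|i r IHr].
  rewrite (_ : (fun x => _) = cst 1); first exact: cst_continuous.
  by apply/funext => y; rewrite big_nil.
case Pi: (P i).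
  rewrite (_ : (fun x => _) = (fun x => f i x * \prod_(i <- r | P i) f i x)).
    by apply: continuousM => //; apply: fc.
  by apply/funext => y; rewrite big_cons Pi.
by under eq_fun do rewrite big_cons Pi.
Qed.

Section ContinuousReal.
Context {R : realType} {T : topologicalType}.
Implicit Types f g : T -> R.

Lemma continuous_funD f g : continuous f -> continuous g -> continuous (fun x => f x + g x).
Proof. by move=> fc gc x; apply: (@continuousD _ _ _ f g); [exact: fc|exact: gc]. Qed.

Lemma continuous_funM f g : continuous f -> continuous g -> continuous (fun x => f x * g x).
Proof. by move=> fc gc x; apply: (@continuousM _ _ f g); [exact: fc|exact: gc]. Qed.

Lemma continuous_funB f g : continuous f -> continuous g -> continuous (fun x => f x - g x).
Proof. by move=> fc gc x; apply: (@continuousB _ _ _ f g); [exact: fc|exact: gc]. Qed.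

Lemma continuous_funV f : (forall x, f x != 0) -> continuous f ->
  continuous (fun x => (f x)^-1).
Proof. by move=> f0 fc x; apply: continuousV; [exact: f0|exact: fc]. Qed.

Lemma continuous_funmax f g :
  continuous f -> continuous g -> continuous (fun x => Num.max (f x) (g x)).
Proof. by move=> fc gc x; apply: (@continuous_max _ _ f g x); [exact: fc|exact: gc]. Qed.

End ContinuousReal.

Section Retraction.
Context {R : realType} {n : nat}.

Definition emb (x : simplex R n) : 'rV[R]_n.+1 := set_val x.

Lemma emb_continuous : continuous emb.
Proof. exact: initial_continuous. Qed.
HB.instance Definition _ := isContinuous.Build _ _ emb emb_continuous.

Lemma embP (x : simplex R n) : simplex R n (emb x).
Proof. by have /set_mem := valP x. Qed.

Definition coord_excess (x : 'rV[R]_n.+1) : R := \sum_i Num.max (x 0 i) 0.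

(** Positive parts, rescaled when their sum exceeds 1, with the missing mass put on vertex 0 when it
    does not. The denominator is at least 1, so this is a continuous retraction of the whole space
    onto the simplex. *)
Definition retr_row (x : 'rV[R]_n.+1) : 'rV[R]_n.+1 :=
  \row_i ((Num.max (x 0 i) 0 + (i == ord0)%:R * Num.max (1 - coord_excess x) 0)
          / Num.max 1 (coord_excess x)).

Lemma retr_row_simplex x : retr_row x \in simplex R n.
Proof.
apply/mem_set; split=> [i|].
  rewrite mxE divr_ge0 ?addr_ge0 ?mulr_ge0 ?le_max ?lexx ?orbT ?ler01//.
under eq_bigr do rewrite mxE.
rewrite -mulr_suml big_split /= -/(coord_excess x) -mulr_suml.
rewrite (bigD1 ord0) //= big1 ?addr0 ?mul1r => [|i /negbTE ->]; last by [].
by case: (lerP (coord_excess x) 1) => h; rewrite ?maxEle ?h /=;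
  case: ifP => h'; first [lra | field; lra].
Qed.

Definition retr x : simplex R n := exist _ (retr_row x) (retr_row_simplex x).

Lemma retr_simplex x : simplex R n x -> emb (retr x) = x.
Proof.
move=> [x0 x1]; apply/rowP => i; rewrite /emb /= mxE.
have -> : coord_excess x = 1.
  by rewrite /coord_excess -x1; apply: eq_bigr => j _; rewrite max_l.
by rewrite max_l// subrr !maxxx mulr0 addr0 divr1.
Qed.

Lemma embK x : retr (emb x) = x.
Proof. by apply: val_inj => /=; apply: retr_simplex; exact: embP. Qed.

Lemma coord_excess_continuous : continuous coord_excess.
Proof.
apply: continuous_sum => i _; apply: continuous_funmax; first exact: coord_continuous.
exact: cst_continuous.
Qed.

Lemma retr_continuous : continuous retr.
Proof.
apply/continuous_comp_initial; apply: continuous_mx => i j.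
rewrite /=; under eq_fun do rewrite mxE.
apply: continuous_funM.
  apply: continuous_funD.
    by apply: continuous_funmax; [exact: coord_continuous|exact: cst_continuous].
  apply: continuous_funM; first exact: cst_continuous.
  apply: continuous_funmax; last exact: cst_continuous.
  apply: continuous_funB; [exact: cst_continuous|exact: coord_excess_continuous].
apply: continuous_funV => [x|]; first by rewrite gt_eqF// lt_max ltr01.
apply: continuous_funmax; [exact: cst_continuous|exact: coord_excess_continuous].
Qed.
HB.instance Definition _ := isContinuous.Build _ _ retr retr_continuous.

Lemma simplex_convex : @convex_closed R 'rV[R]_n.+1 (simplex R n).
Proof.
move=> m a p a0 a1 pK; split=> [i|].
  rewrite summxE sumr_ge0// => k _; rewrite mxE mulr_ge0//.
  by have [] := pK k.
under eq_bigr do rewrite summxE; rewrite exchange_big /= -[RHS]a1.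
apply: eq_bigr => k _; have [_ p1] := pK k.
by under eq_bigr do rewrite mxE; rewrite -mulr_sumr p1 mulr1.
Qed.

Lemma simplex_le1 (x : 'rV[R]_n.+1) i : simplex R n x -> x 0 i <= 1.
Proof.
by move=> [x0 <-]; rewrite (bigD1 i) //= lerDl sumr_ge0.
Qed.

Lemma simplex_dist (x y : 'rV[R]_n.+1) : simplex R n x -> simplex R n y ->
  `|x - y| <= 1.
Proof.
move=> xS yS; rewrite [leLHS]/Num.Def.normr /= mx_normrE; apply/bigmax_leP; split=> // -[i j] _ /=.
rewrite !mxE (ord1 i) ler_norml.
have [x0 _] := xS; have [y0 _] := yS.
have := simplex_le1 j xS; have := simplex_le1 j yS; have := x0 j; have := y0 j.
lra.
Qed.

Lemma simplex_compact : compact (simplex R n).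
Proof.
apply: bounded_closed_compact.
  exists 1; split=> [|M ltM x xS]; first exact: num_real.
  apply: le_trans (ltW ltM); rewrite [leLHS]/Num.Def.normr /= mx_normrE.
  apply/bigmax_leP; split=> // -[i j] _ /=; rewrite (ord1 i).
  by have [x0 _] := xS; rewrite ger0_norm// simplex_le1.
rewrite (_ : simplex R n = (\bigcap_(i in setT) [set x : 'rV[R]_n.+1 | 0 <= x 0 i]) `&`
   [set x : 'rV[R]_n.+1 | \sum_i x 0 i = 1]); last first.
  by apply/seteqP; split => x [xa xb]; split => // i; [move=> _; exact: xa|exact: (xa i I)].
apply: closedI.
  apply: closed_bigI => i _.
  by apply: (@closed_comp _ _ (fun x : 'rV[R]_n.+1 => x 0 i) [set y | 0 <= y]) => [x _|];
    [exact: coord_continuous|exact: closed_ge].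
apply: (@closed_comp _ _ (fun x : 'rV[R]_n.+1 => \sum_i x 0 i) [set y | y = 1]) => [x _|].
  by apply: continuous_sum => i _; exact: coord_continuous.
exact: closed_eq.
Qed.

End Retraction.

Section Affine.
Context {R : realType} {E : normedModType R}.

Definition aff n (l : seq E) (x : 'rV[R]_n.+1) : E := \sum_i x 0 i *: nth 0 l i.

Lemma aff_continuous n l : continuous (@aff n l).
Proof.
apply: continuous_sum => i _ x; apply: continuousZr_tmp.
exact: coord_continuous.
Qed.
HB.instance Definition _ n l := isContinuous.Build _ _ (@aff n l) (@aff_continuous n l).

(** In barycentric coordinates an affine simplex is the restriction of a linear map, so naturality
    under linear maps covers all affine simplices. *)
Lemma aff_linear n l : linear (@aff n l).
Proof.
move=> a x y; rewrite /aff scaler_sumr -big_split /=; apply: eq_bigr => i _.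
by rewrite !mxE scalerDl scalerA.
Qed.

Definition std n : seq 'rV[R]_n.+1 := [seq delta_mx 0 i | i <- enum 'I_n.+1].

Lemma size_std n : size (std n) = n.+1.
Proof. by rewrite size_map size_enum_ord. Qed.

Lemma nth_std n (i : 'I_n.+1) : nth 0 (std n) i = delta_mx 0 i.
Proof. by rewrite (nth_map ord0) ?size_enum_ord// nth_ord_enum. Qed.

Lemma std_simplex n : in_list (simplex R n) (std n).
Proof.
move=> x /mapP[i _ ->]; split=> [j|]; first by rewrite mxE ler0n.
rewrite (bigD1 i) //= mxE !eqxx big1 ?addr0// => j /negbTE ji.
by rewrite mxE ji andbF.
Qed.

Lemma map_aff_std n l : size l = n.+1 -> map (@aff n l) (std n) = l.
Proof.
move=> sl; apply: (@eq_from_nth _ 0); first by rewrite size_map size_std.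
move=> i; rewrite size_map size_std => ni; rewrite (nth_map 0) ?size_std//.
rewrite (_ : i = Ordinal ni :> nat)// nth_std /aff (bigD1 (Ordinal ni)) //=.
rewrite mxE !eqxx scale1r big1 ?addr0// => j /negbTE ji.
by rewrite mxE ji andbF scale0r.
Qed.

Lemma aff_convex n (K : E -> Prop) l x : convex_closed K -> size l = n.+1 ->
  in_list K l -> simplex R n x -> K (@aff n l x).
Proof.
move=> cK sl Kl [x0 x1]; apply: cK => // i; apply: Kl.
by rewrite mem_nth// sl.
Qed.

Lemma aff_face n (i : 'I_n.+2) l (x : simplex R n) : size l = n.+2 ->
  @aff n.+1 l (emb (face i x)) = @aff n (take i l ++ drop i.+1 l) (emb x).
Proof.
move=> sl; rewrite /aff (bigD1_ord i) //= mxE unlift_none /= scale0r add0r.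
apply: eq_bigr => k _; rewrite mxE liftK /=; congr (_ *: _).
have il : (i < size l)%N by rewrite sl.
rewrite nth_cat size_take il /bump; case: (leqP i k) => ik /=.
  by rewrite add1n nth_drop addSn subnKC.
by rewrite add0n nth_take.
Qed.

End Affine.

Lemma aff_map (R : realType) (E1 E2 : normedModType R) (F : E1 -> E2) n l x :
  linear F -> size l = n.+1 -> @aff R E2 n (map F l) x = F (@aff R E1 n l x).
Proof.
move=> linF sl; pose FL := GRing.isLinear.Build _ _ _ _ F linF.
pose G : {linear E1 -> E2} := HB.pack F FL.
rewrite -[F]/(G : _ -> _) /aff linear_sum; apply: eq_bigr => i _.
by rewrite linearZ (nth_map 0)// sl.
Qed.

Section Hat.
Context {R : realType} {X : topologicalType}.

(** A cochain seen through [h] as a function of vertex lists. The value 0 on lists of the wrong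
    length lets one untyped calculus of lists serve every degree. *)
Definition hat {E : normedModType R} n (c : cochain R X n) (h : continuousType E X)
    (l : seq E) : int :=
  if size l == n.+1 then c (h \o @aff R E n l \o emb) else 0.

Lemma hat_std n (c : cochain R X n) (s : singular_simplex R X n) :
  hat c (s \o retr) (std n) = c s.
Proof.
rewrite /hat size_std eqxx; congr c; apply/continuousEP => x /=.
rewrite -[in RHS](embK x); congr (s (retr _)).
apply/rowP => j; rewrite /aff summxE (bigD1 j) //= nth_std !mxE !eqxx mulr1.
rewrite big1 ?addr0// => i /negbTE ij.
by rewrite nth_std !mxE eqxx eq_sym ij mulr0.
Qed.

Lemma ld_hat (E : normedModType R) n (c : cochain R X n) (h : continuousType E X) l :
  ld l (hat c h) = hat (coboundary c) h l.
Proof.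
rewrite ld_sum {2}/hat; case: eqVneq => sl.
  rewrite sl /coboundary; apply: eq_bigr => i _; congr (_ * _).
  have il : (i < size l)%N by rewrite sl.
  rewrite /hat size_cat size_take il size_drop sl.
  rewrite ifT; last by have := ltn_ord i; lia.
  by congr c; apply/continuousEP => x /=; rewrite aff_face.
rewrite big1// => i _; rewrite /hat size_cat size_take ltn_ord size_drop.
rewrite ifF ?mulr0//; apply/negbTE/eqP => e; case/eqP: sl; by rewrite -e -addSn subnKC.
Qed.

Lemma hat_eq (E : normedModType R) n (c : cochain R X n) (h h' : continuousType E X)
    (K : E -> Prop) l : convex_closed K -> in_list K l ->
  (forall x, K x -> h x = h' x) -> hat c h l = hat c h' l.
Proof.
move=> cK Kl hh; rewrite /hat; case: eqVneq => // sl.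
congr c; apply/continuousEP => x /=; apply: hh; apply: aff_convex => //.
exact: embP.
Qed.

Lemma hat_map (E1 E2 : normedModType R) n (c : cochain R X n) (h : continuousType E2 X)
  (h' : continuousType E1 X) (F : E1 -> E2) l :
  linear F -> (forall x, h' x = h (F x)) -> hat c h (map F l) = hat c h' l.
Proof.
move=> linF hF; rewrite /hat size_map; case: eqVneq => // sl.
by congr c; apply/continuousEP => x /=; rewrite hF aff_map.
Qed.

End Hat.

Lemma continuous_pair (T U V : topologicalType) (f : T -> U) (g : T -> V) :
  continuous f -> continuous g -> continuous (fun x => (f x, g x)).
Proof. by move=> fc gc x; exact: (cvg_pair (fc x) (gc x)). Qed.

Lemma continuous_fst (U V : topologicalType) : continuous (@fst U V).
Proof. by case=> u v; exact: cvg_fst. Qed.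

Lemma continuous_snd (U V : topologicalType) : continuous (@snd U V).
Proof. by case=> u v; exact: cvg_snd. Qed.

Lemma continuous_o (T U V : topologicalType) (f : T -> U) (g : U -> V) :
  continuous f -> continuous g -> continuous (fun x => g (f x)).
Proof. by move=> fc gc x; apply: (@continuous_comp _ _ _ f g); [exact: fc|exact: gc]. Qed.

(** * Natural operators on vertex lists and their action on singular cochains *)

Section NaturalOperators.
Context {R : realType}.

(** The factor [R] is the time of a homotopy: cochains on [E * R] are turned into cochains on
    [E]. *)
Definition nat_op := forall E : normedModType R, (seq (E * R) -> int) -> seq E -> int.

Definition lift_fst (E1 E2 : Type) (F : E1 -> E2) (p : E1 * R) : E2 * R := (F p.1, p.2).

Definition natural_op (op : nat_op) := forall (E1 E2 : normedModType R) (F : E1 -> E2),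
  linear F -> forall c l,
  op E2 c (map F l) = op E1 (fun k => c (map (lift_fst F) k)) l.

Definition slab (E : Type) (K : E -> Prop) (p : E * R) := K p.1 /\ 0 <= p.2 <= 1.

Definition local_op (op : nat_op) := forall (E : normedModType R) (K : E -> Prop),
  convex_closed K -> op_local K (slab K) (op E).

Lemma slab_convex (E : normedModType R) (K : E -> Prop) :
  convex_closed K -> convex_closed (slab K).
Proof.
move=> cK n a p a0 a1 Kp.
have fstE : (\sum_i a i *: p i).1 = \sum_i a i *: (p i).1.
  by elim/big_rec2: _ => //= i y1 y2 _ <-.
have sndE : (\sum_i a i *: p i).2 = \sum_i a i * (p i).2.
  by elim/big_rec2: _ => //= i y1 y2 _ <-.
split; first by rewrite fstE; apply: cK => // i; case: (Kp i).
rewrite sndE sumr_ge0/= => [|i _]; last by rewrite mulr_ge0//; case: (Kp i) => _ /andP[].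
rewrite -[leRHS]a1; apply: ler_sum => i _.
by rewrite ler_piMr//; case: (Kp i) => _ /andP[].
Qed.

Lemma lift_fst_linear (E1 E2 : normedModType R) (F : E1 -> E2) : linear F ->
  linear (lift_fst F : E1 * R -> E2 * R).
Proof. by move=> linF a [x s] [y t]; rewrite /lift_fst /= linF. Qed.

Lemma lift_fst_continuous (T1 T2 : topologicalType) (h : continuousType T1 T2) :
  continuous (lift_fst h : T1 * R -> T2 * R).
Proof.
apply: continuous_pair; last exact: continuous_snd.
by apply: continuous_o; [exact: continuous_fst|exact: cts_fun].
Qed.
HB.instance Definition _ (T1 T2 : topologicalType) (h : continuousType T1 T2) :=
  isContinuous.Build _ _ _ (@lift_fst_continuous T1 T2 h).

Variables X X' : topologicalType.
Variables (op : nat_op) (nop : natural_op op) (lop : local_op op).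

Definition pull_op n m (H : continuousType (X * R)%type X') (c : cochain R X' m) :
    cochain R X n :=
  fun s => op (hat c (H \o lift_fst (s \o retr))) (std n).
Arguments pull_op n {m} H c s.

(** Locality on the standard simplex removes the retraction hidden in [pull_op]; naturality under
    the linear map [aff l] then moves the standard vertices to [l]. This is what lets identities
    between list operators pass to the faces of a singular simplex. *)
Lemma hat_pull_op n m (H : continuousType (X * R)%type X') (c : cochain R X' m)
    (E : normedModType R) (h : continuousType E X) l : size l = n.+1 ->
  hat (pull_op n H c) h l = op (hat c (H \o lift_fst h)) l.
Proof.
move=> sl; rewrite {1}/hat sl eqxx /pull_op.
rewrite (lop (@simplex_convex R n)
  (c' := hat c (H \o lift_fst (h \o @aff R E n l))) (@std_simplex R n)); last first.
  move=> k Kk; apply: (hat_eq c (slab_convex (@simplex_convex R n)) Kk) => -[x t] [/= xS _].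
  by rewrite /lift_fst /= retr_simplex.
rewrite -[in RHS](map_aff_std sl) nop; last exact: aff_linear.
congr (op _ (std n)); apply/funext => k; symmetry; apply: hat_map => //.
by apply: lift_fst_linear; exact: aff_linear.
Qed.

Lemma pull_op_ext n m (H : continuousType (X * R)%type X') (c c' : cochain R X' m)
    (s : singular_simplex R X n) :
  (forall k : seq ('rV[R]_n.+1 * R), in_list (slab (simplex R n)) k ->
     hat c (H \o lift_fst (s \o retr)) k = hat c' (H \o lift_fst (s \o retr)) k) ->
  pull_op n H c s = pull_op n H c' s.
Proof. by move=> cc'; apply: (lop (@simplex_convex R n)) => //; exact: std_simplex. Qed.

End NaturalOperators.

Arguments pull_op {R X X'} op n {m} H c s.

Section Prisms.
Context {R : realType}.

Definition i0 (E : normedModType R) (c : seq (E * R) -> int) l :=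
  c (map (fun x : E => (x, 0 : R)) l).
Definition i1 (E : normedModType R) (c : seq (E * R) -> int) l :=
  c (map (fun x : E => (x, 1 : R)) l).
Definition s0 (E : normedModType R) (c : seq (E * R) -> int) l := subdiv bary (i0 c) l.
Definition apex (E : normedModType R) (l : seq E) : E * R := (bary l, 0).

Definition prism : nat_op := fun E => cylinder (@apex E) (@i0 E) (@i1 E).
(** The homotopy between two consecutive iterates of subdivision. All its vertices have time 0; the
    time coordinate gives it the same type as [prism]. *)
Definition subdiv_prism i : nat_op :=
  fun E c => cylinder (@apex E) (@i0 E) (@s0 E) (iter i (subdiv bary) c).

Lemma bary_map (E1 E2 : normedModType R) (F : E1 -> E2) l :
  linear F -> bary (map F l) = F (bary l).
Proof.
move=> linF; pose FL := GRing.isLinear.Build _ _ _ _ F linF.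
pose G : {linear E1 -> E2} := HB.pack F FL.
by rewrite /bary size_map big_map -[F]/(G : _ -> _) linearZ (linear_sum G).
Qed.

Lemma apex_map (E1 E2 : normedModType R) (F : E1 -> E2) l :
  linear F -> apex (map F l) = lift_fst F (apex l).
Proof. by move=> linF; rewrite /apex bary_map. Qed.

Lemma i0_natural : natural_op i0.
Proof. by move=> E1 E2 F linF c l; rewrite /i0 -map_comp -[in RHS]map_comp. Qed.
Lemma i1_natural : natural_op i1.
Proof. by move=> E1 E2 F linF c l; rewrite /i1 -map_comp -[in RHS]map_comp. Qed.
Lemma s0_natural : natural_op s0.
Proof.
move=> E1 E2 F linF c l; rewrite /s0 (subdiv_map (b1 := bary)); last first.
  by move=> k; rewrite bary_map.
by congr subdiv; apply/funext => k; rewrite i0_natural.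
Qed.

Lemma slab0_closed (E : normedModType R) (K : E -> Prop) l (t : R) : 0 <= t <= 1 ->
  in_list K l -> in_list (slab K) (map (fun x : E => (x, t)) l).
Proof. by move=> t01 Kl p /mapP[x /Kl Kx ->]. Qed.

Lemma i0_local : local_op i0.
Proof. by move=> E K cK c c' l Kl; apply; apply: slab0_closed; rewrite ?lexx ?ler01. Qed.
Lemma i1_local : local_op i1.
Proof. by move=> E K cK c c' l Kl; apply; apply: slab0_closed; rewrite ?lexx ?ler01. Qed.
Lemma s0_local : local_op s0.
Proof.
move=> E K cK c c' l Kl cc'; apply: (subdiv_local cK) => // k Kk.
exact: i0_local cc'.
Qed.

Lemma apex_slab (E : normedModType R) (K : E -> Prop) l : convex_closed K ->
  l != [::] -> in_list K l -> slab K (apex l).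
Proof. by move=> cK l0 Kl; split; [exact: bary_convex | rewrite /= lexx ler01]. Qed.

Lemma prism_natural : natural_op prism.
Proof.
move=> E1 E2 F linF c l; apply: cylinder_map => [k|c' k|c' k].
- exact: apex_map.
- exact: i0_natural.
- exact: i1_natural.
Qed.

Lemma prism_local : local_op prism.
Proof.
move=> E K cK; apply: cylinder_local; [|exact: i0_local|exact: i1_local].
by move=> l l0 Kl; exact: apex_slab.
Qed.

Lemma iter_subdiv_map i (E1 E2 : normedModType R) (F : E1 -> E2) c l : linear F ->
  iter i (subdiv bary) c (map F l) = iter i (subdiv bary) (fun k => c (map F k)) l.
Proof.
move=> linF; elim: i c l => //= i IHi c l.
rewrite (subdiv_map (b1 := bary)); last by move=> k; rewrite bary_map.
by congr subdiv; apply/funext => k; rewrite IHi.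
Qed.

Lemma iter_subdiv_local i (E : normedModType R) (K : E -> Prop) :
  convex_closed K -> op_local K K (iter i (subdiv bary)).
Proof.
move=> cK; elim: i => [|i IHi] c c' l Kl cc' /=; first exact: cc'.
by apply: (subdiv_local cK) => // k Kk; exact: IHi.
Qed.

Lemma subdiv_prism_natural i : natural_op (subdiv_prism i).
Proof.
move=> E1 E2 F linF c l; rewrite /subdiv_prism.
rewrite (cylinder_map (F' := lift_fst F) (b1 := @apex E1) (al1 := @i0 E1) (be1 := @s0 E1)).
- congr cylinder; apply/funext => k; apply: iter_subdiv_map.
  exact: lift_fst_linear.
- by move=> k; exact: apex_map.
- by move=> c' k; exact: i0_natural.
- by move=> c' k; exact: s0_natural.
Qed.

Lemma subdiv_prism_local i : local_op (subdiv_prism i).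
Proof.
move=> E K cK c c' l Kl cc'; rewrite /subdiv_prism.
apply: (cylinder_local (K := K) (K' := slab K)) => //.
- by move=> k k0 Kk; exact: apex_slab.
- exact: (i0_local cK).
- exact: (s0_local cK).
- by move=> k Kk; apply: (@iter_subdiv_local i (E * R)%type _ (slab_convex cK)).
Qed.

Lemma i0_chain E : op_chain (@i0 E). Proof. by move=> f l; rewrite /i0 ld_map. Qed.
Lemma i1_chain E : op_chain (@i1 E). Proof. by move=> f l; rewrite /i1 ld_map. Qed.
Lemma s0_chain E : op_chain (@s0 E).
Proof.
move=> f l; rewrite /s0 -subdiv_chain; congr subdiv; apply/funext => k.
exact: i0_chain.
Qed.
Lemma s0B E : op_additive (@s0 E). Proof. by move=> f g l; rewrite /s0 -subdivB. Qed.

Lemma prism_homotopy E c l :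
  @prism E (fun k => ld k c) l + ld l (prism c) = i0 c l - i1 c l.
Proof.
by apply: cylinder_homotopy => //; [exact: i0_chain|exact: i1_chain].
Qed.

Lemma iter_subdiv_chain i (E : normedModType R) : op_chain (iter i (@subdiv E bary)).
Proof.
elim: i => [//|i IHi] f l /=; rewrite -subdiv_chain; congr subdiv.
by apply/funext => k; rewrite IHi.
Qed.

Lemma iter_subdiv_i0 j (E : normedModType R) (c : seq (E * R) -> int) k :
  i0 (iter j (subdiv bary) c) k = iter j (subdiv bary) (i0 c) k.
Proof.
rewrite /i0 iter_subdiv_map //.
by move=> a x y; congr pair; rewrite /= ?scaler0 ?addr0.
Qed.

Lemma subdiv_prism_homotopy i E c l :
  @subdiv_prism i E (fun k => ld k c) l + ld l (subdiv_prism i c) =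
  iter i (subdiv bary) (i0 c) l - iter i.+1 (subdiv bary) (i0 c) l.
Proof.
rewrite /subdiv_prism (_ : iter i _ _ = fun k => ld k (iter i (subdiv bary) c)); last first.
  by apply/funext => k; rewrite iter_subdiv_chain.
rewrite cylinder_homotopy //; [|exact: s0B|exact: i0_chain|exact: s0_chain].
by rewrite /s0 iter_subdiv_i0 /=; congr (_ - subdiv _ _ _); apply/funext => k;
  rewrite iter_subdiv_i0.
Qed.

End Prisms.

Section OpCoboundary.
Context {R : realType} {X X' : topologicalType}.
Variables (op : @nat_op R) (nop : natural_op op) (lop : local_op op).
Variable H : continuousType (X * R)%type X'.

Lemma pull_op_cobE n m (c : cochain R X' m) (s : singular_simplex R X n) :
  pull_op op n H (coboundary c) s =
  op (fun k => ld k (hat c (H \o lift_fst (s \o retr)))) (std n).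
Proof. by congr op; apply/funext => k; rewrite ld_hat. Qed.

Lemma cob_pull_opE n m (c : cochain R X' m) (s : singular_simplex R X n.+1) :
  coboundary (pull_op op n H c) s =
  ld (std n.+1) (op (hat c (H \o lift_fst (s \o retr)))).
Proof.
rewrite -[LHS]hat_std -ld_hat; apply: eq_ld => k; rewrite size_std /= => sk _.
exact: hat_pull_op.
Qed.

Lemma pull_op0 n m (c : cochain R X' m) (s : singular_simplex R X n) :
  (forall E, op_additive (@op E)) ->
  (forall k : seq ('rV[R]_n.+1 * R), in_list (slab (simplex R n)) k ->
     hat c (H \o lift_fst (s \o retr)) k = 0) ->
  pull_op op n H c s = 0.
Proof.
move=> opB c0.
rewrite (@pull_op_ext _ _ _ _ lop n m H c 0 s); last first.
  by move=> k Kk; rewrite c0// /hat; case: ifP.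
rewrite /pull_op; set h := hat _ _.
have := opB _ h h (std n); rewrite subrr => <-.
by congr op; apply/funext => k; rewrite /h /hat; case: ifP.
Qed.

End OpCoboundary.

(** * Relative cochains and homotopy invariance *)

Section Vanishing.
Context {R : realType} {X : topologicalType}.
Implicit Types F : set (set X).

(** For a single set [A] these are the cochains of the pair (X, A), for a cover the cochains
    relative to the small simplices, and for [set0] all cochains. *)
Definition vanishing F n (c : cochain R X n) :=
  forall A (s : singular_simplex R X n), F A -> (forall x, A (s x)) -> c s = 0.

(** In degree 0 only the zero cochain bounds, since there are no cochains of degree -1. *)
Definition bounds F n : cochain R X n -> Prop :=
  match n with
  | 0 => fun c => c = 0
  | m.+1 => fun c => exists2 b : cochain R X m, vanishing F b & c = coboundary b
  end.

End Vanishing.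

Definition pull (R : realType) (X X' : topologicalType) (f : continuousType X X') n
  (c : cochain R X' n) : cochain R X n := fun s => c (f \o s).

Lemma sum_pair (U V : nmodType) (I : Type) (r : seq I) (f : I -> U) (g : I -> V) :
  \sum_(i <- r) (f i, g i) = (\sum_(i <- r) f i, \sum_(i <- r) g i).
Proof. by elim: r => [|i r IHr]; rewrite ?big_nil// !big_cons IHr. Qed.

Lemma hat_slice (R : realType) (E : normedModType R) (X : topologicalType) n
    (c : cochain R X n) (h : continuousType (E * R)%type X) (h' : continuousType E X) t l :
  (forall x, h' x = h (x, t)) -> hat c h (map (fun x : E => (x, t)) l) = hat c h' l.
Proof.
move=> hh; rewrite /hat size_map; case: eqVneq => // sl; congr c; apply/continuousEP => x /=.
rewrite hh; congr (h _); rewrite /aff.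
have [x0 x1] := embP x.
transitivity (\sum_(i < n.+1) (emb x 0 i *: nth 0 l i, emb x 0 i * t)).
  by apply: eq_bigr => i _; rewrite (nth_map 0) ?sl.
by rewrite sum_pair -mulr_suml x1 mul1r.
Qed.

Section Homotopy.
Context {R : realType} {X X' : topologicalType}.

Lemma prismB E : op_additive (@prism R E).
Proof. exact: cylinderB. Qed.

(** The prism of [c] along [H] is a primitive. It vanishes on the sets of [F] because the prism over
    a simplex in [A] stays over [A] with time in [0, 1], which [H] sends into a set of [F']. *)
Lemma homotopy_bounds (F : set (set X)) (F' : set (set X'))
    (H : continuousType (X * R)%type X') (f0 f1 : continuousType X X') n
    (c : cochain R X' n) :
  (forall x, f0 x = H (x, 0)) -> (forall x, f1 x = H (x, 1)) ->
  (forall A, F A -> exists2 A', F' A' & forall x t, 0 <= t <= 1 -> A x -> A' (H (x, t))) ->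
  vanishing F' c -> coboundary c = 0 -> bounds F (pull f0 c - pull f1 c).
Proof.
move=> H0 H1 HF vc dc.
have key (s : singular_simplex R X n) : (pull f0 c - pull f1 c) s =
    ld (std n) (prism (hat c (H \o lift_fst (s \o retr)))).
  have := prism_homotopy (hat c (H \o lift_fst (s \o retr))) (std n).
  rewrite -(pull_op_cobE prism H) dc {1}/pull_op.
  set z := prism _ _; have -> : z = 0.
    apply: (@pull_op0 _ _ _ _ prism_local H n n.+1 0 s) => [|k _]; first exact: prismB.
    by rewrite /hat; case: ifP.
  rewrite add0r => ->.
  rewrite /i0 (@hat_slice _ _ _ _ _ _ ((f0 \o s) \o retr)) ?hat_std => [|x]; last by rewrite /= H0.
  by rewrite /i1 (@hat_slice _ _ _ _ _ _ ((f1 \o s) \o retr)) ?hat_std => [|x]; last by rewrite /= H1.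
case: n => [|n] in c vc dc key *.
  (* In degree 0 the right side is the value of the prism on the empty list, which is zero. *)
  apply/funext => s; rewrite key; have := size_std (R := R) 0.
  by case: (std 0) => [|x []] // _; rewrite /= subr0.
exists (pull_op prism n H c).
  move=> A s FA sA; have [A' FA' AH] := HF _ FA.
  apply: pull_op0 => [|E|k Kk]; [exact: prism_local|exact: prismB|].
  rewrite /hat; case: eqVneq => // sk; apply: (vc _ _ FA') => x /=.
  have [p1 p2] := aff_convex (slab_convex (@simplex_convex R n)) sk Kk (embP x).
  exact: (AH _ _ p2 (sA _)).
apply/funext => s; rewrite key cob_pull_opE //; [exact: prism_natural|exact: prism_local].
Qed.

End Homotopy.

(** * The theorem of small simplices *)

Section SmallSimplices.
Context {R : realType} {X : topologicalType}.
Variable F : set (set X).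
Hypothesis oF : forall A, F A -> open A.

Let H : continuousType (X * R)%type X := mkcts (@continuous_fst X R).

Definition cover_union : set X := \bigcup_(A in F) A.

(** Compactness of the simplex in its near-covering form. The balls are taken in the ambient space
    and mapped back by [retr]. *)
Lemma lebesgue_number n (s : singular_simplex R X n) :
  (forall x, cover_union (s x)) ->
  exists2 e : R, 0 < e & forall x, simplex R n x -> exists2 A, F A &
    forall y, `|x - y| < e -> A (s (retr y)).
Proof.
move=> sU.
have /compact_near_coveringP cpt := @simplex_compact R n.
pose P (e : R) (x : 'rV[R]_n.+1) := exists2 A, F A & forall y, `|x - y| < e -> A (s (retr y)).
have : \forall e \near 0^'+, simplex R n `<=` P e.
  apply: cpt => x xS; have [A FA Ax] := sU (retr x).
  have oA : open ((s \o retr) @^-1` A).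
    by apply: open_comp; [move=> y _; exact: cts_fun|exact: oF].
  have : nbhs x ((s \o retr) @^-1` A) by apply: open_nbhs_nbhs.
  move=> /nbhs_normP[e /= e0 xeA].
  near=> y e'; exists A => // z yz; apply: xeA => /=.
  have xy : `|x - y| < e / 2 by near: y; apply: cvgr_dist_lt => //; rewrite divr_gt0.
  have e'e : e' < e / 2 by near: e'; apply: nbhs_right_lt; rewrite divr_gt0.
  rewrite -[x - z](subrKA y); apply: le_lt_trans (ler_normD _ _) _.
  rewrite [ltRHS](splitr e) ltrD//; exact: lt_trans yz _.
move=> nearP; near (0 : R)^'+ => e; exists e; first by near: e; exact: nbhs_right_gt.
by near: e.
Unshelve. all: by end_near. Qed.

Lemma mesh_small (q C e : R) : 0 <= q -> q < 1 -> 0 <= C -> 0 < e ->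
  exists N, forall i, (N <= i)%N -> q ^+ i * C < e.
Proof.
move=> q0 q1 C0 e0.
have q1' : `|q| < 1 by rewrite ger0_norm.
have := @cvgrPdist_lt _ _ _ _ _ (GRing.exp q) 0.
move=> /(_ \oo _) [+ _] => /(_ (cvg_expr q1')) /(_ (e / (C + 1))).
have C1 : 0 < C + 1 by rewrite ltr_wpDl.
move=> /(_ (divr_gt0 e0 C1)) [N _ NP]; exists N => i Ni.
have := NP i Ni; rewrite /= sub0r normrN ger0_norm ?exprn_ge0// => qi.
apply: (@le_lt_trans _ _ (q ^+ i * (C + 1))).
  by rewrite ler_wpM2l ?exprn_ge0// lerDl.
by rewrite -ltr_pdivlMr.
Qed.

Lemma iter_subdiv0 (E : normedModType R) j (l : seq E) :
  iter j (subdiv bary) (fun=> 0 : int) l = 0.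
Proof.
elim: j l => //= j IHj l; pose z (k : seq E) : int := 0.
have -> : iter j (subdiv bary) (fun=> 0) = z by apply/funext => k; exact: IHj.
by rewrite -(subrr (subdiv bary z l)) -subdivB.
Qed.

(** The threshold is uniform over all lists in the slab: the slab over the simplex has diameter at
    most 1 in the sup norm, and the mesh ratio depends only on the length [m.+1]. *)
Lemma small_vanish n m (s : singular_simplex R X n) (c : cochain R X m) :
  (forall x, cover_union (s x)) -> vanishing F c ->
  exists N, forall i, (N <= i)%N ->
  forall k : seq ('rV[R]_n.+1 * R), in_list (slab (simplex R n)) k ->
    iter i (subdiv bary) (hat c (H \o lift_fst (s \o retr))) k = 0.
Proof.
move=> sU vc; have [e e0 eP] := lebesgue_number sU.
have [N NP] := mesh_small (@mesh_ratio_ge0 R m.+1) (@mesh_ratio_lt1 R m.+1) ler01 e0.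
exists N => i Ni k Kk; set c' := hat _ _.
rewrite -[RHS](iter_subdiv0 i k).
apply: (iter_subdiv_small (slab_convex (@simplex_convex R n)) Kk (rho := 1)).
  move=> x y /Kk[x1 /andP[x2 x2']] /Kk[y1 /andP[y2 y2']].
  rewrite prod_normE ge_max simplex_dist //= ler_norml; lra.
move=> k' sk' Kk' dk'; rewrite /c' /hat; case: eqVneq => // skm.
have /nth_index : (nth 0 k' 0) \in k' by rewrite mem_nth// skm.
set p0 := nth 0 k' 0 => _.
have p0k : p0 \in k' by rewrite mem_nth// skm.
have [A FA eA] := eP p0.1 (Kk' _ p0k).1.
apply: (vc A) => // x /=; apply: eA.
set p := aff _ _; suff : `|p0 - p| < e.
  by rewrite prod_normE gt_max => /andP[].
apply: le_lt_trans (NP i Ni).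
have cB := @convex_closed_ball R ('rV[R]_n.+1 * R)%type p0 (mesh_ratio m.+1 ^+ i * 1).
apply: (aff_convex cB skm _ (embP x)) => y yk'.
by have := dk' _ _ p0k yk'; rewrite -sk' skm.
Qed.

Lemma subdiv_prismB i E : op_additive (@subdiv_prism R i E).
Proof.
move=> f g l; rewrite /subdiv_prism -cylinderB//; last exact: s0B.
congr cylinder; apply/funext => k; elim: i k => //= i IHi k.
by rewrite -subdivB; congr subdiv; apply/funext => k'; rewrite IHi.
Qed.

Lemma subdiv_prism_eq0 i (E : normedModType R) (K : E -> Prop) c l :
  convex_closed K -> in_list K l ->
  (forall k, in_list (slab K) k -> iter i (subdiv bary) c k = 0) ->
  subdiv_prism i c l = 0.
Proof.
move=> cK Kl c0; rewrite /subdiv_prism.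
pose z (k : seq (E * R)) : int := 0.
rewrite (@cylinder_local _ _ K (slab K) (@apex R E) _ _ _ (i0_local cK) (s0_local cK) _ z)//.
  have := @cylinderB _ _ (@apex R E) (@i0 R E) (@s0 R E) _ (@s0B R E) z z l.
  rewrite subrr => <- //.
by move=> k k0 Kk; exact: apex_slab.
Qed.

Lemma telescope_sum_int (a : nat -> int) N : \sum_(i < N) (a i - a i.+1) = a 0 - a N.
Proof.
elim: N => [|N IHN]; first by rewrite big_ord0 subrr.
by rewrite big_ord_recr /= IHN; lia.
Qed.

(* The correction is the locally finite sum of the subdivision prisms applied
   to all iterated subdivisions of [c]. *)
Theorem small_simplices n (c : cochain R X n) :
  vanishing F c -> vanishing [set cover_union] (coboundary c) ->
  exists2 f : cochain R X n, vanishing [set cover_union] f & bounds F (c - f).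
Proof.
case: n c => [|n] c vc vdc.
  (* A 0-simplex in the union is a point, hence lies in one member of the cover, where [c] already
     vanishes. *)
  exists c; last by rewrite /= subrr.
  move=> _ s -> sU; have [A FA As] := sU (retr (delta_mx 0 0)).
  apply: (vc A s FA) => x.
  suff -> : x = retr (delta_mx 0 0) by [].
  rewrite -(embK x); congr retr; apply/rowP => i; rewrite (ord1 i) mxE eqxx.
  by have [_] := embP x; rewrite big_ord1.
pose b i : cochain R X n := pull_op (subdiv_prism i) n H c.
have bF i : vanishing F (b i).
  move=> A s FA sA; apply: pull_op0 => [|E|k Kk].
  - exact: subdiv_prism_local.
  - exact: subdiv_prismB.
  rewrite /hat; case: eqVneq => // sk; apply: (vc _ _ FA) => x /=; exact: sA.
have db i (s : singular_simplex R X n.+1) : (forall x, cover_union (s x)) -> coboundary (b i) s =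
    iter i (subdiv bary) (i0 (hat c (H \o lift_fst (s \o retr)))) (std n.+1) -
    iter i.+1 (subdiv bary) (i0 (hat c (H \o lift_fst (s \o retr)))) (std n.+1).
  move=> sU; rewrite -subdiv_prism_homotopy -(pull_op_cobE (subdiv_prism i) H).
  rewrite pull_op0 ?add0r.
  - by apply: cob_pull_opE; [exact: subdiv_prism_natural|exact: subdiv_prism_local].
  - exact: subdiv_prism_local.
  - by move=> E; exact: subdiv_prismB.
  move=> k Kk; rewrite /hat; case: eqVneq => // sk.
  by apply: (vdc cover_union) => // x /=; exact: sU.
(* On a simplex in the union only finitely many prisms contribute. Elsewhere the sum is given the
   default value 0. *)
have bfin (s : singular_simplex R X n) : exists v : int, (forall x, cover_union (s x)) ->
    exists N0, forall N, (N0 <= N)%N -> \sum_(i < N) b i s = v.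
  have [sU|nsU] := pselect (forall x, cover_union (s x)); last by exists 0.
  have [N0 NP] := small_vanish sU vc.
  exists (\sum_(i < N0) b i s) => _; exists N0 => N N0N.
  rewrite -(big_mkord xpredT (fun i => b i s)) (big_cat_nat _ N0N)//= big_mkord.
  rewrite [X in _ + X]big_nat_cond [X in _ + X]big1 ?addr0// => i /andP[/andP[Ni _] _].
  apply: (subdiv_prism_eq0 (@simplex_convex R n)); first exact: std_simplex.
  by move=> k Kk; apply: NP.
have [v vP] := choice bfin.
pose bb : cochain R X n := v.
have bbF : vanishing F bb.
  move=> A s FA sA; have [|N0 NP] := vP s; first by move=> x; exists A.
  by rewrite /bb -(NP N0 (leqnn _)) big1// => i _; apply: (bF i A).
exists (c - coboundary bb); last by exists bb => //; rewrite opprB addrC subrK.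
move=> _ s -> sU.
have fU (j : 'I_n.+2) : forall x, cover_union (restrict_face j s x) by move=> x; exact: sU.
have [N1 N1P] := choice (fun j => vP _ (fU j)).
have [N2 N2P] := small_vanish sU vc.
(* [N] has to pass the threshold of [s] and those of all its faces, so that the remainder of the
   telescoping sum and the tails on the faces all vanish. *)
pose N := maxn N2 (\max_j N1 j).
rewrite -[LHS]/(c s - coboundary bb s).
suff -> : coboundary bb s = \sum_(i < N) coboundary (b i) s.
  under eq_bigr => i _ do rewrite db//.
  rewrite (telescope_sum_int (fun i => iter i (subdiv bary) _ _)) /=.
  rewrite -(iter_subdiv_i0 N) [X in _ - (_ - X)]N2P ?leq_maxl//; last first.
    by apply: slab0_closed; [rewrite lexx ler01|exact: std_simplex].
  rewrite /i0 (@hat_slice _ _ _ _ _ _ (s \o retr)) ?hat_std//.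
  by rewrite subr0 subrr.
rewrite /coboundary exchange_big /=; apply: eq_bigr => j _; rewrite -mulr_sumr; congr (_ * _).
symmetry; apply: N1P; apply: leq_trans (leq_maxr _ _).
exact: (leq_bigmax j).
Qed.

End SmallSimplices.

Section CochainCalculus.
Context {R : realType} {X : topologicalType}.
Implicit Types (F : set (set X)) (A B : set X).

Lemma coboundary_coboundary n (c : cochain R X n) : coboundary (coboundary c) = 0.
Proof.
apply/funext => s; rewrite -(hat_std (coboundary _)) -ld_hat -[RHS](ldld (std n.+2) (hat c (s \o retr))).
by apply: eq_ld => k _ _; rewrite ld_hat.
Qed.

Lemma coboundaryB n (c e : cochain R X n) :
  coboundary (c - e) = coboundary c - coboundary e.
Proof. exact: coboundary_is_zmod_morphism. Qed.

Lemma coboundaryD n (c e : cochain R X n) :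
  coboundary (c + e) = coboundary c + coboundary e.
Proof. by rewrite [LHS]raddfD. Qed.

Lemma coboundaryMz n (c : cochain R X n) a : coboundary (c *~ a) = coboundary c *~ a.
Proof. by rewrite [LHS]raddfMz. Qed.

Lemma coboundary0 n : coboundary (0 : cochain R X n) = 0.
Proof. by rewrite [LHS]raddf0. Qed.

Lemma cochain_mulrzE n (c : cochain R X n) (a : int) s : (c *~ a) s = c s * a.
Proof.
have natE m : (c *+ m) s = c s * m%:Z.
  elim: m => [|m IHm]; first by rewrite mulr0n mulr0.
  by rewrite mulrS -[LHS]/(c s + (c *+ m) s) IHm intS mulrDr mulr1.
case: a => m; first exact: natE.
by rewrite NegzE mulrNz -[LHS]/(- ((c *+ m.+1) s)) natE mulrN.
Qed.

Lemma cochain_addE n (c e : cochain R X n) s : (c + e) s = c s + e s.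
Proof. by []. Qed.

Lemma cochain_oppE n (c : cochain R X n) s : (- c) s = - c s.
Proof. by []. Qed.

Definition cochainE := (cochain_addE, cochain_oppE, cochain_mulrzE).

Lemma vanishing0 F n : vanishing F (0 : cochain R X n). Proof. by []. Qed.

Lemma vanishingD F n (c e : cochain R X n) :
  vanishing F c -> vanishing F e -> vanishing F (c + e).
Proof. by move=> vc ve A s FA As; rewrite -[LHS]/(c s + e s) (vc A)// (ve A). Qed.

Lemma vanishingB F n (c e : cochain R X n) :
  vanishing F c -> vanishing F e -> vanishing F (c - e).
Proof. by move=> vc ve A s FA As; rewrite -[LHS]/(c s - e s) (vc A)// (ve A). Qed.

Lemma vanishingMz F n (c : cochain R X n) a : vanishing F c -> vanishing F (c *~ a).
Proof. by move=> vc A s FA As; rewrite cochain_mulrzE (vc A)// mul0r. Qed.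

Lemma vanishing_cob F n (c : cochain R X n) : vanishing F c -> vanishing F (coboundary c).
Proof.
move=> vc A s FA As; rewrite /coboundary big1// => i _.
by rewrite (vc A) ?mulr0// => x; exact: As.
Qed.

Lemma vanishing_sub F F' n (c : cochain R X n) :
  (forall A, F' A -> exists2 B, F B & A `<=` B) -> vanishing F c -> vanishing F' c.
Proof. by move=> FF' vc A s /FF'[B FB AB] As; apply: (vc B) => // x; exact/AB. Qed.

Lemma vanishing_set1 A B n (c : cochain R X n) :
  A `<=` B -> vanishing [set B] c -> vanishing [set A] c.
Proof. by move=> AB; apply: vanishing_sub => _ ->; exists B. Qed.

Lemma vanishing_set2 A B n (c : cochain R X n) :
  vanishing [set A] c -> vanishing [set B] c -> vanishing [set A; B] c.
Proof. by move=> vA vB C s [] -> Cs; [exact: (vA A)|exact: (vB B)]. Qed.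

Lemma bounds0 F n : bounds F (0 : cochain R X n).
Proof. by case: n => // n; exists 0; rewrite ?coboundary0. Qed.

Lemma boundsB F n (c e : cochain R X n) : bounds F c -> bounds F e -> bounds F (c - e).
Proof.
case: n c e => [|n] c e /=; first by move=> -> ->; rewrite subrr.
move=> [b vb ->] [b' vb' ->]; exists (b - b'); first exact: vanishingB.
by rewrite coboundaryB.
Qed.

Lemma boundsD F n (c e : cochain R X n) : bounds F c -> bounds F e -> bounds F (c + e).
Proof.
move=> bc be; rewrite -[e]opprK -[- e]sub0r; apply: boundsB => //.
by apply: boundsB => //; exact: bounds0.
Qed.

Lemma boundsMz F n (c : cochain R X n) a : bounds F c -> bounds F (c *~ a).
Proof.
case: n c => [|n] c /=; first by move=> ->; rewrite mul0rz.
move=> [b vb ->]; exists (b *~ a); first exact: vanishingMz.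
by rewrite coboundaryMz.
Qed.

Lemma bounds_sub F F' n (c : cochain R X n) :
  (forall A, F' A -> exists2 B, F B & A `<=` B) -> bounds F c -> bounds F' c.
Proof.
move=> FF'; case: n c => [//|n] c [b vb ->]; exists b => //.
exact: vanishing_sub vb.
Qed.

Lemma bounds_cob F n (c : cochain R X n) : vanishing F c -> bounds F (coboundary c).
Proof. by exists c. Qed.

Lemma bounds_cocycle F n (c : cochain R X n) : bounds F c -> coboundary c = 0.
Proof.
by case: n c => [|n] c /= => [->|[b _ ->]]; rewrite ?coboundary0// coboundary_coboundary.
Qed.

(** Extension by zero outside [A]. It does not commute with the coboundary; the defect sits on
    simplices that leave [A] and is the source of the connecting maps below. *)
Definition restr A n (c : cochain R X n) : cochain R X n :=
  fun s => if `[< forall x, A (s x) >] then c s else 0.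

Lemma restrE A n (c : cochain R X n) : vanishing [set A] (c - restr A c).
Proof.
move=> _ s -> As; rewrite -[LHS]/(c s - restr A c s) /restr; case: asboolP => // _.
by rewrite subrr.
Qed.
Arguments restrE A {n} c.

Lemma restr_vanishing A B C n (c : cochain R X n) :
  (forall x, A x -> C x -> B x) -> vanishing [set B] c -> vanishing [set C] (restr A c).
Proof.
move=> ABC vc _ s -> Cs; rewrite /restr; case: asboolP => // As.
by apply: (vc B) => // x; apply: ABC.
Qed.

Lemma small_simplices2 A B C n (c : cochain R X n) : open A -> open B ->
  C = A `|` B -> vanishing [set A] c -> vanishing [set B] c ->
  vanishing [set C] (coboundary c) ->
  exists2 f : cochain R X n, vanishing [set C] f & bounds [set A; B] (c - f).
Proof.
move=> oA oB CE vA vB vC.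
have UE : cover_union [set A; B] = C.
  apply/seteqP; split=> x; rewrite CE.
    by move=> [? [] -> ?]; [left|right].
  by move=> [?|?]; [exists A|exists B] => //; [left|right].
have := @small_simplices R X [set A; B] _ n c; rewrite UE; apply => //.
  by move=> _ [] ->.
exact: vanishing_set2.
Qed.

(** Replace [e] by the cochain [f] that vanishes on the whole union: [e - f] is a coboundary, so
    both have the same coboundary. *)
Lemma small_simplices2_bounds A B C n (e : cochain R X n) : open A -> open B ->
  C = A `|` B -> vanishing [set A] e -> vanishing [set B] e ->
  vanishing [set C] (coboundary e) -> bounds [set C] (coboundary e).
Proof.
move=> oA oB CE vA vB vC; have [f vf be] := small_simplices2 oA oB CE vA vB vC.
rewrite -[e](subrK f) coboundaryD (bounds_cocycle be) add0r.
exact: bounds_cob.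
Qed.

End CochainCalculus.

Arguments restrE {R X} A {n} c.

Section Pullback.
Context {R : realType} {X Y : topologicalType}.
Variable f : continuousType X Y.

Lemma pull_cob n (c : cochain R Y n) : pull f (coboundary c) = coboundary (pull f c).
Proof.
apply/funext => s; apply: eq_bigr => i _; congr (_ * c _).
exact/continuousEP.
Qed.

Lemma pullB n (c e : cochain R Y n) : pull f (c - e) = pull f c - pull f e.
Proof. by []. Qed.

Lemma pullD n (c e : cochain R Y n) : pull f (c + e) = pull f c + pull f e.
Proof. by []. Qed.

Lemma pullMz n (c : cochain R Y n) a : pull f (c *~ a) = pull f c *~ a.
Proof. by apply/funext => s; rewrite cochain_mulrzE /pull cochain_mulrzE. Qed.

Lemma pull_vanishing A B n (c : cochain R Y n) :
  (forall x, A x -> B (f x)) -> vanishing [set B] c -> vanishing [set A] (pull f c).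
Proof. by move=> AB vc _ s -> As; apply: (vc B) => // x; exact: AB. Qed.

Lemma pull_bounds A B n (c : cochain R Y n) :
  (forall x, A x -> B (f x)) -> bounds [set B] c -> bounds [set A] (pull f c).
Proof.
case: n c => [|n] c AB /= => [->//|[b vb ->]].
by exists (pull f b); rewrite ?pull_cob//; exact: pull_vanishing vb.
Qed.

End Pullback.

(** * Local cohomology of coordinate subspaces *)

Section LocalCohomology.
Context {R : realType} {D : nat}.
Local Notation V := 'rV[R]_D.
Implicit Types (I : seq 'I_D) (eps : 'I_D -> bool).

Definition punctured I : set V := [set x | exists2 i, i \in I & x 0 i != 0].

Definition flip_fun eps (x : V) : V := \row_i ((-1) ^+ eps i * x 0 i).

Lemma flip_fun_continuous eps : continuous (flip_fun eps).
Proof.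
apply: continuous_mx => i j; rewrite /flip_fun.
under eq_fun do rewrite mxE.
by apply: continuous_funM; [exact: cst_continuous|exact: coord_continuous].
Qed.

Definition flip eps : continuousType V V := mkcts (@flip_fun_continuous eps).

Lemma flipE eps x i : flip eps x 0 i = (-1) ^+ eps i * x 0 i.
Proof. by rewrite /flip /mkcts /flip_fun mxE. Qed.

Definition flip_sign eps I : int := \prod_(i <- I) (-1) ^+ eps i.

(** In terms of groups: with L the subspace whose normal coordinates are [I], the cohomology of (V,
    V - L) is infinite cyclic on the class of [g] in degree [k] and zero in other degrees, and a
    sign change acts by the product of its signs on [I]. *)
Definition relative_generator I k (g : cochain R V k) : Prop :=
  [/\ vanishing [set punctured I] g, coboundary g = 0,
    (forall n (c : cochain R V n), vanishing [set punctured I] c -> coboundary c = 0 ->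
       n != k -> bounds [set punctured I] c),
    (forall c : cochain R V k, vanishing [set punctured I] c -> coboundary c = 0 ->
       exists a, bounds [set punctured I] (c - g *~ a)) &
    (forall a, bounds [set punctured I] (g *~ a) -> a = 0) /\
    (forall eps, bounds [set punctured I] (pull (flip eps) g - g *~ flip_sign eps I))].

Section Suspension.
Variables (I : seq 'I_D) (j : 'I_D).
Hypothesis jI : j \notin I.

Definition half_space (b : bool) : set V :=
  [set x | punctured I x \/ 0 < (-1) ^+ b * x 0 j].

Lemma punctured_open J : open (punctured J).
Proof.
rewrite (_ : punctured J = \bigcup_(i in [set` J]) [set x : V | x 0 i != 0]).
  apply: bigcup_open => i _.
  apply: (@open_comp _ _ (fun x : V => x 0 i) [set y | y != 0]); last exact: open_neq.
  by move=> x _; exact: coord_continuous.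
by apply/seteqP; split=> [x [i iJ xi]|x [i iJ xi]]; exists i.
Qed.

Lemma half_space_open b : open (half_space b).
Proof.
apply: openU; first exact: punctured_open.
apply: (@open_comp _ _ (fun x : V => (-1) ^+ b * x 0 j) [set y | 0 < y]); last exact: open_gt.
by move=> x _; apply: continuous_funM; [exact: cst_continuous|exact: coord_continuous].
Qed.

Lemma half_spaceI x : half_space false x -> half_space true x -> punctured I x.
Proof. by move=> [//|]; rewrite mul1r => h1 [//|]; rewrite mulN1r oppr_gt0 => /(lt_trans h1); rewrite ltxx. Qed.

Lemma half_spaceU : punctured (j :: I) = half_space false `|` half_space true.
Proof.
apply/seteqP; split=> x.
  move=> [i]; rewrite inE => /predU1P[->|iI] xi; last by left; left; exists i.
  case/orP: (lt_total xi) => x0; [right|left]; right; last by rewrite mul1r.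
  by rewrite mulN1r oppr_gt0.
have WW' y : punctured I y -> punctured (j :: I) y.
  by move=> [i iI yi]; exists i => //; rewrite inE iI orbT.
case=> [[/WW'//|xj]|[/WW'//|xj]]; exists j; rewrite ?mem_head//.
- by move: xj; rewrite mul1r => /gt_eqF ->.
- by move: xj; rewrite mulN1r oppr_gt0 => /lt_eqF ->.
Qed.

(** Move coordinate [j] linearly to the sign of the half space. This preserves the half space,
    including its part [punctured I] because [j] is not in [I], and it ends inside the half space,
    where [c] vanishes. *)
Lemma half_space_acyclic b n (c : cochain R V n) :
  vanishing [set half_space b] c -> coboundary c = 0 -> bounds [set half_space b] c.
Proof.
move=> vc dc.
pose h (p : V * R) : V := \row_i if i == j then (1 - p.2) * p.1 0 i + p.2 * (-1) ^+ b else p.1 0 i.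
have hc : continuous h.
  apply: continuous_mx => i0 i; rewrite /h; under eq_fun do rewrite mxE.
  have fstc : continuous (fun p : V * R => p.1 0 i).
    by apply: (@continuous_o _ _ _ fst (fun x : V => x 0 i));
      [exact: continuous_fst|exact: coord_continuous].
  case: (i == j) => //; apply: continuous_funD; apply: continuous_funM => //.
  - by apply: continuous_funB; [exact: cst_continuous|exact: continuous_snd].
  - exact: continuous_snd.
  - exact: cst_continuous.
have h1c : continuous (fun x : V => h (x, 1)).
  apply: (@continuous_o _ _ _ (fun x : V => (x, 1 : R)) h) => //.
  by apply: continuous_pair => [x|]; [exact: cvg_id|exact: cst_continuous].
have idc : continuous (@id V) by move=> x; exact: cvg_id.
have hsgn (x : V) t : 0 <= t <= 1 -> half_space b x -> half_space b (h (x, t)).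
  move=> /andP[t0 t1] [[i iI xi]|xj]; [left|right].
    exists i => //; rewrite mxE ifN//.
    by apply: contraNneq jI => <-.
  rewrite mxE eqxx /= mulrDr mulrCA [_ ^+ b * (t * _)]mulrCA -expr2 sqrr_sign mulr1.
  move: xj; set y := (-1) ^+ b * x 0 j => y0.
  have [->|tlt1] := eqVneq t 1; first by rewrite subrr mul0r add0r ltr01.
  by rewrite ltr_pwDl// mulr_gt0// subr_gt0 lt_neqAle tlt1.
have := @homotopy_bounds R V V [set half_space b] [set half_space b] (mkcts hc)
  (mkcts idc) (mkcts h1c) n c _ _ _ vc dc.
have -> : pull (mkcts idc) c = c.
  by apply/funext => s; rewrite /pull; congr c; exact/continuousEP.
have -> : pull (mkcts h1c) c = 0.
  apply/funext => s; apply: (vc (half_space b)) => // x; right.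
  by rewrite /= /mkcts /h mxE eqxx /= subrr mul0r add0r mul1r -expr2 sqrr_sign ltr01.
rewrite subr0; apply => //.
  move=> x; rewrite /mkcts /h; apply/rowP => i; rewrite mxE /= subr0 mul1r mul0r addr0.
  by case: ifP.
by move=> _ ->; exists (half_space b) => // x t t01 hx; exact: hsgn.
Qed.

(* [suspends c z]: the connecting map of the pair of half spaces sends the
   class of [c] to the class of [z]. *)
Definition suspends n (c : cochain R V n) (z : cochain R V n.+1) :=
  exists e : cochain R V n,
    [/\ vanishing [set half_space false] (c - e), vanishing [set half_space true] e,
        z = coboundary e & vanishing [set punctured (j :: I)] z].

Local Notation W := (punctured I).
Local Notation W' := (punctured (j :: I)).

Lemma suspendsB n (c c' : cochain R V n) z z' :
  suspends c z -> suspends c' z' -> suspends (c - c') (z - z').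
Proof.
move=> [e [v1 v2 -> v3]] [e' [v1' v2' -> v3']]; exists (e - e'); split.
- rewrite (_ : _ - _ = (c - e) - (c' - e')); first exact: vanishingB.
  by rewrite !opprD !opprK addrACA.
- exact: vanishingB.
- by rewrite coboundaryB.
- exact: vanishingB.
Qed.

Lemma suspendsMz n (c : cochain R V n) z a :
  suspends c z -> suspends (c *~ a) (z *~ a).
Proof.
move=> [e [v1 v2 -> v3]]; exists (e *~ a); split.
- by rewrite -mulrzBl; exact: vanishingMz.
- exact: vanishingMz.
- by rewrite coboundaryMz.
- exact: vanishingMz.
Qed.

Lemma vanishing_half b n (c : cochain R V n) :
  vanishing [set W'] c -> vanishing [set half_space b] c.
Proof. by apply: vanishing_set1; rewrite half_spaceU; case: b => x hx; [right|left]. Qed.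

Lemma bounds_half b n (c : cochain R V n) :
  bounds [set half_space b] c -> bounds [set W] c.
Proof. by apply: bounds_sub => _ ->; exists (half_space b) => // x Wx; left. Qed.

(** The restriction of [c] to one half space has a coboundary that vanishes on each half space but
    perhaps not on the union; the primitive [b] from small simplices corrects this. *)
Lemma suspends_exists n (c : cochain R V n) :
  vanishing [set W] c -> coboundary c = 0 -> exists z, suspends c z.
Proof.
move=> vc dc; pose c1 := restr (half_space false) c.
have v1 : vanishing [set half_space true] c1.
  by apply: restr_vanishing vc => x; exact: half_spaceI.
have v2 : vanishing [set half_space false] (coboundary c1).
  have := vanishing_cob (restrE (half_space false) c).
  rewrite coboundaryB dc /= => v A s FA As; have := v A s FA As.
  by rewrite -[LHS]/(0 - coboundary c1 s); lia.
have := @small_simplices2 R V _ _ _ _ _ (@half_space_open false) (@half_space_open true)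
  half_spaceU v2 (vanishing_cob v1).
rewrite coboundary_coboundary => -[|f vf [b vb dbE]]; first exact: vanishing0.
have vbf : vanishing [set half_space false] b by apply: vanishing_sub vb => _ ->; exists (half_space false) => //; left.
have vbt : vanishing [set half_space true] b by apply: vanishing_sub vb => _ ->; exists (half_space true) => //; right.
exists f, (c1 - b); split=> //.
- by rewrite opprB addrA addrAC; apply: vanishingD; [exact: restrE|].
- exact: vanishingB.
- by rewrite coboundaryB /= -dbE opprB addrC subrK.
Qed.

(** Both half spaces are acyclic, so [z] has a primitive relative to each; the difference of the two
    primitives suspends to [z]. *)
Lemma suspends_surj n (z : cochain R V n.+1) :
  vanishing [set W'] z -> coboundary z = 0 ->
  exists c, [/\ vanishing [set W] c, coboundary c = 0 & suspends c z].
Proof.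
move=> vz dz.
have [e ve zE] := half_space_acyclic (vanishing_half (b := true) vz) dz.
have [e' ve' zE'] := half_space_acyclic (vanishing_half (b := false) vz) dz.
exists (e - e'); split.
- by apply: vanishingB; [move: ve|move: ve']; apply: vanishing_set1 => x Wx; left.
- by rewrite coboundaryB -zE -zE' subrr.
exists e; split=> //.
by rewrite addrAC subrr add0r -sub0r; apply: vanishingB.
Qed.

Lemma suspends_inj n (c : cochain R V n) z :
  coboundary c = 0 -> suspends c z -> bounds [set W'] z -> bounds [set W] c.
Proof.
move=> dc [e [v1 v2 zE _]] [f vf zE'].
have b1 : bounds [set half_space true] (e - f).
  apply: half_space_acyclic; last by rewrite coboundaryB -zE -zE' subrr.
  by apply: vanishingB => //; exact: vanishing_half.
have b2 : bounds [set half_space false] (c - e + f).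
  apply: half_space_acyclic; last by rewrite coboundaryD coboundaryB /= dc -zE -zE' sub0r addNr.
  by apply: vanishingD => //; exact: vanishing_half.
have <- : (c - e + f) + (e - f) = c by rewrite -addrA [f + _]addrC subrK subrK.
by apply: boundsD; [exact: bounds_half b2|exact: bounds_half b1].
Qed.

(** Correcting [e] by the coboundary of a restricted primitive of [c] makes it vanish on both half
    spaces, and then its coboundary bounds relative to their union. *)
Lemma suspends_bounds n (c : cochain R V n) z :
  bounds [set W] c -> suspends c z -> bounds [set W'] z.
Proof.
move=> bc [e [v1 v2 zE vz]].
suff [e' [ve1 ve2 zE']] : exists e' : cochain R V n,
    [/\ vanishing [set half_space false] e', vanishing [set half_space true] e' &
        z = coboundary e'].
  rewrite zE'; apply: (@small_simplices2_bounds R V _ _ _ _ _ (@half_space_open false)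
    (@half_space_open true) half_spaceU) => //; rewrite -zE' //.
case: n => [|n] in c z e bc v1 v2 zE vz *.
  exists e; split=> //; move: v1; rewrite bc sub0r => v1 A s FA As.
  by have := v1 A s FA As; rewrite -[LHS]/(- e s); lia.
move: bc => [p vp cE]; pose p1 := restr (half_space false) p.
have vp1 : vanishing [set half_space true] p1.
  by apply: restr_vanishing vp => x; exact: half_spaceI.
exists (e - coboundary p1); split.
- have := vanishingB (vanishing_cob (restrE (half_space false) p)) v1.
  by rewrite coboundaryB /= -cE opprB addrC addrA subrK.
- by apply: vanishingB => //; exact: vanishing_cob.
- by rewrite coboundaryB /= coboundary_coboundary subr0.
Qed.

Lemma flip_half_space eps b x : half_space b x ->
  half_space (b (+) eps j) (flip eps x).
Proof.
move=> [[i iI xi]|xj]; [left; exists i => //|right]; rewrite flipE.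
  by rewrite mulf_neq0// signr_eq0.
by rewrite mulrA -signr_addb addbK.
Qed.

Lemma flip_punctured eps J x : punctured J x -> punctured J (flip eps x).
Proof. by move=> [i iJ xi]; exists i => //; rewrite flipE mulf_neq0// signr_eq0. Qed.

Lemma pull_flip_suspends eps n (c : cochain R V n) z : coboundary c = 0 ->
  suspends c z -> suspends (pull (flip eps) c *~ (-1) ^+ eps j) (pull (flip eps) z).
Proof.
move=> dc [e [v1 v2 -> vz]]; set g := flip eps.
have ve b c' : vanishing [set half_space b] c' ->
    vanishing [set half_space (b (+) eps j)] (pull g c' : cochain R V n).
  apply: pull_vanishing => x /(flip_half_space eps).
  by rewrite -addbA addbb addbF.
have vz' : vanishing [set W'] (pull g (coboundary e)).
  by apply: pull_vanishing vz => x; exact: flip_punctured.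
case: (boolP (eps j)) => ej; last first.
  exists (pull g e); rewrite mulr1z -pullB; split => //.
  - by have := ve _ _ v1; rewrite (negbTE ej).
  - by have := ve _ _ v2; rewrite (negbTE ej).
  - by rewrite pull_cob.
(* Reversing coordinate [j] exchanges the half spaces. The cochain [e - c], which vanishes on the
   first one, takes over the role of [e]; this is where the sign -1 arises. *)
exists (pull g e - pull g c); rewrite expr1 mulrNz mulr1z; split => //.
- rewrite opprB addrA addNr sub0r -sub0r; apply: vanishingB => //.
  by have := ve _ _ v2; rewrite ej.
- rewrite -opprB -sub0r; apply: vanishingB => //.
  by have := ve _ _ v1; rewrite ej.
by rewrite coboundaryB /= -!pull_cob dc subr0.
Qed.

End Suspension.
Lemma alternating_sum n : \sum_(i < n) (-1) ^+ i = (odd n)%:R :> int.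
Proof.
elim: n => [|n IHn]; first by rewrite big_ord0.
by rewrite big_ord_recr /= IHn -signr_odd; case: (odd n).
Qed.

Lemma vanishing_punctured0 n (c : cochain R V n) : vanishing [set punctured [::]] c.
Proof. by move=> _ s -> /(_ (retr (delta_mx 0 0)))[]. Qed.

Lemma contraction_bounds n (c : cochain R V n) (s0 : singular_simplex R V n) :
  (forall x, s0 x = 0) -> coboundary c = 0 ->
  bounds [set punctured [::]] (c - (fun=> c s0)).
Proof.
move=> s00 dc; pose h (p : V * R) : V := (1 - p.2) *: p.1.
have hc : continuous h.
  move=> p; apply: (@continuousZ _ _ _ (fun p : V * R => 1 - p.2) fst p);
    last exact: continuous_fst.
  by apply: continuous_funB; [exact: cst_continuous|exact: continuous_snd].
have idc : continuous (@id V) by move=> x; exact: cvg_id.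
have cc : continuous (fun _ : V => 0 : V) by exact: cst_continuous.
have := @homotopy_bounds R V V [set punctured [::]] [set punctured [::]] (mkcts hc)
  (mkcts idc) (mkcts cc) n c _ _ _ (vanishing_punctured0 c) dc.
have -> : pull (mkcts idc) c = c.
  by apply/funext => s; rewrite /pull; congr c; exact/continuousEP.
have -> : pull (mkcts cc) c = fun=> c s0.
  by apply/funext => s; rewrite /pull; congr c; apply/continuousEP => x /=; rewrite s00.
apply=> [x|x|_ ->].
- by rewrite -[RHS]/((1 - 0) *: x) subr0 scale1r.
- by rewrite -[RHS]/((1 - 1) *: x) subrr scale0r.
- by exists (punctured [::]) => // x t _ [].
Qed.

(** [V] is contractible, so a cocycle is cohomologous to the constant cochain with its value on the
    constant simplex. In positive degree a constant cocycle is zero when the degree is odd and a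
    coboundary when it is even. *)
Lemma relative_generator0 : exists g : cochain R V 0, relative_generator [::] g.
Proof.
pose z n : singular_simplex R V n := mkcts (@cst_continuous (simplex R n) V 0).
have dz n (c : cochain R V n) s : (forall s' s'', c s' = c s'') ->
    coboundary c s = c (z n) * (odd n.+2)%:R.
  move=> cc; rewrite -alternating_sum mulr_sumr; apply: eq_bigr => i _.
  by rewrite mulrC (cc _ (z n)).
pose g : cochain R V 0 := fun=> 1.
exists g; split.
- exact: vanishing_punctured0.
- by apply/funext => s; rewrite dz// mulr0.
- case=> // n c _ dc _; have b := contraction_bounds (s0 := z n.+1) (fun=> erefl) dc.
  rewrite -[c](subrK (fun=> c (z n.+1))); apply: boundsD => //.
  have := congr1 (fun e : cochain R V n.+2 => e (z n.+2)) dc.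
  rewrite {1}/coboundary (_ : \sum_i _ = c (z n.+1) * (odd n.+3)%:R); last first.
    rewrite -alternating_sum mulr_sumr; apply: eq_bigr => i _; rewrite mulrC.
    by congr (c _ * _); exact/continuousEP.
  rewrite /= negbK; case: (boolP (odd n)) => on.
    move=> _; exists (fun=> c (z n.+1)); first exact: vanishing_punctured0.
    by apply/funext => s; rewrite dz//= on negbK mulr1.
  rewrite mulr1 => ->; exact: (bounds0 _ n.+1).
- move=> c _ dc; exists (c (z 0)).
  have -> : g *~ c (z 0) = (fun=> c (z 0)) by apply/funext => s; rewrite cochain_mulrzE mul1r.
  exact: contraction_bounds.
split=> [a|eps].
  by move=> /(congr1 (fun e : cochain R V 0 => e (z 0))); rewrite cochain_mulrzE mul1r.
rewrite /flip_sign big_nil mulr1z.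
by have -> : pull (flip eps) g = g by []; rewrite subrr.
Qed.

Theorem relative_generator_exists I : uniq I ->
  exists g : cochain R V (size I), relative_generator I g.
Proof.
elim: I => [_|j I IHI /= /andP[jI uI]]; first exact: relative_generator0.
have [g [vg dg gne gex [gtf gsgn]]] := IHI uI.
have [g' sg] := suspends_exists jI vg dg.
have [e [_ _ g'E vg']] := sg.
exists g'; split=> //.
- by rewrite g'E coboundary_coboundary.
- case=> [|n] c vc dc nk.
    exact: (half_space_acyclic jI (vanishing_half (b := true) vc) dc).
  have [c0 [v0 d0 sc]] := suspends_surj jI vc dc.
  exact: (suspends_bounds jI (gne _ _ v0 d0 nk) sc).
- move=> c vc dc; have [c0 [v0 d0 sc]] := suspends_surj jI vc dc.
  have [a ba] := gex _ v0 d0; exists a.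
  exact: (suspends_bounds jI ba (suspendsB sc (suspendsMz a sg))).
split=> [a ba|eps].
  apply: gtf; apply: (suspends_inj jI _ (suspendsMz a sg) ba).
  by rewrite coboundaryMz dg mul0rz.
have := suspendsB (pull_flip_suspends eps dg sg) (suspendsMz (flip_sign eps (j :: I)) sg).
apply: (suspends_bounds jI).
rewrite /flip_sign big_cons -/(flip_sign eps I) mulrC mulrzA -mulrzBl.
exact: boundsMz.
Qed.

End LocalCohomology.

(** * Cohomology of a cell stratification *)

(** The charts are open embeddings of vector spaces; the embedding property is recorded as lifting
    of singular simplices, which is all that cochains detect. In its chart a cell is the subspace
    cut out by the coordinates [normal], and every other cell that meets the chart has smaller
    codimension, so unions of cells of small codimension are open. *)
Record cellular (R : realType) (X : topologicalType) (K : finType) := Cellular {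
  codim : K -> nat;
  cell : K -> set X;
  chart_dim : K -> nat;
  chart : forall w, continuousType 'rV[R]_(chart_dim w) X;
  normal : forall w, seq 'I_(chart_dim w);
  cell_cover : forall x, exists w, cell w x;
  cell_disjoint : forall w v x, cell w x -> cell v x -> w = v;
  cell_chart : forall w x, cell w x -> range (chart w) x;
  chart_open : forall w, open (range (chart w));
  chart_lift : forall w n (s : singular_simplex R X n),
    (forall x, range (chart w) (s x)) ->
    exists s' : singular_simplex R 'rV[R]_(chart_dim w) n, forall x, chart w (s' x) = s x;
  chart_inj : forall w, injective (chart w);
  normal_uniq : forall w, uniq (normal w);
  size_normal : forall w, size (normal w) = codim w;
  chart_cell : forall w x, cell w (chart w x) <-> ~ punctured (normal w) x;
  cell_order : forall v w x, range (chart v) x -> cell w x ->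
    w = v \/ (codim w < codim v)%N
}.

Section AtDegree.
Context {R : realType} {X : topologicalType} {k : nat}.
Variable c : cochain R X k.

(** Puts a cochain in one degree of a family indexed by all degrees, so that later equations need no
    transport between degrees. *)
Definition at_degree n : cochain R X n :=
  if eqP is ReflectT e then ecast m (cochain R X m) e c else 0 : cochain R X n.
Arguments at_degree n s : clear implicits.

Lemma at_degreeE : at_degree k = c.
Proof. by rewrite /at_degree; case: eqP => // e; rewrite eq_axiomK. Qed.

Lemma at_degreeN n : n <> k -> at_degree n = 0.
Proof. by rewrite /at_degree => nk; case: eqP => // e; case: nk. Qed.

End AtDegree.

Arguments at_degree {R X k} c n s.

Section CellCohomology.
Context {R : realType} {X : topologicalType} {K : finType}.
Variable S : cellular R X K.
Local Notation cd := (codim S).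
Local Notation C := (cell S).
Local Notation j := (chart S).
Local Notation J := (normal S).
Local Notation V w := (range (j w)).

Definition skel k : set X := [set x | exists2 w, (cd w < k)%N & C w x].
(** Together with the chart of [w] it covers [skel (cd w).+1], and it meets that chart inside the
    punctured space. This isolates the single cell [w]. *)
Definition outer w : set X := [set x | exists v, [/\ v <> w, (cd v <= cd w)%N & C v x]].

Lemma skelE k : skel k = \bigcup_(w in [set w | (cd w < k)%N]) V w.
Proof.
apply/seteqP; split=> x [w wk xw]; first by exists w => //; exact: cell_chart.
have [v vx] := cell_cover S x; exists v => //.
by case: (cell_order xw vx) => [->//|/ltn_trans]; apply.
Qed.

Lemma skel_open k : open (skel k).
Proof. by rewrite skelE; apply: bigcup_open => w _; exact: chart_open. Qed.

Lemma outerE w : outer w = \bigcup_(v in [set v | v <> w /\ (cd v <= cd w)%N]) V v.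
Proof.
apply/seteqP; split=> x.
  by move=> [v [vw cvw xv]]; exists v => //; exact: cell_chart.
move=> [v [vw cvw] xv]; have [v' xv'] := cell_cover S x; exists v'.
case: (cell_order xv xv') => [v'v|lt]; first by rewrite v'v in xv' *.
split=> //; last exact: leq_trans (ltnW lt) cvw.
by move=> v'w; move: lt; rewrite v'w ltnNge cvw.
Qed.

Lemma outer_open w : open (outer w).
Proof. by rewrite outerE; apply: bigcup_open => v _; exact: chart_open. Qed.

Lemma skel_sub k k' : (k <= k')%N -> skel k `<=` skel k'.
Proof. by move=> kk' x [w wk xw]; exists w => //; exact: leq_trans kk'. Qed.

Lemma skel_outer k w : (k <= cd w)%N -> skel k `<=` outer w.
Proof.
move=> kw x [v vk xv]; exists v; split=> //; last exact: leq_trans (ltnW vk) kw.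
by move=> vw; move: vk; rewrite vw ltnNge kw.
Qed.

Lemma chart_skel w : V w `<=` skel (cd w).+1.
Proof. by move=> x xw; rewrite skelE; exists w => /=. Qed.

Lemma outer_skel w : outer w `<=` skel (cd w).+1.
Proof. by move=> x [v [vw cvw xv]]; exists v. Qed.

Lemma skelS w : skel (cd w).+1 = outer w `|` V w.
Proof.
apply/seteqP; split=> x; last by case=> [/outer_skel|/chart_skel].
move=> [v vw xv]; have [vE|/eqP vw'] := eqVneq v w.
  by right; rewrite -vE; exact: cell_chart.
by left; exists v.
Qed.

Lemma chart_outer v w : v <> w -> (cd v <= cd w)%N -> V v `<=` outer w.
Proof. by move=> vw cvw x xv; rewrite outerE; exists v. Qed.

Lemma punctured_skel w x : punctured (J w) x -> skel (cd w) (j w x).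
Proof.
move=> px; have [v xv] := cell_cover S (j w x); exists v => //.
have xw : V w (j w x) by exists x.
by case: (cell_order xw xv) => // vw; move: xv; rewrite vw => /chart_cell/(_ px).
Qed.

Lemma outer_punctured w x : outer w (j w x) -> punctured (J w) x.
Proof.
move=> [v [vw _ xv]]; apply: contrapT => /chart_cell xw.
exact/vw/(cell_disjoint xv xw).
Qed.

(** Extension by zero from the chart to [X]. Lifts are unique by [chart_inj], so pulling back along
    the chart recovers [b]. *)
Definition extend w n (b : cochain R 'rV[R]_(chart_dim S w) n) : cochain R X n :=
  fun s => if pselect (exists s' : singular_simplex R 'rV[R]_(chart_dim S w) n,
                         forall x, j w (s' x) = s x) is left ex
           then b (projT1 (cid ex)) else 0.

Lemma pull_extend w n (b : cochain R 'rV[R]_(chart_dim S w) n) :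
  pull (j w) (extend b) = b.
Proof.
apply/funext => s; rewrite /pull /extend; case: pselect => [ex|[]]; last by exists s.
congr b; apply/continuousEP => x; apply: (@chart_inj _ _ _ S).
by case: (cid ex).
Qed.

Lemma extend_vanishing w n (b : cochain R 'rV[R]_(chart_dim S w) n) :
  vanishing [set punctured (J w)] b -> vanishing [set outer w] (extend b).
Proof.
move=> vb _ s -> sO; rewrite /extend; case: pselect => // ex.
apply: (vb _ _ (erefl _)) => x; apply: outer_punctured.
by case: (cid ex) => s' /= ->.
Qed.

Lemma vanishing_chart w n (c : cochain R X n) :
  pull (j w) c = 0 <-> vanishing [set V w] c.
Proof.
split=> [c0 _ s -> sV|vc].
  have [s' ss'] := chart_lift sV.
  have -> : s = j w \o s' by apply/continuousEP => x /=; rewrite ss'.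
  by rewrite -[LHS]/(pull (j w) c s') c0.
by apply/funext => s; apply: (vc (V w)) => // x; exists (s x).
Qed.

Lemma pull_chart_outer v w n (c : cochain R X n) : v <> w -> (cd v <= cd w)%N ->
  vanishing [set outer w] c -> pull (j v) c = 0.
Proof. by move=> vw cvw vc; apply/vanishing_chart; apply: vanishing_set1 vc; exact: chart_outer. Qed.

Lemma generator_family w : exists g : forall n, cochain R 'rV[R]_(chart_dim S w) n,
  [/\ (forall n, vanishing [set punctured (J w)] (g n)),
      (forall n, coboundary (g n) = 0),
      (forall n, n <> cd w -> g n = 0),
      (forall n (c : cochain R 'rV[R]_(chart_dim S w) n),
         vanishing [set punctured (J w)] c -> coboundary c = 0 ->
         exists a, bounds [set punctured (J w)] (c - g n *~ a)) &
      (forall a, bounds [set punctured (J w)] (g (cd w) *~ a) -> a = 0) /\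
      (forall n eps, bounds [set punctured (J w)]
         (pull (flip eps) (g n) - g n *~ flip_sign eps (J w)))].
Proof.
have := relative_generator_exists (R := R) (normal_uniq S w).
rewrite size_normal => -[g0 [vg dg gne gex [gtf gsgn]]].
pose g := at_degree g0.
have gE : g (cd w) = g0 by exact: at_degreeE.
have gN n : n <> cd w -> g n = 0 by exact: at_degreeN.
exists g; split=> //; last split.
- move=> n; have [->|/eqP/gN->] := eqVneq n (cd w); [by rewrite gE|exact: vanishing0].
- move=> n; have [->|/eqP/gN->] := eqVneq n (cd w); [by rewrite gE|exact: coboundary0].
- move=> n c vc dc; have [nE|nk] := eqVneq n (cd w).
    by subst n; rewrite gE; exact: gex.
  by exists 0; rewrite mulr0z subr0; exact: gne.
- by move=> a; rewrite gE; exact: gtf.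
- move=> n eps; have [->|/eqP/gN->] := eqVneq n (cd w); first by rewrite gE.
  rewrite mul0rz subr0 (_ : pull _ _ = 0) //; exact: bounds0.
Qed.

End CellCohomology.

(** * The cellular cochain complex *)

Section CellBasis.
Context {R : realType} {X : topologicalType} {K : finType}.
Variable S : cellular R X K.
Local Notation cd := (codim S).
Local Notation j := (chart S).
Local Notation J := (normal S).
Local Notation V w := (range (j w)).
Local Notation skel := (skel S).
Local Notation outer := (outer S).

Definition gen w : forall n, cochain R 'rV[R]_(chart_dim S w) n :=
  projT1 (cid (generator_family S w)).
Arguments gen : clear implicits.

Lemma gen_vanishing w n : vanishing [set punctured (J w)] (gen w n).
Proof. by rewrite /gen; case: cid => g /= []. Qed.

Lemma gen_cocycle w n : coboundary (gen w n) = 0.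
Proof. by rewrite /gen; case: cid => g /= []. Qed.

Lemma gen_deg w n : n <> cd w -> gen w n = 0.
Proof. by rewrite /gen; case: cid => g /= [] _ _ + _ _; exact. Qed.

Lemma gen_surj w n (c : cochain R 'rV[R]_(chart_dim S w) n) :
  vanishing [set punctured (J w)] c -> coboundary c = 0 ->
  exists a, bounds [set punctured (J w)] (c - gen w n *~ a).
Proof. by rewrite /gen; case: cid => g /= [] _ _ _ + _; exact. Qed.

Lemma gen_inj w a : bounds [set punctured (J w)] (gen w (cd w) *~ a) -> a = 0.
Proof. by rewrite /gen; case: cid => g /= [] _ _ _ _ [+ _]; exact. Qed.

Lemma gen_flip w n eps : bounds [set punctured (J w)]
  (pull (flip eps) (gen w n) - gen w n *~ flip_sign eps (J w)).
Proof. by rewrite /gen; case: cid => g /= [] _ _ _ _ [_]; exact. Qed.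

Definition realize (u : K -> forall n, cochain R X n) n (a : K -> int) : cochain R X n :=
  \sum_w u w n *~ a w.
Arguments realize : clear implicits.

Definition comb (del : K -> K -> int) (a : K -> int) (v : K) : int :=
  \sum_w a w * del w v.

Definition supported k n (a : K -> int) :=
  forall w, a w <> 0 -> (k <= cd w)%N /\ cd w = n.

(** The statement of a descending induction on [k]: for every [k'] from [k] on, the cohomology of
    the pair (X, skel k') is that of the complex spanned by the cells of codimension at least [k'],
    with differential [del]. The fields [basis_surj] and [basis_inj] are the two halves of this;
    [basis_outer] and [basis_chart] tie each generator to its own cell. *)
Record cell_basis k (u : K -> forall n, cochain R X n) (del : K -> K -> int) : Prop :=
  CellBasis {
  basis_deg : forall w n, n <> cd w -> u w n = 0;
  basis_low : forall w n, (cd w < k)%N -> u w n = 0;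
  basis_outer : forall w n, vanishing [set outer w] (u w n);
  basis_chart : forall w n, (k <= cd w)%N -> pull (j w) (u w n) = gen w n;
  basis_cob : forall w n, coboundary (u w n) = realize u n.+1 (del w);
  basis_del : forall w v, del w v <> 0 -> (k <= cd w)%N /\ cd v = (cd w).+1;
  basis_surj : forall k' n (c : cochain R X n), (k <= k')%N ->
    vanishing [set skel k'] c -> coboundary c = 0 ->
    exists2 a, supported k' n a & bounds [set skel k'] (c - realize u n a);
  basis_inj : forall k' n a, (k <= k')%N -> supported k' n a ->
    bounds [set skel k'] (realize u n a) ->
    exists2 a', forall w, a' w <> 0 -> (k' <= cd w)%N /\ (cd w).+1 = n &
                a = comb del a'
  }.

Lemma realizeB u n a a' : realize u n (fun w => a w - a' w) = realize u n a - realize u n a'.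
Proof. by rewrite /realize -sumrB; apply: eq_bigr => w _; rewrite mulrzBr. Qed.

Lemma realizeD u n a a' : realize u n (fun w => a w + a' w) = realize u n a + realize u n a'.
Proof. by rewrite /realize -big_split; apply: eq_bigr => w _; rewrite mulrzDr. Qed.

Lemma coboundary_sum (I : finType) n (F : I -> cochain R X n) :
  coboundary (\sum_i F i) = \sum_i coboundary (F i).
Proof. by rewrite [LHS]raddf_sum. Qed.

Lemma pull_sum (Y : topologicalType) (f : continuousType Y X) (I : finType) n
  (F : I -> cochain R X n) : pull f (\sum_i F i) = \sum_i pull f (F i).
Proof.
elim/big_rec2: _ => [|i y1 y2 _ <-]; first by [].
by rewrite pullD.
Qed.

Lemma vanishing_sum (F : set (set X)) (I : finType) n (c : I -> cochain R X n) :
  (forall i, vanishing F (c i)) -> vanishing F (\sum_i c i).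
Proof.
move=> vc; elim/big_rec: _ => [|i y _ vy]; first exact: vanishing0.
exact: vanishingD.
Qed.

Lemma coboundary_realize u del n a :
  (forall w n, coboundary (u w n) = realize u n.+1 (del w)) ->
  coboundary (realize u n a) = realize u n.+1 (comb del a).
Proof.
move=> du; rewrite /realize coboundary_sum.
under eq_bigr => w _ do rewrite coboundaryMz du /realize mulrz_suml.
rewrite exchange_big /=; apply: eq_bigr => v _.
rewrite /comb mulrz_sumr; apply: eq_bigr => w _.
by rewrite mulrC mulrzA.
Qed.

(** The local generator extended by zero has a coboundary that vanishes on [outer w] and on the
    chart. The correction makes it vanish on their union and leaves the restriction to the chart as
    it was. *)
Lemma lift_generator w : exists u0 : cochain R X (cd w),
  [/\ vanishing [set outer w] u0, vanishing [set skel (cd w).+1] (coboundary u0) &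
      pull (j w) u0 = gen w (cd w)].
Proof.
pose g := extend (gen w (cd w)).
have vg : vanishing [set outer w] g by apply: extend_vanishing; exact: gen_vanishing.
have vdg : vanishing [set V w] (coboundary g).
  by apply/vanishing_chart; rewrite pull_cob pull_extend gen_cocycle.
have := @small_simplices2 R X _ _ _ _ _ (@outer_open _ _ _ S w) (@chart_open _ _ _ S w)
  (skelS S w) (vanishing_cob vg) vdg.
rewrite coboundary_coboundary => -[|f vf [b vb dbE]]; first exact: vanishing0.
have vbo : vanishing [set outer w] b by apply: vanishing_sub vb => _ ->; exists (outer w) => //; left.
have vbV : vanishing [set V w] b by apply: vanishing_sub vb => _ ->; exists (V w) => //; right.
exists (g - b); split.
- exact: vanishingB.
- by rewrite coboundaryB -dbE opprB addrC subrK.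
- by rewrite pullB pull_extend (iffRL (vanishing_chart _ _ _) vbV) subr0.
Qed.

(** Subtracting the coboundaries of the local primitives, extended by zero, makes the cochain vanish
    on each chart; the charts do not interfere because each lies in [outer] of the others. The
    cochain then vanishes on an open cover of [B], and small simplices apply. *)
Lemma excision (A B : set X) (P : pred K) n (c : cochain R X n) :
  open A -> (forall w, P w -> A `<=` outer w) ->
  (forall w v, P w -> P v -> v <> w -> V v `<=` outer w) ->
  B = A `|` \bigcup_(w in [set w | P w]) V w ->
  vanishing [set A] c -> vanishing [set B] (coboundary c) ->
  (forall w, P w -> bounds [set punctured (J w)] (pull (j w) c)) ->
  exists2 f : cochain R X n, vanishing [set B] f & bounds [set A] (c - f).
Proof.
move=> oA Ao Vo BE vc vdc bc.
have [e [ve de vde be]] : exists e : cochain R X n, [/\ vanishing [set A] e,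
    (forall w, P w -> pull (j w) e = 0),
    vanishing [set B] (coboundary e) & bounds [set A] (c - e)].
  case: n => [|n] in c vc vdc bc *.
    exists c; split=> //; last by rewrite /= subrr.
  have exb w : exists b : cochain R 'rV[R]_(chart_dim S w) n, P w ->
      vanishing [set punctured (J w)] b /\ pull (j w) c = coboundary b.
    have [Pw|nPw] := boolP (P w); last by exists 0.
    by have [b vb cb] := bc w Pw; exists b.
  pose b w := projT1 (cid (exb w)).
  have bP w : P w ->
      vanishing [set punctured (J w)] (b w) /\ pull (j w) c = coboundary (b w).
    by rewrite /b; case: cid.
  have vb w : P w -> vanishing [set outer w] (extend (b w)).
    by move=> /bP[vb _]; exact: extend_vanishing.
  pose b' := \sum_(w | P w) extend (b w).
  have vb' : vanishing [set A] b'.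
    rewrite /b' big_mkcond; apply: vanishing_sum => w; case: ifP => // Pw.
    by apply: vanishing_set1 (vb w Pw); apply: Ao.
  exists (c - coboundary b'); split.
  - by apply: vanishingB => //; exact: vanishing_cob.
  - move=> w Pw; rewrite pullB pull_cob (_ : pull (j w) b' = b w).
      by rewrite (bP w Pw).2 subrr.
    rewrite /b' big_mkcond pull_sum (bigD1 w) //= Pw pull_extend big1 ?addr0// => v vw.
    case: ifP => // Pv; apply/vanishing_chart; apply: vanishing_set1 (vb v Pv).
    by apply: Vo => //; apply/eqP; rewrite eq_sym.
  - by rewrite coboundaryB coboundary_coboundary subr0.
  - by rewrite opprB addrC subrK; exact: bounds_cob.
pose F : set (set X) := [set U | U = A \/ exists2 w, P w & U = V w].
have UF : cover_union F = B.
  rewrite BE; apply/seteqP; split=> [x [U [->|[w Pw ->]] Ux]|x [Ax|[w Pw xw]]].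
  - by left.
  - by right; exists w.
  - by exists A => //; left.
  - by exists (V w) => //; right; exists w.
have oF U : F U -> open U by case=> [->//|[w _ ->]]; exact: chart_open.
have vFe : vanishing F e.
  move=> U s [->|[w Pw ->]]; first by apply: ve.
  by move=> sV; apply: (iffLR (vanishing_chart _ _ _) (de w Pw) (V w)).
have := small_simplices oF vFe; rewrite UF => /(_ vde)[f vf bf]; exists f => //.
rewrite -[c](subrK e) -addrA; apply: boundsD => //.
by apply: bounds_sub bf => _ ->; exists A => //; left.
Qed.

Lemma excise_cells k n (c : cochain R X n) :
  vanishing [set skel k] c -> vanishing [set skel k.+1] (coboundary c) ->
  (forall w, cd w = k -> bounds [set punctured (J w)] (pull (j w) c)) ->
  exists2 f : cochain R X n, vanishing [set skel k.+1] f & bounds [set skel k] (c - f).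
Proof.
move=> vc vdc bc; apply: (@excision (skel k) (skel k.+1) [pred w | cd w == k]) => //.
- exact: skel_open.
- by move=> w /eqP wk; apply: skel_outer; rewrite wk.
- by move=> w v /eqP wk /eqP vk vw; apply: chart_outer; rewrite ?vk ?wk.
- apply/seteqP; split=> [x [w wk xw]|x [xk|[w /eqP <- xw]]].
  + move: wk; rewrite ltnS leq_eqVlt => /predU1P[wk|wk]; last by left; exists w.
    by right; exists w; [exact/eqP|exact: cell_chart].
  + exact: skel_sub xk.
  + exact: chart_skel.
- by move=> w /eqP wk; exact: bc.
Qed.

Lemma excise_cell w n (c : cochain R X n) :
  vanishing [set outer w] c -> vanishing [set skel (cd w).+1] (coboundary c) ->
  bounds [set punctured (J w)] (pull (j w) c) ->
  exists2 f : cochain R X n, vanishing [set skel (cd w).+1] f & bounds [set outer w] (c - f).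
Proof.
move=> vc vdc bc; apply: (@excision (outer w) _ (pred1 w)) => //.
- exact: outer_open.
- by move=> _ /eqP ->.
- by move=> w1 w2 /eqP -> /eqP ->.
- rewrite skelS; congr (_ `|` _); apply/seteqP; split=> [x xw|x [_ /eqP -> //]].
  by exists w => //=.
- by move=> _ /eqP ->.
Qed.

Lemma eq_realize u u' n a : (forall w, a w <> 0 -> u w n = u' w n) ->
  realize u n a = realize u' n a.
Proof.
move=> uu'; apply: eq_bigr => w _.
by have [->|/eqP/uu' ->] := eqVneq (a w) 0; rewrite ?mulr0z.
Qed.

Lemma eq_comb del del' a : (forall w, a w <> 0 -> del w = del' w) ->
  comb del a = comb del' a.
Proof.
move=> dd'; apply/funext => v; apply: eq_bigr => w _.
by have [->|/eqP/dd' ->] := eqVneq (a w) 0; rewrite ?mul0r.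
Qed.

Lemma realize0 u n : realize u n (fun=> 0) = 0.
Proof. by rewrite /realize big1// => w _; rewrite mulr0z. Qed.

Lemma cell_basis_top : exists k u del, cell_basis k u del.
Proof.
pose m := (\max_w cd w).+1.
have cdm w : (cd w < m)%N by rewrite ltnS; exact: leq_bigmax.
have skelT k' x : (m <= k')%N -> skel k' x.
  by move=> mk'; have [w xw] := cell_cover S x; exists w => //; exact: leq_trans mk'.
have supp0 k' n a w : (m <= k')%N -> supported k' n a -> a w = 0.
  move=> mk' sa; apply: contrapT => /sa[k'w _].
  by have := leq_ltn_trans k'w (cdm w); rewrite ltnNge mk'.
exists m, (fun _ _ => 0), (fun _ _ => 0); split=> //.
- by move=> w n mw; have := cdm w; rewrite ltnNge mw.
- by move=> w n; rewrite coboundary0 realize0.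
- move=> k' n c mk' vc _; exists (fun=> 0) => //; rewrite realize0 subr0.
  rewrite (_ : c = 0); first exact: bounds0.
  by apply/funext => s; apply: (vc (skel k')) => // x; exact: skelT.
- move=> k' n a mk' sa _; exists (fun=> 0) => //; apply/funext => v.
  by rewrite /comb big1 => [|w _]; rewrite ?mul0r// (supp0 _ _ _ _ mk' sa).
Qed.

(** The exact sequence of the triple [skel k], [skel k.+1], [X], carried out on cochains. The
    coboundary of a lifted generator is a cocycle relative to [skel k.+1]; its coordinates in the
    old basis become the row of [del], and the leftover coboundary is absorbed into the
    generator. *)
Lemma cell_basis_step k u del : cell_basis k.+1 u del ->
  exists u' del', cell_basis k u' del'.
Proof.
move=> [udeg ulow uout uch ucob udel usurj uinj].
have ex w : exists p : (forall n, cochain R X n) * (K -> int), cd w = k ->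
    [/\ forall n, n <> k -> p.1 n = 0, forall n, vanishing [set outer w] (p.1 n),
        forall n, pull (j w) (p.1 n) = gen w n,
        forall n, coboundary (p.1 n) = realize u n.+1 p.2 & supported k.+1 k.+1 p.2].
  have [wk|/eqP wk] := eqVneq (cd w) k; last by exists (fun=> 0, fun=> 0) => /wk.
  have := lift_generator w; rewrite wk => -[u0 [v0 d0 p0]].
  have [a sa [y vy dy]] := usurj k.+1 k.+1 _ (leqnn _) d0 (coboundary_coboundary u0).
  have vyo : vanishing [set outer w] y.
    by apply: vanishing_set1 vy; rewrite -wk; exact: outer_skel.
  have py : pull (j w) y = 0.
    apply/vanishing_chart; apply: vanishing_set1 vy; rewrite -wk; exact: chart_skel.
  exists (at_degree (u0 - y), a) => _; split=> //= n.
  - exact: at_degreeN.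
  - have [->|/eqP nk] := eqVneq n k; last by rewrite at_degreeN//; exact: vanishing0.
    by rewrite at_degreeE; exact: vanishingB.
  - have [->|/eqP nk] := eqVneq n k; last by rewrite at_degreeN// gen_deg ?wk.
    by rewrite at_degreeE pullB p0 py subr0.
  - have [->|/eqP nk] := eqVneq n k.
      by rewrite at_degreeE coboundaryB -dy opprB addrC subrK.
    rewrite at_degreeN// coboundary0 /realize big1// => v _.
    have [->|/eqP/sa[_ vk]] := eqVneq (a v) 0; first by rewrite mulr0z.
    by rewrite udeg ?mul0rz// vk => -[].
pose p w := projT1 (cid (ex w)).
have pP w : cd w = k ->
    [/\ forall n, n <> k -> (p w).1 n = 0, forall n, vanishing [set outer w] ((p w).1 n),
        forall n, pull (j w) ((p w).1 n) = gen w n,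
        forall n, coboundary ((p w).1 n) = realize u n.+1 (p w).2 & supported k.+1 k.+1 (p w).2].
  by rewrite /p; case: cid.
pose u' w := if cd w == k then (p w).1 else u w.
pose del' w := if cd w == k then (p w).2 else del w.
have u'E w : (k < cd w)%N -> u' w = u w by rewrite /u' => /gtn_eqF ->.
have del'E w : (k < cd w)%N -> del' w = del w by rewrite /del' => /gtn_eqF ->.
have u'deg w n : n <> cd w -> u' w n = 0.
  rewrite /u'; case: eqP => [wk|_]; last exact: udeg.
  by rewrite wk; have [+ _ _ _ _] := pP w wk; apply.
have u'low w n : (cd w < k)%N -> u' w n = 0.
  by move=> wk; rewrite /u' ltn_eqF// ulow// ltnS ltnW.
have u'out w n : vanishing [set outer w] (u' w n).
  by rewrite /u'; case: eqP => [wk|_]; [have [_ + _ _ _] := pP w wk; apply|exact: uout].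
have u'ch w n : (k <= cd w)%N -> pull (j w) (u' w n) = gen w n.
  rewrite leq_eqVlt eq_sym /u'; case: eqP => [wk _|_ /= wk]; last exact: uch.
  by have [_ _ + _ _] := pP w wk; apply.
have del'P w v : del' w v <> 0 -> (k <= cd w)%N /\ cd v = (cd w).+1.
  rewrite /del'; case: eqP => [wk|_].
    by have [_ _ _ _ + /[dup] dv] := pP w wk => /[apply] -[]; rewrite wk.
  by move=> /udel[/ltnW].
have u'cob w n : coboundary (u' w n) = realize u' n.+1 (del' w).
  have [wk|/eqP wk] := eqVneq (cd w) k.
    have [_ _ _ pd sp] := pP w wk.
    have -> : u' w = (p w).1 by rewrite /u' wk eqxx.
    have -> : del' w = (p w).2 by rewrite /del' wk eqxx.
    by rewrite pd; apply: eq_realize => v /sp[kv _]; rewrite u'E.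
  have -> : u' w = u w by rewrite /u' ifN//; exact/eqP.
  have -> : del' w = del w by rewrite /del' ifN//; exact/eqP.
  rewrite ucob; apply: eq_realize => v /udel[kw vw].
  by rewrite u'E// vw ltnS ltnW.
have realize'E k' n a : (k < k')%N -> supported k' n a -> realize u' n a = realize u n a.
  by move=> kk' sa; apply: eq_realize => w /sa[k'w _]; rewrite u'E//; exact: leq_trans k'w.
have u'surj k' n (c : cochain R X n) : (k < k')%N ->
    vanishing [set skel k'] c -> coboundary c = 0 ->
    exists2 a, supported k' n a & bounds [set skel k'] (c - realize u' n a).
  move=> kk' vc dc; have [a sa ba] := usurj k' n c kk' vc dc.
  by exists a => //; rewrite (realize'E k').
have u'inj k' n a : (k < k')%N -> supported k' n a ->
    bounds [set skel k'] (realize u' n a) ->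
    exists2 a', forall w, a' w <> 0 -> (k' <= cd w)%N /\ (cd w).+1 = n & a = comb del' a'.
  move=> kk' sa; rewrite (realize'E k')// => /(uinj _ _ _ kk' sa)[a' sa' ->].
  exists a' => //; apply: eq_comb => w /sa'[k'w _]; rewrite del'E//.
  exact: leq_trans k'w.
have dreal n a : coboundary (realize u' n a) = realize u' n.+1 (comb del' a) by exact: coboundary_realize.
have realn n a : (forall w, a w <> 0 -> cd w <> n) -> realize u' n a = 0.
  move=> an; rewrite /realize big1// => w _.
  have [->|/eqP/an wn] := eqVneq (a w) 0; first by rewrite mulr0z.
  by rewrite u'deg ?mul0rz//; exact: nesym.
(* Excision in codimension [k], with the classes on the charts realized by [u']. *)
have exck n (c : cochain R X n) : vanishing [set skel k] c ->
    vanishing [set skel k.+1] (coboundary c) ->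
    exists2 a, (forall w, a w <> 0 -> cd w = k /\ k = n) & exists2 f : cochain R X n,
      vanishing [set skel k.+1] f & bounds [set skel k] (c - realize u' n a - f).
  move=> vc vdc.
  have exa w : exists a : int, cd w = k ->
      bounds [set punctured (J w)] (pull (j w) c - gen w n *~ a).
    have [wk|/eqP wk] := eqVneq (cd w) k; last by exists 0 => /wk.
    have [||a ba] := @gen_surj w n (pull (j w) c).
    - by apply: pull_vanishing vc => x; rewrite -wk; exact: punctured_skel.
    - rewrite -pull_cob; apply/vanishing_chart; apply: vanishing_set1 vdc; rewrite -wk.
      exact: chart_skel.
    by exists a.
  pose a0 w := projT1 (cid (exa w)).
  have a0P w : cd w = k -> bounds [set punctured (J w)] (pull (j w) c - gen w n *~ a0 w).
    by rewrite /a0; case: cid.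
  pose a w := if (cd w == k) && (k == n) then a0 w else 0.
  have sa w : a w <> 0 -> cd w = k /\ k = n.
    by rewrite /a; case: ifP => // /andP[/eqP -> /eqP ->].
  exists a => //; apply: excise_cells.
  - apply: vanishingB => //; apply: vanishing_sum => w.
    have [->|/eqP/sa[wk _]] := eqVneq (a w) 0; first by rewrite mulr0z; exact: vanishing0.
    by apply: vanishingMz; apply: vanishing_set1 (u'out w n); apply: skel_outer; rewrite wk.
  - rewrite coboundaryB; apply: vanishingB => //; rewrite dreal; apply: vanishing_sum => v.
    have [->|/eqP cv] := eqVneq (comb del' a v) 0; first by rewrite mulr0z; exact: vanishing0.
    apply: vanishingMz; apply: vanishing_set1 (u'out v _); apply: skel_outer.
    rewrite ltnNge; apply/negP => vk; apply: cv; rewrite /comb big1// => w _.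
    have [->|/eqP/sa[wk _]] := eqVneq (a w) 0; first by rewrite mul0r.
    have [->|/eqP/del'P[_ vw]] := eqVneq (del' w v) 0; first by rewrite mulr0.
    by move: vk; rewrite vw wk ltnn.
  - move=> w wk; rewrite pullB /realize pull_sum (bigD1 w)//= big1 ?addr0 => [|v vw].
      rewrite pullMz u'ch ?wk// /a wk eqxx; case: eqVneq => [_|/eqP nk]; first exact: a0P.
      have := a0P w wk; rewrite gen_deg ?mul0rz ?wk//; exact: nesym.
    rewrite pullMz; have [->|/eqP/sa[vk _]] := eqVneq (a v) 0; first by rewrite mulr0z.
    rewrite (@pull_chart_outer _ _ _ S w v) ?mul0rz ?wk ?vk//.
    by apply/eqP; rewrite eq_sym.
exists u', del'; split=> //.
- move=> k' n c; rewrite leq_eqVlt => /predU1P[<-|]; last exact: u'surj.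
  move=> vc dc; have [|a sa [f vf bf]] := exck n c vc; first by rewrite dc; exact: vanishing0.
  (* [a] holds the part of [c] on cells of codimension [k]. The rest [f] is relative to the larger
     set [skel k.+1], and its coboundary is minus the cellular differential of [a]. *)
  have df : coboundary f = realize u' n.+1 (fun w => 0 - comb del' a w).
    have := bounds_cocycle bf; rewrite realizeB realize0 -dreal !coboundaryB dc sub0r.
    by move/eqP; rewrite subr_eq0 => /eqP <-.
  (* This differential bounds relative to [skel k.+1], so by injectivity it comes from cells of
     codimension above [k]. Subtracting them from [f] leaves a cocycle, to which surjectivity
     applies. *)
  have [||b sb bE] := u'inj k.+1 n.+1 (fun w => 0 - comb del' a w) (ltnSn k).
  + move=> v; rewrite sub0r => /eqP; rewrite oppr_eq0 => /eqP cv.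
    have [w aw dw] : exists2 w, a w <> 0 & del' w v <> 0.
      apply: contrapT => nex; apply: cv; rewrite /comb big1// => w _.
      have [->|/eqP aw] := eqVneq (a w) 0; first by rewrite mul0r.
      have [->|/eqP dw] := eqVneq (del' w v) 0; first by rewrite mulr0.
      by case: nex; exists w.
    by have [_ ->] := del'P _ _ dw; have [-> ->] := sa _ aw.
  + by rewrite -df; exact: bounds_cob.
  have df0 : coboundary (f - realize u' n b) = 0 by rewrite coboundaryB df dreal bE subrr.
  have vb : vanishing [set skel k.+1] (f - realize u' n b).
    apply: vanishingB => //; apply: vanishing_sum => w.
    have [->|/eqP/sb[kw _]] := eqVneq (b w) 0; first by rewrite mulr0z; exact: vanishing0.
    by apply: vanishingMz; apply: vanishing_set1 (u'out w n); exact: skel_outer.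
  have [a' sa' ba'] := u'surj k.+1 n _ (ltnSn k) vb df0.
  exists (fun w => a w + (b w + a' w)).
    move=> w; have [->|/eqP/sa[-> ->]//] := eqVneq (a w) 0.
    have [->|/eqP/sb[/ltnW kw [wn]]] := eqVneq (b w) 0; last by move=> _; split.
    by rewrite !add0r => /sa'[/ltnW].
  rewrite realizeD realizeD opprD addrA.
  have -> : c - realize u' n a - (realize u' n b + realize u' n a') =
    (c - realize u' n a - f) + (f - realize u' n b - realize u' n a').
    by rewrite addrA [_ + (f - _)]addrA subrK opprD addrA.
  apply: boundsD => //; apply: bounds_sub ba' => _ ->; exists (skel k.+1) => //.
  exact: skel_sub.
- move=> k' n a; rewrite leq_eqVlt => /predU1P[<-|]; last exact: u'inj.
  move=> sa ba.
  (* In the chart of a cell of codimension [k] only that cell contributes. A nonzero coefficient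
     there would make a multiple of the local generator bound. *)
  have ak w : a w <> 0 -> (k < cd w)%N.
    move=> aw; have [kw wn] := sa w aw; rewrite ltn_neqAle kw andbT; apply/negP => /eqP kE.
    apply: aw; apply: (@gen_inj w); rewrite wn.
    have := @pull_bounds R _ _ (j w) (punctured (J w)) (skel k) n _ _ ba.
    rewrite /realize pull_sum (bigD1 w)//= big1 ?addr0 => [|v vw].
      by rewrite pullMz u'ch// => bw; apply: bw => //; rewrite kE; exact: punctured_skel.
    rewrite pullMz; have [->|/eqP/sa[kv _]] := eqVneq (a v) 0; first by rewrite mulr0z.
    rewrite (@pull_chart_outer _ _ _ S w v) ?mul0rz -?kE//.
    by apply/eqP; rewrite eq_sym.
  have sa1 : supported k.+1 n a by move=> w aw; split; [exact: ak|have [] := sa w aw].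
  have va : vanishing [set skel k.+1] (realize u' n a).
    apply: vanishing_sum => w.
    have [->|/eqP/ak kw] := eqVneq (a w) 0; first by rewrite mulr0z; exact: vanishing0.
    by apply: vanishingMz; apply: vanishing_set1 (u'out w n); exact: skel_outer.
  case: n => [|n] in a sa ba ak sa1 va *.
    have [|a' sa' ->] := u'inj k.+1 0 a (ltnSn k) sa1; first exact: ba.
    by exists a' => // w /sa'[].
  have [b vb bE] := ba.
  (* The primitive [b] may have a component on cells of codimension [k]; splitting it off leaves a
     relation relative to [skel k.+1]. *)
  have [|a1 sa1' [f vf bf]] := exck n b vb; first by rewrite -bE.
  have df : coboundary f = realize u' n.+1 (fun w => a w - comb del' a1 w).
    have := bounds_cocycle bf; rewrite realizeB bE -dreal !coboundaryB.
    by move/eqP; rewrite subr_eq0 => /eqP <-.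
  have [||a' sa' aE] := u'inj k.+1 n.+1 (fun w => a w - comb del' a1 w) (ltnSn k).
  + move=> v av; have [a0|/eqP/sa1//] := eqVneq (a v) 0; move: av; rewrite a0 sub0r.
    move=> /eqP; rewrite oppr_eq0 => /eqP cv.
    have [w aw dw] : exists2 w, a1 w <> 0 & del' w v <> 0.
      apply: contrapT => nex; apply: cv; rewrite /comb big1// => w _.
      have [->|/eqP aw] := eqVneq (a1 w) 0; first by rewrite mul0r.
      have [->|/eqP dw] := eqVneq (del' w v) 0; first by rewrite mulr0.
      by case: nex; exists w.
    by have [_ ->] := del'P _ _ dw; have [-> ->] := sa1' _ aw.
  + by rewrite -df; exact: bounds_cob.
  exists (fun w => a1 w + a' w).
    move=> w; have [->|/eqP/sa1'[-> ->]//] := eqVneq (a1 w) 0.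
    by rewrite add0r => /sa'[/ltnW].
  apply/funext => v; have := congr1 (fun g => g v) aE; rewrite /comb => aEv.
  under eq_bigr do rewrite mulrDl.
  by rewrite big_split /= -aEv addrC subrK.
Qed.

Theorem cell_basis_exists : exists u del, cell_basis 0 u del.
Proof.
have [k [u [del b]]] := cell_basis_top.
elim: k u del b => [|k IHk] u del b; first by exists u, del.
by have [u' [del' b']] := cell_basis_step b; exact: IHk b'.
Qed.

End CellBasis.

Arguments gen {R X K} S w n _.
Arguments realize {R X K} u n a _.
Arguments gen_vanishing {R X K} S w n.
Arguments gen_flip {R X K} S w n eps.
Arguments basis_outer {R X K S k u del} _ w n.
Arguments basis_chart {R X K S k u del} _ w n _.

(** * Symmetries of a stratification *)

Lemma flip_signP D (eps : 'I_D -> bool) I : flip_sign eps I = 1 \/ flip_sign eps I = -1.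
Proof.
rewrite /flip_sign; elim/big_rec: _ => [|i y _ [] ->]; first by left.
  by case: (eps i); [right|left].
by case: (eps i); [left|right].
Qed.

Record symmetry (R : realType) (X : topologicalType) (K : finType)
    (S : cellular R X K) := Symmetry {
  sym_act : continuousType X X;
  sym_flip : forall w, 'I_(chart_dim S w) -> bool;
  sym_chart : forall w x, sym_act (chart S w x) = chart S w (flip (@sym_flip w) x)
}.
Arguments sym_flip {R X K S} s w _.

(** Records only the consequence of a homotopy to the identity: the action on absolute cohomology is
    trivial. *)
Definition null_homotopic (R : realType) (X : topologicalType) (f : continuousType X X) :=
  forall n (c : cochain R X n), coboundary c = 0 -> bounds set0 (pull f c - c).

Section Symmetries.
Context {R : realType} {X : topologicalType} {K : finType}.
Variable S : cellular R X K.
Local Notation cd := (codim S).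
Local Notation C := (cell S).
Local Notation j := (chart S).
Local Notation J := (normal S).
Local Notation V w := (range (j w)).
Local Notation skel := (skel S).
Local Notation outer := (outer S).
Local Notation gen := (gen S).
Variables (u : K -> forall n, cochain R X n) (del : K -> K -> int).
Arguments u : clear implicits.
Hypothesis uB : cell_basis S 0 u del.

Definition character (g : symmetry S) w := flip_sign (sym_flip g w) (J w).

Lemma act_cell (g : symmetry S) w x : C w x -> C w (sym_act g x).
Proof.
move=> xw; have [y _ yx] := cell_chart xw; move: xw; rewrite -yx sym_chart.
move=> /chart_cell ny; apply/chart_cell => -[i iJ].
by rewrite flipE mulf_eq0 signr_eq0 /= => yi; apply: ny; exists i.
Qed.

Lemma act_outer (g : symmetry S) w x : outer w x -> outer w (sym_act g x).
Proof. by move=> [v [vw cvw xv]]; exists v; split=> //; exact: act_cell. Qed.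

Lemma cob_basis_vanishing w n : vanishing [set skel (cd w).+1] (coboundary (u w n)).
Proof.
rewrite (basis_cob uB); apply: vanishing_sum => v.
have [->|/eqP/(basis_del uB)[_ vw]] := eqVneq (del w v) 0; first by rewrite mulr0z; exact: vanishing0.
apply: vanishingMz; apply: vanishing_set1 (basis_outer uB v n.+1).
by apply: skel_outer; rewrite vw.
Qed.

Arguments cob_basis_vanishing w n : clear implicits.

(** In the chart of [w] the symmetry multiplies the local generator by the sign of its flip;
    excising the single cell [w] pushes the discrepancy into a cochain that vanishes on
    [skel (cd w).+1]. *)
Lemma basis_character (g : symmetry S) w n : exists2 z : cochain R X n,
  vanishing [set skel (cd w).+1] z &
  bounds [set outer w] (pull (sym_act g) (u w n) - u w n *~ character g w - z).
Proof.
apply: excise_cell.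
- apply: vanishingB; last by apply: vanishingMz; exact: (basis_outer uB w n).
  by apply: pull_vanishing (basis_outer uB w n) => x; exact: act_outer.
- rewrite coboundaryB -pull_cob coboundaryMz; apply: vanishingB; last first.
    by apply: vanishingMz; exact: cob_basis_vanishing.
  apply: pull_vanishing (cob_basis_vanishing w n) => x [v vw xv].
  by exists v => //; exact: act_cell.
- rewrite pullB pullMz (basis_chart uB)//.
  have -> : pull (j w) (pull (sym_act g) (u w n)) = pull (flip (sym_flip g w)) (gen w n).
    rewrite -(basis_chart uB w n)//; apply/funext => s; congr (u w n _).
    by apply/continuousEP => x /=; rewrite sym_chart.
  exact: gen_flip.
Qed.

Lemma pull_chart_realize v n a : (forall w, a w <> 0 -> cd w = cd v) ->
  pull (j v) (realize u n a) = gen v n *~ a v.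
Proof.
move=> ac; rewrite /realize pull_sum (bigD1 v) //= big1 ?addr0 => [|w wv].
  by rewrite pullMz (basis_chart uB).
rewrite pullMz; have [->|/eqP/ac wE] := eqVneq (a w) 0; first by rewrite mulr0z.
rewrite (@pull_chart_outer _ _ _ S v w) ?mul0rz ?wE//.
  by apply/eqP; rewrite eq_sym.
exact: (basis_outer uB w n).
Qed.

(** Compute the action on the coboundary of [u w] in the chart of [v] in two ways: the results are
    [del w v] times either character times the local generator, whose class has infinite order. *)
Lemma del_equivariant (g : symmetry S) w v : del w v <> 0 -> character g w = character g v.
Proof.
move=> dwv; have [_ vw] := basis_del uB dwv.
have delc v' : del w v' <> 0 -> cd v' = cd v by move=> /(basis_del uB)[_ ->].
have [z vz bz] := basis_character g w (cd w).
have zE : coboundary z = pull (sym_act g) (realize u (cd w).+1 (del w)) -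
    realize u (cd w).+1 (del w) *~ character g w.
  have := bounds_cocycle bz; rewrite coboundaryB => /eqP; rewrite subr_eq0 => /eqP <-.
  by rewrite coboundaryB coboundaryMz -pull_cob (basis_cob uB).
have pz : vanishing [set punctured (J v)] (pull (j v) z).
  by apply: pull_vanishing vz => x px; rewrite -vw; exact: punctured_skel.
have := bounds_cob pz; rewrite -pull_cob zE pullB pullMz pull_chart_realize//.
have -> : pull (j v) (pull (sym_act g) (realize u (cd w).+1 (del w))) =
    pull (flip (sym_flip g v)) (gen v (cd w).+1) *~ del w v.
  rewrite -pullMz -(pull_chart_realize (cd w).+1 delc); apply/funext => s; congr (realize _ _ _ _).
  by apply/continuousEP => x /=; rewrite sym_chart.
move=> b1; have b2 := boundsMz (del w v) (gen_flip S v (cd w).+1 (sym_flip g v)).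
have : bounds [set punctured (J v)]
    (gen v (cd w).+1 *~ (del w v * (character g v - character g w))).
  rewrite [X in bounds _ X](_ : _ = (pull (flip (sym_flip g v)) (gen v (cd w).+1) *~ del w v -
    gen v (cd w).+1 *~ del w v *~ character g w) - (pull (flip (sym_flip g v))
    (gen v (cd w).+1) - gen v (cd w).+1 *~ character g v) *~ del w v); last first.
    by apply/funext => s; rewrite !cochainE; ring.
  exact: boundsB.
rewrite -vw => /gen_inj/eqP; rewrite mulf_eq0 subr_eq0.
by case/orP=> [/eqP/dwv//|/eqP ->].
Qed.

(* On the chart of [v] the trace of the cell [w] falls into two parts, where
   [f] is positive or negative, which the symmetry exchanges; the corresponding
   parts of [u w] therefore contribute equally up to sign. *)
Lemma del_even (g : symmetry S) w v (f : 'rV[R]_(chart_dim S v) -> R) :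
  cd v = (cd w).+1 -> continuous f -> (forall x, f (flip (sym_flip g v) x) = - f x) ->
  (forall x, C w (j v x) -> f x != 0) ->
  exists b, del w v = b + b.
Proof.
move=> vw fc fg fC; set n := cd w.
pose Y : set 'rV[R]_(chart_dim S v) := punctured (J v).
pose fl := @flip R _ (sym_flip g v).
pose O := [set x | outer w (j v x)].
have oO : open O by apply: open_comp (@outer_open _ _ _ S w) => x _; exact: cts_fun.
(* [u w] vanishes on [outer w], and in the punctured chart what lies off [O] is the trace of the
   cell [w], where [f] has no zero. So [O1] and [O2] cover [Y] and overlap only inside [O]. *)
pose O1 := Y `&` (O `|` [set x | 0 < f x]); pose O2 := Y `&` (O `|` [set x | f x < 0]).
have oO1 : open O1.
  apply: openI; first exact: punctured_open.
  by apply: openU => //; apply: open_comp (@open_gt _ 0) => x _; exact: fc.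
have oO2 : open O2.
  apply: openI; first exact: punctured_open.
  by apply: openU => //; apply: open_comp (@open_lt _ 0) => x _; exact: fc.
have O12 x : O1 x -> O2 x -> O x.
  by move=> [_ [//|/= f0]] [_ [//|/= f0']]; have := lt_trans f0 f0'; rewrite ltxx.
have YE : Y = O1 `|` O2.
  apply/seteqP; split=> [x Yx|x [[]|[]]//].
  have := punctured_skel Yx; rewrite vw => -[v' v'w xv'].
  have [vE|/eqP v'ne] := eqVneq v' w; last first.
    by left; split=> //; left; exists v'.
  have := fC x; rewrite -vE => /(_ xv'); rewrite neq_lt => /orP[f0|f0].
    by right; split=> //; right.
  by left; split=> //; right.
have flY x : Y x -> Y (fl x) by exact: flip_punctured.
have flO x : O x -> O (fl x) by rewrite /O /= -sym_chart; exact: act_outer.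
have fl12 x : O1 x -> O2 (fl x).
  move=> [/flY Yx [/flO Ox|/= f0]]; split=> //; [by left|right].
  by rewrite /= fg oppr_lt0.
have fl21 x : O2 x -> O1 (fl x).
  move=> [/flY Yx [/flO Ox|/= f0]]; split=> //; [by left|right].
  by rewrite /= fg oppr_gt0.
have Y1 x : O1 x -> Y x by case.
have Y2 x : O2 x -> Y x by case.
pose G := gen v n.+1; pose h := pull (j v) (u w n).
have vG : vanishing [set Y] G by exact: gen_vanishing.
have dh : coboundary h = G *~ del w v.
  by rewrite -pull_cob (basis_cob uB) pull_chart_realize// => v' /(basis_del uB)[_ ->].
have vh : vanishing [set O] h by apply: pull_vanishing (basis_outer uB w n).
have vG1 a : vanishing [set O1] (G *~ a).
  by apply: vanishingMz; apply: vanishing_set1 vG => x; exact: Y1.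
have vG2 a : vanishing [set O2] (G *~ a).
  by apply: vanishingMz; apply: vanishing_set1 vG => x; exact: Y2.
pose u1 := restr O1 h; pose u2 := restr O2 h.
have u12 : vanishing [set O2] u1 by apply: restr_vanishing vh.
have u21 : vanishing [set O1] u2 by apply: restr_vanishing vh => x x2 x1; exact: O12.
have du11 : vanishing [set O1] (coboundary u1).
  rewrite -[u1](subKr h) coboundaryB dh; apply: vanishingB => //.
  by apply: vanishing_cob; exact: restrE.
have du22 : vanishing [set O2] (coboundary u2).
  rewrite -[u2](subKr h) coboundaryB dh; apply: vanishingB => //.
  by apply: vanishing_cob; exact: restrE.
pose small m (e : cochain R 'rV[R]_(chart_dim S v) m) := vanishing [set O1] e /\ vanishing [set O2] e.
have smallB m (e e' : cochain R _ m) : small m e -> small m e' -> small m (e - e').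
  by move=> [e1 e2] [e1' e2']; split; exact: vanishingB.
have smallMz m (e : cochain R _ m) a : small m e -> small m (e *~ a).
  by move=> [e1 e2]; split; exact: vanishingMz.
(* [a] is the class of the coboundary of [e] in the infinite cyclic cohomology of the chart relative
   to [Y]. By [class_inj] below it depends on [e] only up to cochains vanishing on [O1] and on
   [O2]. *)
have classE (e : cochain R 'rV[R]_(chart_dim S v) n) : small n.+1 (coboundary e) ->
    exists a, exists2 y, small n y & coboundary e = G *~ a + coboundary y.
  move=> [e1 e2].
  have [|f' vf' [y' vy' y'E]] := small_simplices2 oO1 oO2 YE e1 e2.
    by rewrite coboundary_coboundary; exact: vanishing0.
  have df' : coboundary f' = 0.
    have := congr1 (@coboundary R _ n.+1) y'E.
    by rewrite coboundaryB !coboundary_coboundary sub0r => /eqP; rewrite oppr_eq0 => /eqP.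
  have [a [y2 vy2 y2E]] := gen_surj vf' df'.
  exists a, (y' + y2); last by rewrite coboundaryD -y'E -y2E; apply/funext => s; rewrite !cochainE; ring.
  split; apply: vanishingD.
  - by apply: vanishing_sub vy' => _ ->; exists O1 => //; left.
  - by apply: vanishing_set1 vy2 => x; exact: Y1.
  - by apply: vanishing_sub vy' => _ ->; exists O2 => //; right.
  - by apply: vanishing_set1 vy2 => x; exact: Y2.
have class_inj a y : small n y -> G *~ a = coboundary y -> a = 0.
  move=> [y1 y2] aE; apply: (@gen_inj _ _ _ S v); rewrite vw -/n -/G aE.
  apply: small_simplices2_bounds oO1 oO2 YE y1 y2 _; rewrite -aE; exact: vanishingMz.
have [|a [y sy yE]] := classE u1; first by split=> //; exact: vanishing_cob.
have [|b [y' sy' y'E]] := classE u2; first by split=> //; exact: vanishing_cob.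
have sh : small n (h - u1 - u2).
  split; first by apply: vanishingB => //; exact: restrE.
  by rewrite addrAC; apply: vanishingB => //; exact: restrE.
have hab : del w v = a + b.
  apply/eqP; rewrite -subr_eq0; apply/eqP.
  apply: (class_inj _ (h - u1 - u2 + y + y')).
    by have := smallB _ _ _ (smallB _ _ _ sh (smallB _ _ _ (smallB _ _ _ sy sy) sy)) (smallB _ _ _ (smallB _ _ _ sy sy) sy'); rewrite !subrr !sub0r !opprK.
  rewrite !(coboundaryB, coboundaryD) dh yE y'E; apply/funext => s; rewrite !cochainE; ring.
have [z vz bz] := basis_character g w n.
pose chi := character g w.
pose hz := pull (j v) z.
have vhz : vanishing [set Y] hz.
  by apply: pull_vanishing vz => x px; rewrite -vw; exact: punctured_skel.
have hfl : pull (j v) (pull (sym_act g) (u w n)) = pull fl h.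
  apply/funext => s; congr (u w n _).
  by apply/continuousEP => x /=; rewrite sym_chart.
(* The primitive of the discrepancy vanishes only on [O]. Its restriction to [O2] has a coboundary
   [e2] that agrees with the discrepancy on [O2] and vanishes on [O1]. *)
have [e2 [e2O2 e2O1 de2]] : exists e2 : cochain R 'rV[R]_(chart_dim S v) n,
    [/\ vanishing [set O2] (pull fl h - h *~ chi - hz - e2), vanishing [set O1] e2 &
        coboundary e2 = 0].
  have : bounds [set O] (pull fl h - h *~ chi - hz).
    by rewrite -hfl -pullMz -!pullB; apply: pull_bounds bz.
  move: (pull fl h - h *~ chi - hz) => c.
  case: (n) c => [|m] c bc.
    by exists 0; split=> //; [rewrite bc subrr|exact: coboundary0].
  have [y0 vy0 ->] := bc; exists (coboundary (restr O2 y0)); split.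
  - by rewrite -coboundaryB; apply: vanishing_cob; exact: restrE.
  - by apply: vanishing_cob; apply: restr_vanishing vy0 => x x2 x1; exact: O12.
  - exact: coboundary_coboundary.
pose E := pull fl u1 - u2 *~ chi - e2.
have sE : small n E.
  split.
    apply: vanishingB => //; apply: vanishingB; last exact: vanishingMz.
    by apply: pull_vanishing u12 => x; exact: fl12.
  rewrite (_ : E = (pull fl h - h *~ chi - hz - e2) - pull fl (h - u1) +
      (h - u2) *~ chi + hz); last by apply/funext => s; rewrite /E /pull !cochainE; ring.
  apply: vanishingD; last by apply: vanishing_set1 vhz => x; exact: Y2.
  apply: vanishingD; last by apply: vanishingMz; exact: restrE.
  apply: vanishingB => //.
  by apply: pull_vanishing (restrE O1 h) => x; exact: fl21.
have sfy : small n (pull fl y).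
  case: sy => y1 y2; split.
    by apply: pull_vanishing y2 => x; exact: fl12.
  by apply: pull_vanishing y1 => x; exact: fl21.
have [e3 ve3 e3E] : exists2 e3 : cochain R 'rV[R]_(chart_dim S v) n, vanishing [set Y] e3 &
    pull fl G - G *~ character g v = coboundary e3
  by exact: (gen_flip S v n.+1 (sym_flip g v)).
have s3 : small n e3.
  by split; apply: vanishing_set1 ve3 => x; [exact: Y1|exact: Y2].
have chiab : a * character g v = b * chi.
  apply/eqP; rewrite -subr_eq0; apply/eqP.
  apply: (class_inj _ (E - (pull fl y - y' *~ chi) - e3 *~ a)).
    exact: (smallB n _ _ (smallB n _ _ sE (smallB n _ _ sfy (smallMz n _ _ sy'))) (smallMz n _ _ s3)).
  rewrite /E !(coboundaryB, coboundaryD, coboundaryMz) -!pull_cob yE y'E de2 -e3E.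
  by apply/funext => s; rewrite /pull !cochainE; ring.
(* Equal characters give [a = b], so [del w v] is twice [a]; opposite characters give [a = - b], so
   it is zero. *)
exists (if character g v == chi then a else 0); rewrite hab.
have := chiab; rewrite /chi /character.
have [->|->] := flip_signP (sym_flip g v) (J v); have [->|->] := flip_signP (sym_flip g w) (J w) => /= ?; lia.
Qed.

Lemma bounds_sum (F : set (set X)) (I : finType) n (c : I -> cochain R X n) :
  (forall i, bounds F (c i)) -> bounds F (\sum_i c i).
Proof.
move=> bc; elim/big_rec: _ => [|i y _ vy]; first exact: bounds0.
exact: boundsD.
Qed.

Lemma bounds_skel0 F n (c : cochain R X n) : bounds F c -> bounds [set skel 0] c.
Proof.
case: n c => [|n] c //= [b vb ->]; exists b => // _ s -> s0.
by have [] := s0 (retr (delta_mx 0 0)).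
Qed.

(** On this part the symmetry acts as -1, up to cochains of degree [n] vanishing on [skel n.+1],
    which carry no cohomology. By hypothesis it also acts as the identity on cohomology, so twice
    the class is zero. *)
Lemma character_killed (g : symmetry S) n a : null_homotopic R (sym_act g) ->
  supported S 0 n a -> comb del a = (fun=> 0) ->
  (forall w, a w <> 0 -> character g w = -1) ->
  exists2 a', forall w, a' w <> 0 -> (cd w).+1 = n & forall v, a v + a v = comb del a' v.
Proof.
move=> ng sa ca ga; pose c := realize u n a.
have dc : coboundary c = 0.
  by rewrite (coboundary_realize _ _ (basis_cob uB)) ca /realize big1// => w _; rewrite mulr0z.
pose z w := projT1 (cid2 (basis_character g w n)).
have zP w : vanishing [set skel (cd w).+1] (z w) /\
    bounds [set outer w] (pull (sym_act g) (u w n) - u w n *~ character g w - z w).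
  by rewrite /z; case: cid2.
pose zz := \sum_w z w *~ a w.
have vzz : vanishing [set skel n.+1] zz.
  apply: vanishing_sum => w; have [->|/eqP/sa[_ wn]] := eqVneq (a w) 0.
    by rewrite mulr0z; exact: vanishing0.
  by apply: vanishingMz; have [+ _] := zP w; rewrite wn.
have b1 : bounds [set skel n] (pull (sym_act g) c + c - zz).
  rewrite (_ : _ - zz = \sum_w (pull (sym_act g) (u w n) - u w n *~ character g w - z w) *~ a w).
    apply: bounds_sum => w; have [->|/eqP/sa[_ wn]] := eqVneq (a w) 0.
      by rewrite mulr0z; exact: bounds0.
    apply: boundsMz; apply: bounds_sub (zP w).2 => _ ->; exists (outer w) => //.
    by rewrite -wn; exact: skel_outer.
  rewrite /c /zz /realize pull_sum -big_split -sumrB; apply: eq_bigr => w _ /=.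
  have [->|/eqP/ga ->] := eqVneq (a w) 0; first by rewrite !mulr0z addr0 subrr.
  by rewrite pullMz; apply/funext => s; rewrite /pull !cochainE; ring.
have dzz : coboundary zz = 0.
  have := bounds_cocycle b1; rewrite coboundaryB coboundaryD -pull_cob dc.
  by rewrite addr0 sub0r => /eqP; rewrite oppr_eq0 => /eqP.
have [a1 sa1] := basis_surj uB (leq0n n.+1) vzz dzz.
rewrite (_ : realize u n a1 = 0) => [|]; last first.
  rewrite /realize big1// => w _; have [->|/eqP/sa1[+ wn]] := eqVneq (a1 w) 0.
    by rewrite mulr0z.
  by rewrite wn ltnn.
rewrite subr0 => bzz.
have b2 : bounds [set skel 0] (realize u n (fun w => a w + a w)).
  rewrite realizeD -/c (_ : c + c = (pull (sym_act g) c + c - zz) + zz - (pull (sym_act g) c - c)).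
    apply: boundsB; last exact: bounds_skel0 (ng _ _ dc).
    by apply: boundsD; [exact: bounds_skel0 b1|exact: bounds_skel0 bzz].
  by apply/funext => s; rewrite !cochainE; ring.
have [|a' sa' aE] := basis_inj uB (leq0n 0) _ b2.
  move=> w aa; apply: sa => a0; apply: aa; by rewrite a0.
by exists a' => [w /sa'[]|v]; rewrite -?aE.
Qed.

Variable N : symmetry S -> Prop.
Hypothesis N_null : forall g, N g -> null_homotopic R (sym_act g).

Definition trivial_cell w := forall g : symmetry S, N g -> character g w = 1.

Lemma trivial_cell_del w v : del w v <> 0 -> trivial_cell w <-> trivial_cell v.
Proof.
move=> dwv; have ch g : character g w = character g v by exact: del_equivariant.
by split=> tr g ng; rewrite -?ch ?tr// ch tr.
Qed.

(** Different cells may need different symmetries, so [a] is split according to the values of all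
    characters from [N]. Since [del] preserves characters, each part is again a cocycle, and one
    symmetry of character -1 serves a whole part. *)
Lemma nontrivial_killed n a : supported S 0 n a -> comb del a = (fun=> 0) ->
  (forall w, a w <> 0 -> ~ trivial_cell w) ->
  exists2 a', forall w, a' w <> 0 -> (cd w).+1 = n & forall v, a v + a v = comb del a' v.
Proof.
move=> sa ca na.
pose same w v := forall g : symmetry S, N g -> character g w = character g v.
pose rep w := odflt w [pick v | `[< same w v >]].
have repP w : same w (rep w).
  by rewrite /rep; case: pickP => [v /asboolP|_ g _].
have repE w v : same w v -> rep w = rep v.
  move=> wv; rewrite /rep (eq_pick (Q := fun v' => `[< same v v' >])); last first.
    move=> v'; apply/asboolP/asboolP => s g ng; first by rewrite -wv// s.
    by rewrite wv// s.
  by case: pickP => // /(_ v)/asboolP[].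
have del_rep w v : del w v <> 0 -> rep w = rep v.
  by move=> dwv; apply: repE => g _; exact: del_equivariant.
pose part w0 w := if rep w == w0 then a w else 0.
have ex w0 : exists a' : K -> int, (forall w, a' w <> 0 -> (cd w).+1 = n) /\
    forall v, part w0 v + part w0 v = comb del a' v.
  have [ex0|nex] := pselect (exists2 v, a v <> 0 & rep v = w0); last first.
    exists (fun=> 0); split=> // v; rewrite /comb big1 => [|w _]; last by rewrite mul0r.
    rewrite /part; case: eqP => // vw0.
    by have [->|/eqP av] := eqVneq (a v) 0; last by case: nex; exists v.
  have [v0 av0 rv0] := ex0.
  have [g ng gv0] : exists2 g : symmetry S, N g & character g v0 <> 1.
    by apply: contrapT => h; apply: (na _ av0) => g ng; apply: contrapT => gv; apply: h; exists g.
  have gv0' : character g v0 = -1 by have [/gv0|] := flip_signP (sym_flip g v0) (J v0).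
  have [|||a' sa' aE] := @character_killed g n (part w0) (N_null ng); last by exists a'.
  - by move=> w; rewrite /part; case: eqP => // _; exact: sa.
  - apply/funext => v; transitivity (if rep v == w0 then comb del a v else 0); last first.
      by rewrite ca; case: ifP.
    rewrite /comb; case: eqP => rv.
      apply: eq_bigr => w _; have [->|/eqP/del_rep wv] := eqVneq (del w v) 0; first by rewrite !mulr0.
      by rewrite /part wv rv eqxx.
    rewrite big1// => w _; have [->|/eqP/del_rep wv] := eqVneq (del w v) 0; first by rewrite mulr0.
    by rewrite /part wv; case: eqP; rewrite ?mul0r.
  - move=> w; rewrite /part; case: eqP => // rw _; rewrite -gv0'.
    by rewrite (repP w)// (repP v0)// rw rv0.
pose f w0 := projT1 (cid (ex w0)).
have fP w0 : (forall w, f w0 w <> 0 -> (cd w).+1 = n) /\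
    forall v, part w0 v + part w0 v = comb del (f w0) v.
  by rewrite /f; case: cid.
exists (fun w => \sum_w0 f w0 w).
  move=> w; apply: contra_notP => wn; rewrite big1// => w0 _.
  by apply: contrapT => /(fP w0).1.
move=> v; transitivity (\sum_w0 (part w0 v + part w0 v)).
  by rewrite (bigD1 (rep v)) //= big1 ?addr0 /part ?eqxx// => w0; rewrite eq_sym => /negbTE ->.
rewrite /comb; under [RHS]eq_bigr do rewrite mulr_suml.
by rewrite [RHS]exchange_big; apply: eq_bigr => w0 _; rewrite (fP w0).2.
Qed.

End Symmetries.

(** * Integral linear algebra *)

Section DiagonalRank.
Variables (F : fieldType) (m : nat).

Definition indicator_mx (P : pred 'I_m) : 'M[F]_m := \matrix_(i, j) ((i == j) && P i)%:R.

Lemma mul_indicator_mxE p (A : 'M[F]_(p, m)) P i j :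
  (A *m indicator_mx P) i j = A i j * (P j)%:R.
Proof.
rewrite mxE (bigD1 j) //= mxE eqxx big1 ?addr0// => k /negbTE kj.
by rewrite mxE kj mulr0.
Qed.

Lemma indicator_mx_mulE p (A : 'M[F]_(m, p)) P i j :
  (indicator_mx P *m A) i j = (P i)%:R * A i j.
Proof.
rewrite mxE (bigD1 i) //= mxE eqxx big1 ?addr0// => k; rewrite eq_sym => /negbTE ki.
by rewrite mxE ki mul0r.
Qed.

Lemma rank_indicator_mx_le P : (\rank (indicator_mx P) <= #|P|)%N.
Proof.
pose X : 'M[F]_(m, #|P|) := \matrix_(i, k) (i == enum_val k)%:R.
rewrite (_ : indicator_mx P = X *m X^T); first exact: mulmx_max_rank.
apply/matrixP => i j; rewrite !mxE; case: (boolP (P i)) => Pi; last first.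
  rewrite andbF big1// => k _; rewrite !mxE; case: eqP => [ik|_]; last by rewrite mul0r.
  by move: Pi; rewrite ik -[P _]/(_ \in P) enum_valP.
have Pi' : i \in P by [].
rewrite andbT (bigD1 (enum_rank_in Pi' i)) //= !mxE enum_rankK_in// eqxx mul1r eq_sym.
rewrite big1 ?addr0// => k kr; rewrite !mxE; case: eqP => [ik|_]; last by rewrite mul0r.
by case/eqP: kr; apply: enum_val_inj; rewrite enum_rankK_in.
Qed.

Lemma rank_indicator_mx P : \rank (indicator_mx P) = #|P|.
Proof.
apply/eqP; rewrite eqn_leq rank_indicator_mx_le /=.
have : (m <= \rank (indicator_mx P) + \rank (indicator_mx (predC P)))%N.
  rewrite -{1}(mxrank1 F m) (_ : 1%:M = indicator_mx P + indicator_mx (predC P)).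
    exact: mxrank_add.
  apply/matrixP => i j; rewrite !mxE /=; case: eqVneq => _ /=; last by rewrite addr0.
  by case: (P i); rewrite ?addr0 ?add0r.
have PC : (#|P| + #|predC P| = m)%N.
  by rewrite -[RHS]card_ord -(cardC P); congr addn; apply: eq_card.
move=> h; rewrite -(leq_add2r #|predC P|) PC; apply: leq_trans h _.
by rewrite leq_add2l rank_indicator_mx_le.
Qed.

Lemma rank_diagonal (d : 'I_m -> F) :
  \rank (\matrix_(i, j) (d i *+ (i == j)) : 'M[F]_m) = #|[pred i | d i != 0]|.
Proof.
pose U : 'M[F]_m := \matrix_(i, j) ((if d i == 0 then 1 else d i) *+ (i == j)).
have Udiag (e : 'I_m -> F) p (A : 'M[F]_(m, p)) i j :
    ((\matrix_(i, j) (e i *+ (i == j)) : 'M[F]_m) *m A) i j = e i * A i j.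
  rewrite mxE (bigD1 i) //= mxE eqxx mulr1n big1 ?addr0// => k; rewrite eq_sym => /negbTE ki.
  by rewrite mxE ki mulr0n mul0r.
have Uu : U \in unitmx.
  pose W : 'M[F]_m := \matrix_(i, j) ((if d i == 0 then 1 else (d i)^-1) *+ (i == j)).
  apply: (proj1 (mulmx1_unit (B := W) _)); apply/matrixP => i j; rewrite Udiag !mxE mulrnAr.
  by case: (eqVneq (d i) 0) => [di|di]; rewrite ?mul1r// mulfV.
rewrite -rank_indicator_mx -[RHS](mxrankMfree _ (B := U)) ?row_free_unit//; congr mxrank.
apply/matrixP => i j; rewrite indicator_mx_mulE !mxE /=.
by case: (eqVneq (d i) 0) => [->|_]; rewrite ?mul0r ?mul0rn ?mul1r.
Qed.

End DiagonalRank.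

Lemma clear_denominators m (v : 'rV[rat]_m) :
  exists2 D : int, D != 0 & exists w : 'rV[int]_m, D%:~R *: v = map_mx intr w.
Proof.
exists (\prod_i denq (v 0 i)); first by apply/prodf_neq0 => i _; exact: denq_neq0.
exists (\row_i (numq (v 0 i) * \prod_(k | k != i) denq (v 0 k))).
apply/rowP => i; rewrite !mxE (bigD1 i) //= !rmorphM /= numqE.
by rewrite mulrC mulrA.
Qed.

Lemma intr_Z2_eq0 (c : int) : c%:~R = 0 :> 'Z_2 -> exists b, c = b + b.
Proof.
have cE := divz_eq c 2; rewrite cE => h; exists (c %/ 2)%Z.
suff -> : (c %% 2)%Z = 0 by rewrite addr0; lia.
have := modz_ge0 c (isT : 2%:Z != 0); have := ltz_pmod c (isT : 0 < 2%:Z).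
move: h; case: (c %% 2)%Z => [[|[|//]]|//] // + _ _.
rewrite rmorphD rmorphM /= (_ : (2%:~R : 'Z_2) = 0) ?mulr0 ?add0r; last exact/val_inj.
by move=> /(congr1 val).
Qed.

Section SmithQuotient.
Variables (m : nat) (M : 'M[int]_m).
Hypothesis saturated : forall (y x : 'rV[int]_m) d, d != 0 -> d *: y = x *m M ->
  exists x', y = x' *m M.

Local Notation rk := (\rank (map_mx intr M : 'M[rat]_m)).

(** Saturation forces the nonzero invariant factors to be units. The image is then a direct summand,
    and [psi] reads its coordinates in the basis of rows of [Q] modulo 2. *)
Lemma smith_mod2 : exists psi : 'rV[int]_m -> 'rV['Z_2]_rk,
  [/\ {morph psi : x y / x - y}, (forall z, exists x, psi (x *m M) = z) &
      forall x, psi (x *m M) = 0 -> exists x', x *m M = (x' + x') *m M].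
Proof.
have [L Lu [Q Qu [d _ ME]]] := int_Smith_normal_form M.
pose Dg : 'M[int]_m := \matrix_(i, j) (d`_i *+ (i == j)).
have {}ME : M = L *m Dg *m Q.
  by rewrite ME; congr (_ *m _ *m _); apply/matrixP => i j; rewrite !mxE.
have DgE (z : 'rV[int]_m) i : (z *m Dg) 0 i = z 0 i * d`_i.
  rewrite mxE (bigD1 i) //= mxE eqxx mulr1n big1 ?addr0// => k /negbTE ki.
  by rewrite mxE ki mulr0n mulr0.
pose P := [pred i : 'I_m | d`_i != 0].
have rkE : rk = #|P|.
  rewrite ME !map_mxM mxrankMfree ?row_free_unit; last first.
    by rewrite unitmxE det_map_mx rmorph_unit// -unitmxE.
  rewrite -mxrank_tr trmx_mul mxrankMfree ?row_free_unit ?unitmx_tr; last first.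
    by rewrite unitmxE det_map_mx rmorph_unit// -unitmxE.
  rewrite mxrank_tr (_ : map_mx _ Dg = \matrix_(i, j) ((d`_i)%:~R *+ (i == j))); last first.
    by apply/matrixP => i j; rewrite !mxE rmorphMn.
  by rewrite rank_diagonal; apply: eq_card => i; rewrite !inE intr_eq0.
have du i : P i -> d`_i * d`_i = 1.
  (* The i-th invariant factor times row i of [Q] lies in the image, hence by saturation so does the
     row itself; comparing coordinates shows that the factor is a unit. *)
  move=> di; have [|x xE] := saturated (y := row i Q) (x := row i (invmx L)) di.
    rewrite ME !mulmxA -row_mul mulVmx// -mulmxA -row_mul mul1mx.
    apply/rowP => j; rewrite !mxE (bigD1 i) //= mxE eqxx mulr1n big1 ?addr0// => k; rewrite eq_sym => /negbTE ki.
    by rewrite mxE ki mulr0n mul0r.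
  have : delta_mx 0 i = x *m L *m Dg.
    have xQ : x *m L *m Dg *m Q = row i Q by rewrite xE ME !mulmxA.
    rewrite -[RHS](mulmxK Qu) xQ -row_mul mulmxV//.
    by apply/rowP => j; rewrite !mxE eqxx /= eq_sym.
  move=> /(congr1 (fun v : 'rV_m => v 0 i)); rewrite DgE mxE !eqxx /= => e.
  by have /orP[/eqP->|/eqP->] := intUnitRing.unitzPl (esym e).
pose z0 : 'I_rk -> 'I_m := fun k => enum_val (cast_ord rkE k).
have z0P k : P (z0 k) by have := enum_valP (cast_ord rkE k).
have z0_inj : injective z0 by move=> k k' /enum_val_inj/cast_ord_inj.
have z0_surj i : P i -> exists k, z0 k = i.
  move=> Pi; have Pi' : i \in P by [].
  exists (cast_ord (esym rkE) (enum_rank_in Pi' i)).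
  by rewrite /z0 cast_ordKV enum_rankK_in.
pose psi (y : 'rV[int]_m) : 'rV['Z_2]_rk := \row_k ((y *m invmx Q) 0 (z0 k))%:~R.
have psiE y k : psi y 0 k = ((y *m invmx Q) 0 (z0 k))%:~R by rewrite mxE.
have psiM x k : psi (x *m M) 0 k = ((x *m L) 0 (z0 k) * d`_(z0 k))%:~R.
  by rewrite psiE -DgE ME !mulmxA mulmxK.
exists psi; split.
- move=> x y; apply/rowP => k; rewrite [RHS]mxE [X in _ = _ + X]mxE !psiE mulmxBl -rmorphB.
  by congr (_ %:~R); rewrite [LHS]mxE [X in _ + X = _]mxE.
(* The invariant factor is put in once more to cancel the one in [Dg], since its square is 1. *)
- move=> z; pose w : 'rV[int]_m := \row_i (\sum_(k | z0 k == i) (z 0 k : nat)%:Z * d`_i).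
  exists (w *m invmx L); apply/rowP => k; rewrite psiM mulmxKV//.
  rewrite mxE (bigD1 k) //= big1 ?addr0; last first.
    by move=> k' /andP[/eqP/z0_inj -> /eqP].
  by rewrite -mulrA du// mulr1 -pmulrn natr_Zp.
- move=> x x0; pose w := x *m L.
  have w2 i : P i -> exists b : int, w 0 i = b + b.
    move=> Pi; have [k ki] := z0_surj _ Pi.
    have := congr1 (fun v : 'rV_rk => v 0 k) x0; rewrite psiM ki [RHS]mxE -/w => e.
    have [c cE] := intr_Z2_eq0 e; exists (c * d`_i).
    by rewrite -[LHS]mulr1 -(du i Pi) mulrA cE mulrDl.
  have exb i : exists b : int, P i -> w 0 i = b + b.
    by case: (boolP (P i)) => [/w2[b bE]|_]; [exists b|exists 0].
  have [b bP] := choice exb.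
  pose r : 'rV[int]_m := \row_i b i.
  have rE i : (r + r) 0 i = b i + b i by rewrite !mxE.
  exists (r *m invmx L); rewrite ME !mulmxA; congr (_ *m _).
  apply/rowP => i; rewrite !DgE mulmxDl mulmxKV// rE -/w.
  have [->|di] := eqVneq d`_i 0; first by rewrite !mulr0.
  by rewrite -(bP i di).
Qed.
End SmithQuotient.

Section QuotientIso.
Local Open Scope quotient_scope.

(** [rep z v] says that the vector [v] represents [z]. It is a relation and not a function because
    the cellular coordinates of a cocycle are determined only up to coboundaries. *)
Lemma quotient_group_iso (A : zmodType) (I : zmodClosed A) (L G : zmodType)
    (rep : A -> L -> Prop) (phi : L -> G) :
  {morph phi : x y / x - y} ->
  (forall z, exists v, rep z v) ->
  (forall z z' v v', rep z v -> rep z' v' -> rep (z - z') (v - v')) ->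
  (forall z v, rep z v -> (z \in I) <-> phi v = 0) ->
  (forall y, exists z v, rep z v /\ phi v = y) ->
  group_iso (Quotient.quot I) G.
Proof.
move=> phiB rep_ex repB rep0 phi_surj.
pose v z := projT1 (cid (rep_ex z)).
have vP z : rep z (v z) by rewrite /v; case: cid.
pose f (x : Quotient.quot I) := phi (v (generic_quotient.repr x)).
have fE z w : rep z w -> f (\pi_(Quotient.quot I) z) = phi w.
  move=> zw; apply/eqP; rewrite -subr_eq0 -phiB; apply/eqP.
  by apply/(rep0 _ _ (repB _ _ _ _ (vP _) zw)); rewrite Quotient.idealrBE reprK.
have piB a b : \pi_(Quotient.quot I) (a - b) = \pi_(Quotient.quot I) a - \pi_(Quotient.quot I) b.
  by rewrite !piE.
have fB : zmod_morphism f.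
  move=> x y; rewrite -[x]reprK -[y]reprK -piB (fE _ (v (generic_quotient.repr x) - v (generic_quotient.repr y))).
    by rewrite phiB !(fE _ _ (vP _)).
  exact: repB.
pose F : {additive Quotient.quot I -> G} :=
  HB.pack f (GRing.isZmodMorphism.Build _ _ f fB).
exists F.
have Finj : injective f.
  move=> x y /eqP; rewrite -subr_eq0 -fB => /eqP; rewrite -[x]reprK -[y]reprK -piB.
  rewrite (fE _ _ (vP _)) => /(rep0 _ _ (vP _)); rewrite Quotient.idealrBE.
  by move=> /eqP.
have Fsurj y : exists x, f x = y.
  have [z [w [zw <-]]] := phi_surj y; exists (\pi_(Quotient.quot I) z).
  by rewrite (fE _ w).
have [g gP] := choice Fsurj.
by exists g => [x|y]; [apply: Finj; rewrite gP|rewrite /= gP].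
Qed.

End QuotientIso.

Lemma is_coboundaryE (R : realType) (X : topologicalType) n (z : cocycle R X n) :
  (z \in @is_coboundary R X n) <-> bounds set0 (cocycle_val z).
Proof.
case: n z => [|n] z; rewrite unfold_in /=.
  by split=> [/eqP ->//|z0]; apply/eqP/val_inj.
by split=> [/asboolP[b bE]|[b _ bE]]; [exists b|apply/asboolP; exists b].
Qed.

(** * The number of Z/2 summands as the rank of the halved differential *)

Section Z2Rank.
Context {R : realType} {X : topologicalType} {K : finType}.
Variable S : cellular R X K.
Local Notation cd := (codim S).
Variables (u : K -> forall n, cochain R X n) (del : K -> K -> int).
Arguments u : clear implicits.
Hypothesis uB : cell_basis S 0 u del.
Hypothesis del_even : forall w v, exists b, del w v = b + b.
Variable N : symmetry S -> Prop.
Hypothesis N_null : forall g, N g -> null_homotopic R (sym_act g).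
Hypothesis trivial_codim : forall w, trivial_cell N w -> (4 %| cd w)%N.

Definition trivialb w := `[< trivial_cell N w >].

Definition half_del w v : int := projT1 (cid (del_even w v)).

Lemma half_delE w v : del w v = half_del w v + half_del w v.
Proof. by rewrite /half_del; case: cid. Qed.

Lemma half_del_neq0 w v : half_del w v <> 0 -> del w v <> 0.
Proof. by rewrite half_delE; lia. Qed.

Lemma half_del_nontrivial w v : half_del w v <> 0 -> ~~ trivialb w /\ ~~ trivialb v.
Proof.
move=> /half_del_neq0 dwv; have [_ vw] := basis_del uB dwv.
have nt : ~ trivial_cell N w.
  move=> tw; have := trivial_codim tw; have := trivial_codim (iffLR (trivial_cell_del uB N dwv) tw).
  by rewrite vw => /dvdnP[p pE] /dvdnP[q qE]; lia.
by split; apply/asboolP => // /(iffRL (trivial_cell_del uB N dwv)).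
Qed.

Lemma half_del_codim w v : half_del w v <> 0 -> cd v = (cd w).+1.
Proof. by move=> /half_del_neq0/(basis_del uB)[]. Qed.

Lemma realize_inj n a : supported S 0 n a -> realize u n a = 0 -> a = fun=> 0.
Proof.
move=> sa ra; apply/funext => w; have [->//|/eqP aw] := eqVneq (a w) 0.
apply: (@gen_inj _ _ _ S w); have [_ wn] := sa w aw.
have := pull_chart_realize uB n (v := w) (a := a); rewrite ra wn => <-.
  exact: bounds0.
by move=> v /sa[_ ->].
Qed.

Lemma supported_comb n a : supported S 0 n a -> supported S 0 n.+1 (comb del a).
Proof.
move=> sa v cv; split=> //.
have [w aw dw] : exists2 w, a w <> 0 & del w v <> 0.
  apply: contrapT => nex; apply: cv; rewrite /comb big1// => w _.
  have [->|/eqP aw] := eqVneq (a w) 0; first by rewrite mul0r.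
  have [->|/eqP dw] := eqVneq (del w v) 0; first by rewrite mulr0.
  by case: nex; exists w.
by have [_ ->] := basis_del uB dw; have [_ ->] := sa _ aw.
Qed.

Lemma comb_comb n a : supported S 0 n a -> comb del (comb del a) = fun=> 0.
Proof.
move=> sa; apply: (@realize_inj n.+2); first by do 2 apply: supported_comb.
by rewrite -!(coboundary_realize _ _ (basis_cob uB)) coboundary_coboundary.
Qed.

Local Notation m := #|K|.
Implicit Types v x : 'rV[int]_m.

Definition to_fun v (w : K) : int := v 0 (enum_rank w).
Definition of_fun (a : K -> int) : 'rV[int]_m := \row_i a (enum_val i).

Lemma to_funK v : of_fun (to_fun v) = v.
Proof. by apply/rowP => i; rewrite mxE /to_fun enum_valK. Qed.

Lemma of_funK a : to_fun (of_fun a) = a.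
Proof. by apply/funext => w; rewrite /to_fun mxE enum_rankK. Qed.

(** A square matrix over all cells, with zero rows away from codimension [n], so that differentials
    of consecutive degrees act on the same space. *)
Definition del_mx n : 'M[int]_m :=
  \matrix_(i, j) if cd (enum_val i) == n then half_del (enum_val i) (enum_val j) else 0.

Definition del_mx_pred n : 'M[int]_m := if n is k.+1 then del_mx k else 0.

Lemma to_fun_del_mx n v w :
  to_fun (v *m del_mx n) w = \sum_w' (if cd w' == n then to_fun v w' * half_del w' w else 0).
Proof.
rewrite /to_fun mxE (reindex_onto enum_rank enum_val) => [|i _]; last exact: enum_valK.
rewrite (eq_bigl xpredT) => [|w']; last by rewrite enum_rankK eqxx.
by apply: eq_bigr => w' _; rewrite mxE !enum_rankK; case: ifP; rewrite ?mulr0.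
Qed.

Lemma comb_del_mx n a : (forall w, a w <> 0 -> cd w = n) ->
  comb del a = to_fun ((of_fun a + of_fun a) *m del_mx n).
Proof.
move=> an; apply/funext => w; rewrite to_fun_del_mx; apply: eq_bigr => w' _.
rewrite /to_fun !mxE enum_rankK half_delE; case: eqP => [_|wn]; first by ring.
by have [->|/eqP/an//] := eqVneq (a w') 0; rewrite mul0r.
Qed.

Definition trunc_mx n v : 'rV[int]_m := of_fun (fun w => if cd w == n then to_fun v w else 0).

Lemma trunc_del_mx n v : trunc_mx n v *m del_mx n = v *m del_mx n.
Proof.
rewrite -[LHS]to_funK -[RHS]to_funK; congr of_fun; apply/funext => w.
rewrite !to_fun_del_mx; apply: eq_bigr => w' _; case: eqP => // wn.
by rewrite /trunc_mx of_funK wn eqxx.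
Qed.

Lemma double_inj v x : v + v = x + x -> v = x.
Proof.
move=> e; apply/rowP => i; have := congr1 (fun y : 'rV_m => y 0 i) e.
by rewrite [LHS]mxE [RHS]mxE; move: (v 0 i) (x 0 i) => a b; lia.
Qed.

Lemma del_mx_supported n v w : to_fun (v *m del_mx n) w <> 0 ->
  cd w = n.+1 /\ ~~ trivialb w.
Proof.
rewrite to_fun_del_mx => s0.
have [w' wn hw] : exists2 w', cd w' = n & half_del w' w <> 0.
  apply: contrapT => nex; apply: s0; rewrite big1// => w' _; case: eqP => // wn.
  have [->|/eqP dw] := eqVneq (half_del w' w) 0; first by rewrite mulr0.
  by case: nex; exists w'.
by rewrite (half_del_codim hw) wn; split=> //; have [] := half_del_nontrivial hw.
Qed.

Lemma del_mx_mul n : del_mx n *m del_mx n.+1 = 0.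
Proof.
apply/row_matrixP => i; rewrite row0 row_mul rowE.
set v := delta_mx 0 i.
rewrite -(trunc_del_mx n v); set a := to_fun (trunc_mx n v).
have sa : supported S 0 n a.
  by move=> w; rewrite /a /trunc_mx of_funK; case: eqP.
have cE : comb del a = to_fun ((of_fun a + of_fun a) *m del_mx n).
  by apply: comb_del_mx => w /sa[].
have sc := supported_comb sa; have := comb_comb sa.
rewrite (comb_del_mx (n := n.+1) (a := comb del a)) => [|w /sc[]//].
have aK : of_fun a = trunc_mx n v by exact: to_funK.
rewrite cE aK => /(congr1 of_fun); rewrite !to_funK.
rewrite (_ : of_fun (fun=> 0) = 0) => [|]; last by apply/rowP => k; rewrite !mxE.
rewrite !mulmxDl => e.
by apply: double_inj; rewrite addr0; apply: double_inj; rewrite addr0.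
Qed.

(** If a multiple of [v] is hit by the halved differential, then [v] is a cocycle on nontrivial
    cells, so [v + v] is a value of the full differential. Dividing by 2 puts [v] in the image of
    the halved one. *)
Lemma saturated_del_mx_pred n v x (d : int) : d != 0 -> d *: v = x *m del_mx_pred n ->
  exists x', v = x' *m del_mx_pred n.
Proof.
case: n => [|n] d0 /= vE.
  exists 0; rewrite mulmx0; apply/rowP => i; have := congr1 (fun y : 'rV_m => y 0 i) vE.
  by rewrite mulmx0 !mxE => /eqP; rewrite mulf_eq0 (negbTE d0) => /eqP.
have sv w : to_fun v w <> 0 -> cd w = n.+1 /\ ~~ trivialb w.
  move=> vw; apply: (@del_mx_supported _ x); rewrite -vE /to_fun mxE => /eqP.
  by rewrite mulf_eq0 (negbTE d0) => /eqP.
have [|||a' sa' aE] := nontrivial_killed uB N_null (n := n.+1) (a := to_fun v).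
- by move=> w /sv[].
- rewrite (comb_del_mx (n := n.+1)) => [|w /sv[]//]; rewrite to_funK.
  suff -> : (v + v) *m del_mx n.+1 = 0 by apply/funext => w; rewrite /to_fun mxE.
  apply/rowP => i; rewrite mulmxDl.
  have e : d *: (v *m del_mx n.+1) = 0 by rewrite scalemxAl vE -mulmxA del_mx_mul mulmx0.
  have := congr1 (fun y : 'rV_m => y 0 i) e.
  rewrite [LHS]mxE [RHS]mxE => /eqP; rewrite mulf_eq0 (negbTE d0) /= => /eqP vi.
  by rewrite [LHS]mxE vi addr0 [RHS]mxE.
- by move=> w /sv[_ /asboolP].
exists (of_fun a'); apply: double_inj; rewrite -mulmxDl.
rewrite -[RHS]to_funK -(comb_del_mx (n := n)) => [|w /sa'[]//].
by apply/rowP => i; rewrite !mxE -aE /to_fun enum_valK.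
Qed.

Definition del_rank n := \rank (map_mx intr (del_mx_pred n) : 'M[rat]_m).

Lemma comb_del_mx_pred n (a : K -> int) : (forall w, a w <> 0 -> (cd w).+1 = n) ->
  comb del a = to_fun ((of_fun a + of_fun a) *m del_mx_pred n).
Proof.
case: n => [|n] an /=; last by apply: comb_del_mx => w /an[].
apply/funext => w; rewrite mulmx0 /to_fun mxE /comb big1// => w' _.
by have [->|/eqP/an//] := eqVneq (a w') 0; rewrite mul0r.
Qed.

Lemma nontrivial_image n v : (forall w, to_fun v w <> 0 -> cd w = n /\ ~~ trivialb w) ->
  v *m del_mx n = 0 -> exists x, v = x *m del_mx_pred n.
Proof.
move=> sv v0; have [|||a' sa' aE] := nontrivial_killed uB N_null (n := n) (a := to_fun v).
- by move=> w /sv[].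
- rewrite (comb_del_mx (n := n)) => [|w /sv[]//].
  by rewrite to_funK mulmxDl v0 addr0; apply/funext => w; rewrite /to_fun mxE.
- by move=> w /sv[_ /asboolP].
exists (of_fun a'); apply: double_inj; rewrite -mulmxDl.
rewrite -[RHS]to_funK -(comb_del_mx_pred (n := n)) => [|w /sa'//].
by apply/rowP => i; rewrite !mxE -aE /to_fun enum_valK.
Qed.

Lemma del_mx_pred_supported n x w : to_fun (x *m del_mx_pred n) w <> 0 ->
  cd w = n /\ ~~ trivialb w.
Proof.
case: n => [|n]; last exact: del_mx_supported.
by rewrite /= mulmx0 /to_fun mxE.
Qed.

Lemma del_mx_pred_mul n : del_mx_pred n *m del_mx n = 0.
Proof. by case: n => [|n]; rewrite /= ?mul0mx// del_mx_mul. Qed.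

Lemma trivial_del_mx n v : (forall w, to_fun v w <> 0 -> cd w <> n \/ trivialb w) ->
  v *m del_mx n = 0.
Proof.
move=> tv; rewrite -[LHS]to_funK; apply/rowP => i; rewrite mxE to_fun_del_mx mxE.
rewrite big1// => w _; case: eqP => // wn.
have [->|/eqP/tv[//|tw]] := eqVneq (to_fun v w) 0; first by rewrite mul0r.
have [->|/eqP/half_del_nontrivial[]] := eqVneq (half_del w (enum_val i)) 0; first by rewrite mulr0.
by rewrite tw.
Qed.

(** Rank and nullity over the rationals: the kernel of the halved differential leaving degree [n] is
    the image of the one entering it plus all coordinates off the nontrivial cells of degree [n].
    Integral exactness becomes rational by clearing denominators. *)
Lemma del_rank_count n :
  (del_rank n + del_rank n.+1)%N = #|[pred w | ~~ trivialb w & cd w == n]|.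
Proof.
pose A : 'M[rat]_m := map_mx intr (del_mx_pred n).
pose B : 'M[rat]_m := map_mx intr (del_mx n).
pose P := [pred i : 'I_m | ~~ trivialb (enum_val i) & cd (enum_val i) == n].
have -> : #|[pred w | ~~ trivialb w & cd w == n]| = #|P|.
  rewrite -(fintype.card_image (@enum_rank_inj K)); apply: eq_card => i.
  apply/fintype.imageP/idP => [[w wP ->]|iP]; first by rewrite inE /= enum_rankK.
  by exists (enum_val i); rewrite ?enum_valK.
pose Q : 'M[rat]_m := indicator_mx rat (predC P).
have AP : A *m indicator_mx rat P = A.
  apply/matrixP => i k; rewrite mul_indicator_mxE; case: (boolP (P k)) => [_|Pk]; first by rewrite mulr1.
  rewrite mulr0 mxE (_ : del_mx_pred n i k = 0) ?rmorph0//.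
  apply/eqP; apply: contraNT Pk => dik.
  have [|kn kt] := @del_mx_pred_supported n (delta_mx 0 i) (enum_val k); last first.
    by rewrite /P /= kn kt eqxx.
  by rewrite -rowE /to_fun mxE enum_valK; exact/eqP.
have AB : A *m B = 0 by rewrite -map_mxM del_mx_pred_mul map_mx0.
have QB : Q *m B = 0.
  apply/matrixP => i k; rewrite indicator_mx_mulE -[predC P i]/(~~ P i).
  case: (boolP (P i)) => [_|/= Pi]; first by rewrite mul0r mxE.
  rewrite mul1r !mxE; case: eqP => [wn|_]; last by rewrite rmorph0.
  have [->|/eqP/half_del_nontrivial[nt _]] := eqVneq (half_del (enum_val i) (enum_val k)) 0.
    by rewrite rmorph0.
  by move: Pi; rewrite negb_and wn eqxx nt.
have AQ : (A :&: Q)%MS = 0.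
  apply/eqP; rewrite -submx0; apply/rV_subP => v; rewrite sub_capmx => /andP[/submxP[x ->] /submxP[y yE]].
  rewrite submx0; apply/eqP; rewrite -AP mulmxA yE -mulmxA.
  rewrite (_ : Q *m _ = 0) ?mulmx0//; apply/matrixP => i k.
  rewrite mul_indicator_mxE !mxE; case: eqP => [->|_]; last by rewrite mul0r.
  by rewrite -[predC P k]/(~~ P k); case: (P k); rewrite ?mul0r ?mulr0.
have kE : (kermx B :=: A + Q)%MS.
  apply/eqmxP/andP; split; last first.
    by rewrite addsmx_sub; apply/andP; split; apply/sub_kermxP.
  apply/rV_subP => v /sub_kermxP vB.
  have vE : v = v *m indicator_mx rat P + v *m Q.
    apply/rowP => i; rewrite [RHS]mxE !mul_indicator_mxE -[predC P i]/(~~ P i).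
    by case: (P i); rewrite ?mulr1 ?mulr0 ?addr0 ?add0r.
  rewrite vE; apply: addmx_sub_adds; last exact: submxMl.
  have [D D0 [w wE]] := clear_denominators (v *m indicator_mx rat P).
  have wB : w *m del_mx n = 0.
    have : map_mx intr (w *m del_mx n) = 0 :> 'M[rat]_(1, m).
      have IP : v *m indicator_mx rat P = v - v *m Q by rewrite {2}vE addrK.
      by rewrite map_mxM -wE -scalemxAl IP mulmxBl vB -mulmxA QB mulmx0 subrr scaler0.
    by move/matrixP => e; apply/matrixP => i k; have /eqP := e i k; rewrite [X in _ == X -> _]mxE [X in X == _ -> _]mxE intr_eq0 => /eqP ->; rewrite mxE.
  have [|x xE] := @nontrivial_image n w _ wB.
    move=> k wk; have : P (enum_rank k).
      apply: contra_notT wk => Pk; have := congr1 (fun y : 'rV_m => y 0 (enum_rank k)) wE.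
      rewrite mxE mul_indicator_mxE (negbTE Pk) mulr0 mulr0 mxE => /esym/eqP.
      by rewrite intr_eq0 => /eqP.
    by rewrite /P /= enum_rankK => /andP[nt /eqP].
  have -> : v *m indicator_mx rat P = (D%:~R)^-1 *: (map_mx intr x *m A).
    by rewrite -map_mxM -xE -wE scalerA mulVf ?scale1r// intr_eq0.
  by rewrite scalemx_sub// submxMl.
have := mxrank_ker B; rewrite kE (mxrank_disjoint_sum AQ) rank_indicator_mx.
have rB := rank_leq_row B; have : (#|P| + #|predC P| = m)%N.
  by rewrite -[RHS]card_ord -(cardC P); congr addn; apply: eq_card.
rewrite /del_rank -/A -/B; move: (\rank A) (\rank B) rB => a b.
by move: #|P| #|predC P| => p q; lia.
Qed.

(** The trivial cells of codimension [n] give the free part. On the nontrivial cells the cocycles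
    are the image of the halved differential and the coboundaries are twice that image, so [psi]
    identifies the quotient with a power of Z/2. *)
Lemma cohomology_Z2_rank n : Z2_rank (cohomology R X n) (del_rank n).
Proof.
have [psi [psiB psi_surj psi_ker]] := smith_mod2 (@saturated_del_mx_pred n).
pose T := [pred w | trivialb w & cd w == n].
exists #|T|.
pose ntr v : 'rV[int]_m := of_fun (fun w => if trivialb w then 0 else to_fun v w).
pose phi v : Z_sum_Z2 #|T| (del_rank n) :=
  (\row_k to_fun v (enum_val k), psi (ntr v)).
have psi0 : psi 0 = 0 by rewrite -(subrr (0 : 'rV[int]_m)) psiB subrr.
have psi2 v : psi (v + v) = 0.
  have psiN x : psi (- x) = - psi x by rewrite -sub0r psiB psi0 sub0r.
  rewrite -{2}[v]opprK psiB psiN opprK.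
  by apply/rowP => k; rewrite !mxE -mulr2n -mulr_natr (_ : 2%:R = 0) ?mulr0//; exact/val_inj.
pose rep (z : cocycle R X n) v := [/\ supported S 0 n (to_fun v), comb del (to_fun v) = fun=> 0 &
  bounds [set skel S 0] (cocycle_val z - realize u n (to_fun v))].
have dz (z : cocycle R X n) : coboundary (cocycle_val z) = 0.
  by have := valP z; rewrite unfold_in => /eqP.
have skel0v k (c : cochain R X k) : vanishing [set skel S 0] c.
  by move=> _ s -> /(_ (retr (delta_mx 0 0)))[].
have combn v : supported S 0 n (to_fun v) -> comb del (to_fun v) = (fun=> 0) -> v *m del_mx n = 0.
  move=> sv; rewrite (comb_del_mx (n := n)) ?to_funK => [|w /sv[]//].
  move=> /(congr1 of_fun); rewrite to_funK mulmxDl (_ : of_fun (fun=> 0) = 0) => [e|].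
    by apply: double_inj; rewrite addr0.
  by apply/rowP => k; rewrite !mxE.
apply: (@quotient_group_iso _ _ _ _ rep phi).
- move=> v x; congr pair; last first.
    rewrite -psiB; congr psi; apply/rowP => k; rewrite !mxE /to_fun !mxE.
    by case: ifP; rewrite ?subrr.
  by apply/rowP => k; rewrite !mxE /to_fun !mxE.
- move=> z; have [a sa ba] := basis_surj uB (leq0n 0) (skel0v _ (cocycle_val z)) (dz z).
  exists (of_fun a); rewrite /rep of_funK; split=> //.
  apply: (realize_inj (supported_comb sa)); rewrite -(coboundary_realize _ _ (basis_cob uB)).
  have := bounds_cocycle ba; rewrite coboundaryB dz sub0r => /eqP.
  by rewrite oppr_eq0 => /eqP.
- move=> z z' v v' [sz cz bz] [sz' cz' bz'].
  have fB : to_fun (v - v') = fun w => to_fun v w - to_fun v' w.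
    by apply/funext => w; rewrite /to_fun !mxE.
  rewrite /rep fB; split.
  + move=> w; have [->|/eqP/sz//] := eqVneq (to_fun v w) 0.
    by have [->|/eqP/sz'//] := eqVneq (to_fun v' w) 0; rewrite subr0.
  + apply/funext => w; rewrite /comb; under eq_bigr do rewrite mulrBl.
    rewrite sumrB -/(comb del (to_fun v) w) -/(comb del (to_fun v') w) cz cz'.
    by rewrite subrr.
  + rewrite realizeB -[cocycle_val (z - z')]/(cocycle_val z - cocycle_val z').
    rewrite (_ : _ - _ = (cocycle_val z - realize u n (to_fun v)) -
      (cocycle_val z' - realize u n (to_fun v'))); first exact: boundsB.
    by apply/funext => s; rewrite !cochainE; ring.
- move=> z v [sv cv bv]; split.
    move=> /is_coboundaryE/(bounds_skel0 S) bz.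
    have br : bounds [set skel S 0] (realize u n (to_fun v)).
      rewrite -[realize _ _ _](subKr (cocycle_val z)); exact: boundsB.
    have [a' sa' aE] := basis_inj uB (leq0n 0) sv br.
    have sa1 w : a' w <> 0 -> (cd w).+1 = n by move=> /sa'[].
    have vE : v = (of_fun a' + of_fun a') *m del_mx_pred n.
      by rewrite -[v]to_funK aE (comb_del_mx_pred sa1) to_funK.
    have tv w : trivialb w -> to_fun v w = 0.
      move=> tw; have [//|/eqP] := eqVneq (to_fun v w) 0.
      by rewrite vE => /del_mx_pred_supported[_]; rewrite tw.
    congr pair.
      apply/rowP => k; rewrite !mxE; apply: tv.
      by have := enum_valP k; rewrite inE => /andP[].
    have -> : ntr v = v.
      rewrite -[RHS]to_funK; congr of_fun; apply/funext => w.
      by case: ifP => // /tv ->.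
    by rewrite vE mulmxDl psi2.
  case=> p1 p2.
  have tv w : trivialb w -> to_fun v w = 0.
    move=> tw; have [//|/eqP vw] := eqVneq (to_fun v w) 0.
    have wT : w \in T by rewrite inE tw /=; have [_ ->] := sv w vw.
    have := congr1 (fun y : 'rV_#|T| => y 0 (enum_rank_in wT w)) p1.
    by rewrite !mxE enum_rankK_in.
  have ntrv : ntr v = v.
    rewrite -[RHS]to_funK; congr of_fun; apply/funext => w.
    by case: ifP => // /tv ->.
  have [x xE] := @nontrivial_image n v (fun w vw => conj (sv w vw).2
    (introN idP (fun tw => vw (tv w tw)))) (combn v sv cv).
  move: p2; rewrite ntrv xE => /psi_ker[x' x'E].
  apply/is_coboundaryE; rewrite -[cocycle_val z](subrK (realize u n (to_fun v))).
  apply: (bounds_sub (F := [set skel S 0])) => //; apply: boundsD => //.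
  rewrite xE x'E; case: (n) => [|k] /=.
    rewrite mulmx0 /realize (_ : \sum_w _ = 0) ?big1 // => w _.
    by rewrite /to_fun mxE mulr0z.
  exists (realize u k (to_fun (trunc_mx k x'))) => //.
  rewrite (coboundary_realize _ _ (basis_cob uB)) (comb_del_mx (n := k)).
    by rewrite to_funK !mulmxDl trunc_del_mx.
  by move=> w; rewrite of_funK; case: eqP.
move=> [p y]; have [x xE] := psi_surj y.
(* The preimage has the prescribed integers on the trivial cells, plus a value of the halved
   differential with the prescribed reduction modulo 2. *)
pose a w := \sum_(k < #|T|) p 0 k * (enum_val k == w)%:R.
have aT k : a (enum_val k) = p 0 k.
  rewrite /a (bigD1 k) //= eqxx mulr1 big1 ?addr0// => k' kk'.
  by rewrite (inj_eq enum_val_inj) (negbTE kk') mulr0.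
have aP w : a w <> 0 -> trivialb w /\ cd w = n.
  move=> aw; have [k kw] : exists k : 'I_#|T|, enum_val k = w.
    apply: contrapT => nex; apply: aw; rewrite /a big1// => k _.
    by case: eqP => [kw|_]; rewrite ?mulr0//; case: nex; exists k.
  by have := enum_valP k; rewrite kw inE => /andP[-> /eqP].
pose b := x *m del_mx_pred n; pose v := of_fun a + b.
have vE w : to_fun v w = a w + to_fun b w by rewrite /to_fun !mxE enum_rankK.
have vM : v *m del_mx n = 0.
  rewrite mulmxDl -mulmxA del_mx_pred_mul mulmx0 addr0; apply: trivial_del_mx => w.
  by rewrite of_funK => /aP[]; right.
have sv : supported S 0 n (to_fun v).
  move=> w; rewrite vE => vw; split=> //.
  have [aw|/eqP/aP[]//] := eqVneq (a w) 0; move: vw.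
  by rewrite aw add0r => /del_mx_pred_supported[].
have cv : comb del (to_fun v) = fun=> 0.
  rewrite (comb_del_mx (n := n)) => [|w /sv[]//].
  by rewrite to_funK mulmxDl vM addr0; apply/funext => w; rewrite /to_fun mxE.
have zP : realize u n (to_fun v) \in @is_cocycle R X n.
  rewrite unfold_in; apply/eqP; rewrite (coboundary_realize _ _ (basis_cob uB)) cv.
  by rewrite /realize big1// => w _; rewrite mulr0z.
exists (Cocycle zP), v; split; first by split=> //=; rewrite subrr; exact: bounds0.
have tb w : trivialb w -> to_fun b w = 0.
  move=> tw; have [//|/eqP/del_mx_pred_supported[_]] := eqVneq (to_fun b w) 0.
  by rewrite tw.
congr pair.
  apply/rowP => k; rewrite mxE vE aT tb ?addr0//.
  by have := enum_valP k; rewrite inE => /andP[].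
rewrite (_ : ntr v = b)// -[RHS]to_funK; congr of_fun; apply/funext => w.
case: ifP => [/tb ->//|tw]; rewrite vE.
by have [->|/eqP/aP[]] := eqVneq (a w) 0; rewrite ?add0r// tw.
Qed.

End Z2Rank.

(** * Schubert cells in flag manifolds *)

Section Frames.
Context {R : realType} {r : nat} {e : 'I_r -> nat}.
Local Notation M := (ambient_dim e).
Local Notation X := (flag R e).
Local Notation mx := 'M[R]_M.
Local Notation row_vec := 'rV[R]_M.
Local Notation frame := (@frame R r e).
Implicit Types (F G : X) (g : mx) (i : 'I_r).

Definition flag_space F i : {vspace row_vec} := val F i.

Lemma dim_space F i : \dim (flag_space F i) = flag_dim e i.
Proof. by have /andP[/forallP/(_ i)/eqP] := valP F. Qed.

Lemma space_mono F i (k : 'I_r) : (i <= k)%N -> (flag_space F i <= flag_space F k)%VS.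
Proof. by move=> ik; have /andP[_ /forallP/(_ i)/forallP/(_ k)/implyP] := valP F; apply. Qed.

Lemma flag_eq F G : (forall i, (flag_space F i <= flag_space G i)%VS) -> F = G.
Proof.
move=> FG; apply/val_inj/ffunP => i; apply/eqP.
by rewrite eqEdim [(_ <= _)%VS]FG /= -/(flag_space F i) -/(flag_space G i) !dim_space.
Qed.

(** Total on matrices, with the identity frame as default for singular ones, so that flags can be
    handled by matrix formulas and invertibility becomes a hypothesis of lemmas. *)
Definition mk_frame g : frame :=
  if pselect (g \in unitmx) is left u then exist _ g (mem_set u)
  else exist _ 1%:M (mem_set (unitmx1 R M)).

Lemma mk_frameE g : g \in unitmx -> set_val (mk_frame g) = g.
Proof. by rewrite /mk_frame; case: pselect. Qed.

Lemma frame_unit (h : frame) : set_val h \in unitmx.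
Proof. by have /set_mem := valP h. Qed.

Lemma mk_frameK (h : frame) : mk_frame (set_val h) = h.
Proof. by apply/val_inj; exact: (mk_frameE (frame_unit h)). Qed.

Definition fspan g : X := flag_of_frame (mk_frame g).

Lemma memv_fspan g i y : g \in unitmx ->
  (y \in flag_space (fspan g) i) <->
  exists2 c : row_vec, (forall k : 'I_M, (flag_dim e i <= k)%N -> c 0 k = 0) & y = c *m g.
Proof.
move=> gu; rewrite /flag_space /fspan /= ffunE (_ : _ (mk_frame g) = g); last exact: mk_frameE.
set s := [seq row k g | k : 'I_M].
have ss : size s = M by rewrite size_map -cardE card_ord.
have sE (k : 'I_M) : nth 0 s k = row k g.
  by rewrite (nth_map k) -?cardE ?card_ord// nth_ord_enum.
split=> [|[c c0 ->]]; last first.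
  rewrite mulmx_sum_row; apply: memv_suml => k _.
  case: (ltnP k (flag_dim e i)) => ki; last by rewrite c0// scale0r mem0v.
  apply: memvZ; apply: memv_span; rewrite -sE -(nth_take _ ki) mem_nth//.
  by rewrite size_take ss; case: ifP => // _; exact: ltn_ord.
have st : size (take (flag_dim e i) s) == minn (flag_dim e i) M.
  by rewrite size_take_min ss.
rewrite -[take _ s]/(tval (Tuple st)) => /coord_span yE.
pose co (k : 'I_M) : R := if insub (k : nat) is Some k' then coord (Tuple st) k' y else 0.
exists (\row_k co k).
  move=> k ik; rewrite mxE /co insubN//.
  by rewrite -leqNgt geq_min ik.
rewrite yE mulmx_sum_row.
have le : (minn (flag_dim e i) M <= M)%N by exact: geq_minr.
rewrite (bigID (fun k : 'I_M => (k < minn (flag_dim e i) M)%N)) /= [X in _ + X]big1; last first.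
  by move=> k; rewrite -leqNgt => kk; rewrite mxE /co insubN ?scale0r// -leqNgt.
rewrite addr0 (reindex_omap (widen_ord le) (fun k : 'I_M => insub (k : nat))) /=; last first.
  by move=> k kk; rewrite insubT /=; congr Some; exact/val_inj.
apply: eq_big => [k|k _].
  by rewrite ltn_ord valK eqxx.
rewrite mxE /co valK; congr (_ *: _).
rewrite /= nth_take; last by apply: leq_trans (ltn_ord k) (geq_minl _ _).
by rewrite -(sE (widen_ord le k)).
Qed.

Lemma fspan_eq g F : g \in unitmx ->
  (forall i (k : 'I_M), (k < flag_dim e i)%N -> row k g \in flag_space F i) -> fspan g = F.
Proof.
move=> gu gF; apply: flag_eq => i; apply/subvP => y /(memv_fspan _ _ gu)[c c0 ->].
rewrite mulmx_sum_row; apply: memv_suml => k _.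
case: (ltnP k (flag_dim e i)) => ki; last by rewrite c0// scale0r mem0v.
by apply: memvZ; exact: gF.
Qed.

(** Triangularity for an arbitrary weight [mu]: a nonzero vector of the left kernel is refuted at
    its nonzero coordinate of least weight. The weight is the position for echelon matrices and the
    letter for unipotent ones. *)
Lemma unit_by_order (A : mx) (mu : 'I_M -> nat) :
  (forall p q, A p q != 0 -> p = q \/ (mu p < mu q)%N) -> (forall p, A p p != 0) ->
  A \in unitmx.
Proof.
move=> Amu Ad; rewrite -row_free_unit; apply: inj_row_free => v vA.
apply/eqP; apply: contrapT => /negP v0; have [p0 vp0] : exists p, v 0 p != 0.
  apply: contrapT => nex; case/negP: v0; apply/eqP/rowP => p; rewrite mxE.
  by apply/eqP; apply: contrapT => /negP vp; apply: nex; exists p.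
have [p vp pmin] := arg_minnP mu (P := fun p => v 0 p != 0) vp0.
have := congr1 (fun y : row_vec => y 0 p) vA; rewrite !mxE (bigD1 p) //= big1 ?addr0.
  by move=> /eqP; rewrite mulf_eq0 (negbTE vp) (negbTE (Ad p)).
move=> q qp; have [->|Aqp] := eqVneq (A q p) 0; first by rewrite mulr0.
have [qp'|mupq] := Amu _ _ Aqp; first by rewrite qp' eqxx in qp.
have [->|vq] := eqVneq (v 0 q) 0; first by rewrite mul0r.
by have := pmin q vq; rewrite leqNgt mupq.
Qed.

End Frames.

Section Words.
Context {r : nat} (e : 'I_r -> nat).
Local Notation M := (ambient_dim e).

Definition has_content (w : {ffun 'I_M -> 'I_r}) :=
  [forall i, #|[pred p | w p == i]| == e i].

(** The letter at [p] is the step of a coordinate flag at which the [p]-th basis vector enters. *)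
Definition word := {w : {ffun 'I_M -> 'I_r} | has_content w}.

Definition letter (w : word) : 'I_M -> 'I_r := val w.

Lemma card_letter w i : #|[pred p | letter w p == i]| = e i.
Proof. by have /forallP/(_ i)/eqP := valP w. Qed.

Lemma letter_inj w v : letter w =1 letter v -> w = v.
Proof. by move=> wv; apply/val_inj/ffunP. Qed.

Lemma card_letter_le w (i : 'I_r) : #|[pred p | (letter w p <= i)%N]| = flag_dim e i.
Proof.
rewrite -sum1_card (partition_big (letter w) (fun j : 'I_r => (j <= i)%N)) //=.
rewrite /flag_dim; apply: eq_bigr => k ki.
rewrite -(card_letter w k) -sum1_card; apply: eq_bigl => p; rewrite !inE /=.
by case: eqP => [->|]; rewrite ?ki ?andbF.
Qed.

Lemma sorting_exists w : exists s : 'S_M,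
  forall k (i : 'I_r), (letter w (s k) <= i)%N = (k < flag_dim e i)%N.
Proof.
pose s := sort (fun p q => (letter w p <= letter w q)%N) (enum 'I_M).
have us : uniq s by rewrite sort_uniq enum_uniq.
have ss : size s = M by rewrite size_sort size_enum_ord.
have inj : injective (fun k : 'I_M => nth k s k).
  move=> k k'; rewrite (set_nth_default k') ?ss// => /eqP.
  by rewrite nth_uniq ?ss// => /eqP/val_inj.
exists (perm inj) => k i; rewrite permE.
pose D := [pred k : 'I_M | (letter w (nth k s k) <= i)%N].
have cD : #|D| = flag_dim e i.
  rewrite -(card_letter_le w i) -!sum1_card [RHS](reindex_inj (@perm_inj _ (perm inj))).
  by apply: eq_bigl => l; rewrite !inE /= permE.
have down (l m : 'I_M) : (l <= m)%N -> m \in D -> l \in D.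
  rewrite !inE => lm; apply: leq_trans; rewrite (set_nth_default m) ?ss//.
  apply: (sorted_leq_nth (leT := fun p q => (letter w p <= letter w q)%N)) => //.
  - by move=> p q t; exact: leq_trans.
  - by apply: sort_sorted => p q; exact: leq_total.
  - by rewrite inE ss.
  - by rewrite inE ss.
have card_lt m : (m <= M)%N -> #|[pred l : 'I_M | (l < m)%N]| = m.
  move=> mM; rewrite -sum1_card (eq_bigl (fun l : 'I_M => (l < m)%N))//.
  by rewrite -(big_ord_widen _ (fun=> 1%N)) // sum1_card card_ord.
have -> : (letter w (nth k s k) <= i)%N = (k \in D) by rewrite inE.
apply/idP/idP => kD.
  rewrite -cD -(card_lt k.+1)//; apply: subset_leq_card.
  by apply/fintype.subsetP => l; rewrite inE ltnS => lk; exact: down kD.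
apply: contraTT kD => kD; rewrite -leqNgt -cD -[leqRHS](card_lt k) ?(ltnW (ltn_ord k))//.
apply: subset_leq_card; apply/fintype.subsetP => l lD; rewrite inE ltnNge.
by apply: contra kD => kl; exact: down lD.
Qed.

Definition sorting w : 'S_M := sval (cid (sorting_exists w)).

Lemma sortingE w k (i : 'I_r) : (letter w (sorting w k) <= i)%N = (k < flag_dim e i)%N.
Proof. exact: (svalP (cid (sorting_exists w))). Qed.

End Words.

Section WordFlags.
Context {R : realType} {r : nat} {e : 'I_r -> nat}.
Local Notation M := (ambient_dim e).
Local Notation X := (flag R e).
Local Notation mx := 'M[R]_M.
Local Notation row_vec := 'rV[R]_M.
Local Notation K := (word e).
Implicit Types (F : X) (G H : mx) (i : 'I_r) (w v : K) (p q : 'I_M).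

(** Rows are indexed by positions and not by their order in the frame: step [i] is spanned by the
    rows whose letter is at most [i]. Thus every word uses the same matrix space with its fixed
    order of columns. *)
Definition flagw w G : X := fspan (row_perm (sorting w) G).

Lemma row_perm_unit (s : 'S_M) G : (row_perm s G \in unitmx) = (G \in unitmx).
Proof. by rewrite row_permE unitmx_mul unitmx_perm. Qed.

Definition letter_supported w i (c : row_vec) := forall p, (i < letter w p)%N -> c 0 p = 0.

Lemma memv_flagw w G i y : G \in unitmx ->
  (y \in flag_space (flagw w G) i) <-> exists2 c, letter_supported w i c & y = c *m G.
Proof.
move=> Gu; rewrite memv_fspan ?row_perm_unit//; split=> -[c c0 ->].
  exists (c *m perm_mx (sorting w)); last by rewrite row_permE mulmxA.
  move=> p ip; rewrite -[X in c *m perm_mx X]invgK -col_permE mxE c0//.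
  by rewrite leqNgt -(sortingE w) permKV -ltnNge.
exists (col_perm (sorting w) c).
  by move=> k ik; rewrite mxE c0// ltnNge sortingE -leqNgt.
by rewrite row_permE mulmxA col_permE -[_ *m perm_mx _ *m perm_mx _]mulmxA -perm_mxM mulVg perm_mx1 mulmx1.
Qed.

Lemma memv_row_flagw w G i p : G \in unitmx -> (letter w p <= i)%N ->
  row p G \in flag_space (flagw w G) i.
Proof.
move=> Gu pi; apply/memv_flagw => //; exists (delta_mx 0 p); last by rewrite rowE.
by move=> q; rewrite mxE eqxx /=; case: eqP => // ->; rewrite ltnNge pi.
Qed.

Lemma flagw_eq w G F : G \in unitmx ->
  (forall p, row p G \in flag_space F (letter w p)) -> flagw w G = F.
Proof.
move=> Gu GF; apply: fspan_eq => [|i k ki]; first by rewrite row_perm_unit.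
rewrite (_ : row k _ = row (sorting w k) G); last by apply/rowP => q; rewrite !mxE.
by apply: (subvP (space_mono _ _)) (GF _); rewrite sortingE.
Qed.

Lemma flagw_row_perm w (g : mx) : flagw w (row_perm (sorting w)^-1 g) = fspan g.
Proof. by rewrite /flagw -row_permM mulgV row_perm1. Qed.

Definition leading (y : row_vec) p := y 0 p != 0 /\ forall q, (q < p)%N -> y 0 q = 0.

Lemma leading_exists y : y != 0 -> exists p, leading y p.
Proof.
move=> y0; have [p0 yp0] : exists p, y 0 p != 0.
  apply: contrapT => nex; case/negP: y0; apply/eqP/rowP => p; rewrite mxE.
  by apply/eqP; apply: contrapT => /negP vp; apply: nex; exists p.
have [p yp pmin] := arg_minnP (fun p : 'I_M => p : nat) (P := fun p => y 0 p != 0) yp0.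
exists p; split=> // q qp; apply/eqP; apply: contraTT qp => yq.
by rewrite -leqNgt pmin.
Qed.

Lemma leading_uniq y p q : leading y p -> leading y q -> p = q.
Proof.
move=> [yp p0] [yq q0]; case: (ltngtP p q) => [pq|qp|/val_inj//].
  by rewrite (q0 _ pq) eqxx in yp.
by rewrite (p0 _ qp) eqxx in yq.
Qed.

Definition echelon G := forall p, leading (row p G) p.

Lemma echelon_unit G : echelon G -> G \in unitmx.
Proof.
move=> eG; apply: (unit_by_order (mu := fun p => p : nat)) => [p q Gpq|p].
  case: (ltngtP p q) => [|qp|/val_inj]; [by right| |by left].
  by case: (eG p) => _ /(_ q qp); rewrite mxE => E; rewrite E eqxx in Gpq.
by case: (eG p) => +; rewrite mxE.
Qed.

Lemma leading_mul G (c : row_vec) p : echelon G -> leading c p -> leading (c *m G) p.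
Proof.
move=> eG [cp c0].
have G0 p' q : (q < p')%N -> G p' q = 0 by case: (eG p') => _ /[apply]; rewrite mxE.
split=> [|q qp]; rewrite mxE.
  rewrite (bigD1 p)//= big1 ?addr0 ?mulf_neq0//; first by case: (eG p); rewrite mxE.
  move=> k kp; case: (ltngtP k p) => [kp'|pk|/val_inj E].
  - by rewrite c0 ?mul0r.
  - by rewrite G0 ?mulr0.
  - by rewrite E eqxx in kp.
rewrite big1// => k _; case: (ltnP k p) => [kp'|pk]; first by rewrite c0 ?mul0r.
by rewrite G0 ?mulr0// (leq_trans qp).
Qed.

Definition schubert w : set X := [set F | exists2 G, echelon G & F = flagw w G].

(** Multiplying by an echelon matrix keeps the leading position of the coefficients. Hence the word
    can be read off the flag: its letter at [p] is the first step containing a vector that leads at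
    [p]. *)
Lemma schubert_pivot w F i p : schubert w F ->
  (letter w p <= i)%N <-> exists2 y, y \in flag_space F i & leading y p.
Proof.
move=> [G eG ->]; have Gu := echelon_unit eG; split=> [pi|[y /memv_flagw-/(_ Gu)[c cs yE] yp]].
  by exists (row p G); [exact: memv_row_flagw|exact: eG].
have c0 : c != 0.
  by apply: contraPneq (yp.1) => c0; rewrite yE c0 mul0mx mxE eqxx.
have [q cq] := leading_exists c0; rewrite yE in yp.
rewrite -(leading_uniq (leading_mul eG cq) yp) leqNgt; apply/negP => /cs E.
by case: cq; rewrite E eqxx.
Qed.

Lemma schubert_disjoint w v F : schubert w F -> schubert v F -> w = v.
Proof.
move=> wF vF; apply: letter_inj => p; apply/val_inj/eqP; rewrite eqn_leq.
apply/andP; split.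
  by apply/(schubert_pivot _ p wF)/(schubert_pivot _ p vF).
by apply/(schubert_pivot _ p vF)/(schubert_pivot _ p wF).
Qed.

Lemma row_free_card G (A : {pred 'I_M}) (U : {vspace row_vec}) : G \in unitmx ->
  (forall y, (y \in U) <-> exists2 c : row_vec, (forall p, p \notin A -> c 0 p = 0) & y = c *m G) ->
  \dim U = #|A|.
Proof.
move=> Gu UE; pose s := [seq row p G | p <- enum A].
have sE : U = << s>>%VS.
  apply/eqP; rewrite eqEsubv; apply/andP; split; last first.
    apply/span_subvP => _ /mapP[p pA ->]; apply/UE; exists (delta_mx 0 p).
      move=> q qA; rewrite mxE eqxx /=; case: eqP => // E; move: qA; rewrite E.
      by rewrite -mem_enum pA.
    by rewrite rowE.
  apply/subvP => y /UE[c cA ->]; rewrite mulmx_sum_row; apply: memv_suml => p _.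
  case: (boolP (p \in A)) => pA; last by rewrite cA// scale0r mem0v.
  by apply/memvZ/memv_span/mapP; exists p; rewrite ?mem_enum.
have := frame_rows_free (mk_frame G); rewrite (_ : set_val (mk_frame G) = G); last exact: mk_frameE.
move=> fr; have fs : free s.
  have := filter_free (mem s) fr; congr (is_true _); apply: perm_free.
  have inj : injective (fun p => row p G).
    by apply/injectiveP; rewrite /injectiveb /dinjectiveb; exact: free_uniq fr.
  apply: uniq_perm; [exact/filter_uniq/free_uniq|by rewrite map_inj_uniq ?enum_uniq|].
  move=> y; rewrite mem_filter /=; case: (boolP (y \in s)) => //= /mapP[p _ ->].
  by apply/mapP; exists p; rewrite ?mem_enum.
by move: fs; rewrite /free sE => /eqP ->; rewrite size_map -cardE.
Qed.

End WordFlags.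

(** * Row reduction and affine charts *)

Section Charts.
Context {R : realType} {r : nat} {e : 'I_r -> nat}.
Local Notation M := (ambient_dim e).
Local Notation X := (flag R e).
Local Notation mx := 'M[R]_M.
Local Notation row_vec := 'rV[R]_M.
Local Notation K := (word e).
Implicit Types (F : X) (G H : mx) (i : 'I_r) (w v : K) (p q : 'I_M).

Lemma last_space F i : i.+1 = r -> flag_space F i = fullv.
Proof.
move=> ir; apply/eqP; rewrite eqEdim subvf /= dim_space dimvf.
have -> : flag_dim e i = M; last by rewrite dim_matrix mul1r.
by apply: eq_bigl => j; rewrite -ltnS ir ltn_ord.
Qed.

(** Row reduction without an algorithm: for each [p] choose a vector leading at [p] in the earliest
    possible step. These rows span every step, since a remainder would lead at some [p] before the
    earliest step for [p]. *)
Lemma schubert_cover F : (0 < r)%N -> exists w, schubert w F.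
Proof.
move=> hr; pose pivot i p := `[<exists2 y, y \in flag_space F i & leading y p>].
have last_r : (r.-1 < r)%N by rewrite prednK.
have has_pivot p : pivot (Ordinal last_r) p.
  apply/asboolP; exists (delta_mx 0 p); first by rewrite last_space ?memvf//= prednK.
  split=> [|q qp]; first by rewrite mxE !eqxx oner_eq0.
  by rewrite mxE eqxx /=; case: eqP qp => // ->; rewrite ltnn.
have first_pivot p : exists i, pivot i p /\ forall j : 'I_r, pivot j p -> (i <= j)%N.
  have [i ip imin] := arg_minnP (P := pivot^~ p) (fun i : 'I_r => i : nat) (has_pivot p).
  by exists i; split=> // j; exact: imin.
pose f p := sval (cid (first_pivot p)).
have fP p : pivot (f p) p by have [] := svalP (cid (first_pivot p)).
have f_min p j : pivot j p -> (f p <= j)%N by have [_] := svalP (cid (first_pivot p)); apply.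
have y_ p : {y | y \in flag_space F (f p) /\ leading y p}.
  by apply: cid; have /asboolP[y] := fP p; exists y.
pose G : mx := \matrix_p sval (y_ p).
have rowG p : row p G = sval (y_ p) by rewrite rowK.
have eG : echelon G by move=> p; rewrite rowG; case: (svalP (y_ p)).
have GF p : row p G \in flag_space F (f p) by rewrite rowG; case: (svalP (y_ p)).
have sum_mem i (c : row_vec) : (forall p, (i < f p)%N -> c 0 p = 0) ->
    c *m G \in flag_space F i.
  move=> c0; rewrite mulmx_sum_row; apply: memv_suml => p _.
  case: (leqP (f p) i) => ip; last by rewrite c0// scale0r mem0v.
  by apply: memvZ; apply: (subvP (space_mono _ ip)).
have FE i y : (y \in flag_space F i) <->
    exists2 c : row_vec, (forall p, (i < f p)%N -> c 0 p = 0) & y = c *m G.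
  split=> [yF|[c c0 ->]]; last exact: sum_mem.
  have [c yE] : exists c, y = c *m G.
    by exists (y *m invmx G); rewrite mulmxKV// echelon_unit.
  rewrite yE in yF *.
  pose c1 : row_vec := \row_p (if (f p <= i)%N then c 0 p else 0).
  have c1F : c1 *m G \in flag_space F i.
    by apply: sum_mem => p ip; rewrite mxE leqNgt ip.
  have [c0|/leading_exists[p cp]] := eqVneq (c - c1) 0.
    exists c1; last by congr (_ *m _); apply/eqP; rewrite -subr_eq0 c0.
    by move=> p ip; rewrite mxE leqNgt ip.
  have : pivot i p.
    apply/asboolP; exists ((c - c1) *m G); last exact: leading_mul.
    by rewrite mulmxBl memvB.
  by move=> /f_min fi; case: cp; rewrite !mxE fi subrr eqxx.
have cardf i : #|[pred p | (f p <= i)%N]| = flag_dim e i.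
  rewrite -(dim_space F) (row_free_card (echelon_unit eG) (A := [pred p | (f p <= i)%N]))// => y.
  by rewrite FE; split=> -[c c0 ->]; exists c => // p; have := c0 p; rewrite inE -ltnNge.
have cont : has_content (finfun f).
  apply/forallP => i; apply/eqP.
  have count_lt m : (m <= r)%N -> #|[pred p | (f p < m)%N]| = (\sum_(j < r | j < m) e j)%N.
    case: m => [|m mr]; first by rewrite big_pred0// eq_card0.
    exact: (cardf (Ordinal mr)).
  have := count_lt i.+1 (ltn_ord i); rewrite (bigD1 i) //=.
  rewrite (eq_bigl (fun j : 'I_r => (j < i)%N)); last first.
    by move=> j; rewrite ltnS ltn_neqAle andbC.
  rewrite -count_lt ?(ltnW (ltn_ord i))// -(cardID [pred p | f p == i]) => /eqP.
  rewrite (_ : #|[predD _ & _]| = #|[pred p | (f p < i)%N]|); last first.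
    by apply: eq_card => p; rewrite !inE /= ltnS ltn_neqAle.
  rewrite eqn_add2r => /eqP <-; apply: eq_card => p; rewrite !inE /= ffunE andbC.
  by case: eqP => //= ->; rewrite ltnSn.
exists (exist _ (finfun f) cont); exists G => //; apply/esym/flagw_eq; first exact: echelon_unit.
by move=> p; rewrite /letter /= ffunE.
Qed.

Lemma fspan_surj F : (0 < r)%N -> exists2 G, G \in unitmx & F = fspan G.
Proof.
move=> /(schubert_cover F)[w [G eG ->]]; exists (row_perm (sorting w) G) => //.
by rewrite row_perm_unit echelon_unit.
Qed.

(** The block on letters at most [i], padded by the identity to a fixed size; its determinant is the
    corresponding principal minor. *)
Definition minor_mx w i G : mx := \matrix_(p, q)
  if (letter w p <= i)%N && (letter w q <= i)%N then G p q else (p == q)%:R.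

Definition transverse w G := forall i, minor_mx w i G \in unitmx.

Lemma minor_mx_mul w i G C H :
  (forall p, (letter w p <= i)%N -> row p H = row p C *m G /\ letter_supported w i (row p C)) ->
  minor_mx w i H = minor_mx w i C *m minor_mx w i G.
Proof.
move=> HC; apply/matrixP => p q; rewrite !mxE.
case: (leqP (letter w p) i) => pi /=; last first.
  rewrite (bigD1 p)//= big1 ?addr0 => [|k kp].
    by rewrite !mxE leqNgt pi /= eqxx mul1r.
  by rewrite !mxE leqNgt pi /= eq_sym (negbTE kp) mul0r.
have [Hp supp] := HC p pi.
case: (leqP (letter w q) i) => qi; last first.
  rewrite big1 => [|k _]; first by case: eqP qi => // <-; rewrite ltnNge pi.
  rewrite !mxE pi (leqNgt _ i) /= [X in _ * (if X then _ else _)]andbC (leqNgt (letter w q)) qi /=.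
  case: (ltnP i (letter w k)) => ki /=; first by case: eqP ki => [<-|]; rewrite ?mul0r// ltnNge pi.
  by case: eqP ki => [->|]; rewrite ?mulr0// leqNgt qi.
have /rowP/(_ q) := Hp; rewrite !mxE => ->; apply: eq_bigr => k _; rewrite !mxE pi qi andbT.
case: (leqP (letter w k) i) => ki //.
by have := supp k ki; rewrite mxE => ->; rewrite mul0r; case: eqP ki => [<-|]; rewrite ?mul0r// ltnNge pi.
Qed.

Lemma transverse_flagw w G H : G \in unitmx -> H \in unitmx -> flagw w G = flagw w H ->
  transverse w H -> transverse w G.
Proof.
move=> Gu Hu GH tH i; have := tH i.
rewrite (@minor_mx_mul w i G (H *m invmx G) H); first by rewrite unitmx_mul => /andP[].
move=> p pi; have := memv_row_flagw Hu pi; rewrite -GH => /memv_flagw -/(_ Gu)[c cs pH].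
by rewrite row_mul pH mulmxK.
Qed.

Lemma transverse_inj w G i (y : row_vec) : G \in unitmx -> transverse w G ->
  y \in flag_space (flagw w G) i -> (forall q, (letter w q <= i)%N -> y 0 q = 0) -> y = 0.
Proof.
move=> Gu tG /memv_flagw -/(_ Gu)[c cs ->] y0.
suff -> : c = 0 by rewrite mul0mx.
suff : c *m minor_mx w i G = 0 by move/(congr1 (mulmx^~ (invmx (minor_mx w i G)))); rewrite mulmxK// mul0mx.
apply/rowP => q; rewrite !mxE.
case: (leqP (letter w q) i) => qi.
  have := y0 q qi; rewrite mxE => yq; rewrite -[RHS]yq; apply: eq_bigr => k _; rewrite !mxE qi andbT.
  by case: (leqP (letter w k) i) => // /cs ->; rewrite !mul0r.
rewrite big1// => k _; case: (leqP (letter w k) i) => ki; last by rewrite cs// mul0r.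
by rewrite !mxE ki (leqNgt (letter w q)) qi /=; case: eqP ki => [->|]; rewrite ?mulr0// leqNgt qi.
Qed.

(** The normal form of frames in the open cell of GL/P attached to [w]: identity blocks on equal
    letters, and free entries only where the column has a larger letter than the row. *)
Definition unipotent w H := forall p q, (letter w q <= letter w p)%N -> H p q = (p == q)%:R.

Lemma unipotent_unit w H : unipotent w H -> H \in unitmx.
Proof.
move=> uH; apply: (unit_by_order (mu := letter w)) => [p q|p]; last first.
  by rewrite uH// eqxx oner_eq0.
case: (leqP (letter w q) (letter w p)) => [/uH ->|]; last by right.
by case: (eqVneq p q) => [->|_]; [left|rewrite mulr0n eqxx].
Qed.

Lemma unipotent_transverse w H : unipotent w H -> transverse w H.
Proof.
move=> uH i; apply: (@unipotent_unit w) => p q qp; rewrite mxE uH//.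
by case: ifP.
Qed.

Lemma echelon_transverse w G : echelon G -> transverse w G.
Proof.
move=> eG i; apply: (unit_by_order (mu := fun p => p : nat)) => [p q|p]; rewrite mxE.
  case: ifP => _; last by case: (eqVneq p q) => [->|_]; [left|rewrite mulr0n eqxx].
  case: (ltngtP p q) => [|qp|/val_inj]; [by right| |by left].
  by case: (eG p) => _ /(_ q qp); rewrite mxE => ->; rewrite eqxx.
by case: ifP => _; [case: (eG p); rewrite mxE|rewrite eqxx oner_eq0].
Qed.

Lemma unipotent_inj w H H' : unipotent w H -> unipotent w H' ->
  flagw w H = flagw w H' -> H = H'.
Proof.
move=> uH uH' HH'; apply/row_matrixP => p; apply/eqP; rewrite -subr_eq0; apply/eqP.
apply: (@transverse_inj w H (letter w p)).
- exact: unipotent_unit uH.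
- exact: unipotent_transverse.
- apply: memvB; first exact: (memv_row_flagw (unipotent_unit uH)).
  by rewrite HH'; exact: (memv_row_flagw (unipotent_unit uH')).
- by move=> q qp; rewrite !mxE uH// uH'// subrr.
Qed.

(* By Cramer's rule the rows of [normalize w G] lie in the flag of [G] and
   form the unipotent representative of that flag. *)
Definition normalize w G : mx := \matrix_(p, q)
  ((\det (minor_mx w (letter w p) G))^-1 *
   \sum_(k | (letter w k <= letter w p)%N) (\adj (minor_mx w (letter w p) G)) p k * G k q).

Lemma normalize_unipotent w G : transverse w G -> unipotent w (normalize w G).
Proof.
move=> tG p q qp; rewrite mxE; set N := minor_mx w (letter w p) G.
have -> : \sum_(k | (letter w k <= letter w p)%N) (\adj N) p k * G k q = (\adj N *m N) p q.
  rewrite mxE big_mkcond /=; apply: eq_bigr => k _; rewrite !mxE qp andbT.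
  case: ifP => // kp; case: eqP => [E|]; last by rewrite mulr0.
  by rewrite E qp in kp.
rewrite mul_adj_mx mxE mulrnAr mulVf//.
by have := tG (letter w p); rewrite unitmxE unitfE.
Qed.

Lemma flagw_normalize w G : G \in unitmx -> transverse w G ->
  flagw w (normalize w G) = flagw w G.
Proof.
move=> Gu tG; apply: flagw_eq => [|p]; first exact: unipotent_unit (normalize_unipotent tG).
have -> : row p (normalize w G) = \sum_(k | (letter w k <= letter w p)%N)
    ((\det (minor_mx w (letter w p) G))^-1 * (\adj (minor_mx w (letter w p) G)) p k) *: row k G.
  apply/rowP => q; rewrite !mxE summxE mulr_sumr; apply: eq_bigr => k _.
  by rewrite !mxE mulrA.
by apply: memv_suml => k kp; apply: memvZ; exact: memv_row_flagw.
Qed.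

End Charts.

Section ContinuousMatrix.
Context {R : realType} {T : topologicalType}.

Lemma continuous_mx_at m n (f : T -> 'M[R]_(m, n)) x :
  (forall i j, {for x, continuous (fun y => f y i j)}) -> {for x, continuous f}.
Proof.
move=> fc A [P Px sPA]; rewrite nbhs_filterE /=.
have : \forall y \near x, forall ij : 'I_m * 'I_n, P ij.1 ij.2 (f y ij.1 ij.2).
  apply: (@filter_forall _ _
    (fun ij (y : T) => P ij.1 ij.2 (f y ij.1 ij.2)) _ (nbhs_filter x)) => -[i j].
  exact: (fc i j _ (Px i j)).
by apply: filterS => y Py; apply: sPA => i j; exact: (Py (i, j)).
Qed.

Lemma continuous_det n (A : T -> 'M[R]_n) :
  (forall i j, continuous (fun x => A x i j)) -> continuous (fun x => \det (A x)).
Proof.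
move=> Ac; apply: (@continuous_sum _ _ R^o) => s _.
apply: continuous_funM; first exact: cst_continuous.
by apply: continuous_prod => i _; exact: Ac.
Qed.

Lemma continuous_adj n (A : T -> 'M[R]_n) i j :
  (forall i j, continuous (fun x => A x i j)) -> continuous (fun x => (\adj (A x)) i j).
Proof.
move=> Ac; under eq_fun do rewrite mxE.
apply: continuous_funM; first exact: cst_continuous.
apply: continuous_det => k l; under eq_fun do rewrite !mxE; exact: Ac.
Qed.

Lemma continuous_mulmx m n k (A : T -> 'M[R]_(m, n)) (B : T -> 'M[R]_(n, k)) :
  (forall i j, continuous (fun x => A x i j)) -> (forall i j, continuous (fun x => B x i j)) ->
  forall i j, continuous (fun x => (A x *m B x) i j).
Proof.
move=> Ac Bc i j; under eq_fun do rewrite mxE.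
by apply: (@continuous_sum _ _ R^o) => l _; apply: continuous_funM; [exact: Ac|exact: Bc].
Qed.

End ContinuousMatrix.

Lemma continuous_entry (R : realType) m n (i : 'I_m) (j : 'I_n) :
  continuous (fun A : 'M[R]_(m, n) => A i j : R).
Proof. exact: coord_continuous. Qed.

Lemma unitmx_near (R : realType) n (A : 'M[R]_n) :
  A \in unitmx -> \forall B \near A, B \in unitmx.
Proof.
rewrite unitmxE unitfE => A0.
have dc : continuous (fun B : 'M[R]_n => \det B : R).
  by apply: continuous_det => i j; exact: continuous_entry.
have := dc A [set x | x != 0]; rewrite nbhs_filterE /= => /(_ _)/=.
have : nbhs (\det A) [set x : R | x != 0] by apply: open_nbhs_nbhs; split=> //; exact: open_neq.
move=> N /(_ N); apply: filterS => B /=.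
by rewrite unitmxE unitfE.
Qed.

(** * The quotient topology and the action of matrices on flags *)

Section FlagTopology.
Context {R : realType} {r : nat} {e : 'I_r -> nat}.
Local Notation M := (ambient_dim e).
Local Notation X := (flag R e).
Local Notation mx := 'M[R]_M.
Local Notation frame := (@frame R r e).
Implicit Types (F : X) (G H A : mx) (U : set X).

Lemma flag_openE U : open U = open (@flag_of_frame R r e @^-1` U).
Proof. by []. Qed.

Lemma open_flagP U : (forall G, G \in unitmx -> U (fspan G) ->
  \forall G' \near G, G' \in unitmx -> U (fspan G')) -> open U.
Proof.
move=> UG; rewrite flag_openE openE => g Ug.
have := UG _ (frame_unit g); rewrite /fspan mk_frameK => /(_ Ug) N.
have vc : continuous (set_val : frame -> mx) by exact: initial_continuous.
have := vc g _ N; rewrite !nbhs_filterE /interior /=; apply: filterS => h.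
by rewrite /= mk_frameK; apply; exact: frame_unit.
Qed.

Lemma fspan_near U G : open U -> G \in unitmx -> U (fspan G) ->
  \forall G' \near G, U (fspan G').
Proof.
rewrite flag_openE => -[W oW WE] Gu UG.
have WG : W G.
  have : (set_val @^-1` W) (mk_frame G) by rewrite WE.
  by rewrite /preimage /= (mk_frameE Gu).
have NW : nbhs G W by exact: open_nbhs_nbhs.
near=> G'.
have uG' : G' \in unitmx by near: G'; exact: unitmx_near.
have : (set_val @^-1` W) (mk_frame G').
  by rewrite /preimage /= (mk_frameE uG'); near: G'.
by rewrite WE.
Unshelve. all: by end_near. Qed.

Lemma fspan_continuous (T : topologicalType) (g : T -> mx) :
  continuous g -> (forall t, g t \in unitmx) -> continuous (fun t => fspan (g t) : X).
Proof.
move=> gc gu t A; rewrite nbhsE /= => -[U [oU Ut] UA].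
have := gc t _ (fspan_near oU (gu t) Ut).
by rewrite !nbhs_filterE /= /fmap /=; apply: filterS => t' /UA.
Qed.

Lemma fspan_mulr G G' A : G \in unitmx -> G' \in unitmx -> A \in unitmx ->
  fspan G = fspan G' :> X -> fspan (G *m A) = fspan (G' *m A) :> X.
Proof.
move=> Gu G'u Au GG'; apply: flag_eq => i; apply/subvP => y.
move=> /memv_fspan -/(_ _)/=; rewrite unitmx_mul Gu Au => /(_ isT)[c c0 ->].
have : c *m G \in flag_space (fspan G) i by apply/memv_fspan => //; exists c.
rewrite GG' => /memv_fspan -/(_ G'u)[c' c'0 cG]; apply/memv_fspan.
  by rewrite unitmx_mul G'u.
by exists c' => //; rewrite !mulmxA cG.
Qed.

(** Two frames of the same flag differ by left multiplication by a stabilizing matrix, which carries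
    a neighbourhood of one frame to a neighbourhood of the other without changing flags. *)
Lemma fspan_image_open (B : set mx) : open B ->
  open [set F : X | exists G, [/\ G \in unitmx, B G & F = fspan G]].
Proof.
move=> oB; apply: open_flagP => G Gu [G0 [G0u BG0 GG0]].
pose h := G *m invmx G0.
have hu : h \in unitmx by rewrite unitmx_mul Gu unitmx_inv.
have hc : continuous (fun G' : mx => invmx h *m G').
  apply: continuous_mx; apply: continuous_mulmx => i j; first exact: cst_continuous.
  exact: continuous_entry.
have hG : invmx h *m G = G0 by rewrite -[G in LHS](mulmxKV G0u) mulKmx.
have N : \forall G' \near G, B (invmx h *m G').
  by apply: hc; rewrite hG; exact: open_nbhs_nbhs.
near=> G' => G'u; exists (invmx h *m G'); split.
- by rewrite unitmx_mul unitmx_inv hu.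
- by near: G'.
- have := @fspan_mulr G G0 (invmx G *m G') Gu G0u _ GG0.
  rewrite unitmx_mul unitmx_inv Gu G'u => /(_ isT).
  rewrite mulKVmx// => ->; congr fspan; rewrite mulmxA; congr (_ *m _).
  by rewrite -hG mulmxK.
Unshelve. all: by end_near. Qed.

Variable hr : (0 < r)%N.

Definition frame_mx F : mx := s2val (cid2 (fspan_surj F hr)).

Lemma frame_mx_unit F : frame_mx F \in unitmx.
Proof. exact: (s2valP (cid2 (fspan_surj F hr))). Qed.

Lemma frame_mxK F : fspan (frame_mx F) = F.
Proof. exact/esym/(s2valP' (cid2 (fspan_surj F hr))). Qed.

Definition translate A F : X := fspan (frame_mx F *m A).

Lemma translate_fspan A G : A \in unitmx -> G \in unitmx -> translate A (fspan G) = fspan (G *m A).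
Proof. by move=> Au Gu; apply: fspan_mulr => //; rewrite ?frame_mxK// frame_mx_unit. Qed.

(** The product of a quotient map with an identity need not be a quotient map, so joint continuity
    in the flag and the parameter is obtained from the openness of [fspan]. *)
Lemma translate_continuous (T : topologicalType) (A : T -> mx) : continuous A ->
  (forall t, A t \in unitmx) -> continuous (fun p : X * T => translate (A p.2) p.1).
Proof.
move=> Ac Au [F t] B; rewrite nbhsE /= => -[U [oU Ut] UB].
rewrite -(frame_mxK F) translate_fspan ?frame_mx_unit// in Ut.
have Gu := frame_mx_unit F; set G := frame_mx F in Ut Gu.
have mc : continuous (fun p : mx * T => p.1 *m A p.2).
  apply: continuous_mx; apply: continuous_mulmx => i j.
    apply: (@continuous_o _ _ _ fst (fun G : mx => G i j)); first exact: continuous_fst.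
    exact: continuous_entry.
  apply: (@continuous_o _ _ _ snd (fun t => A t i j)); first exact: continuous_snd.
  by apply: (@continuous_o _ _ _ A (fun G : mx => G i j)) => //; exact: continuous_entry.
have GAu : G *m A t \in unitmx by rewrite unitmx_mul Gu Au.
have [[B1 B2] /= [NB1 NB2] sB] := mc (G, t) _ (fspan_near oU GAu Ut).
move: NB1; rewrite nbhsE => -[W [oW WG] WB1].
exists ([set F : X | exists G, [/\ G \in unitmx, W G & F = fspan G]], B2) => /=.
  split=> //; apply: open_nbhs_nbhs; split; first exact: fspan_image_open.
  by exists G; split=> //; rewrite frame_mxK.
move=> [F' t'] /= [[G' [G'u WG' ->]] Bt']; apply: UB; rewrite translate_fspan//.
by apply: (sB (G', t')); split=> //=; exact: WB1.
Qed.

Lemma flagw_translate w A G : A \in unitmx -> G \in unitmx ->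
  translate A (flagw w G) = flagw w (G *m A).
Proof.
by move=> Au Gu; rewrite translate_fspan ?row_perm_unit// /flagw !row_permE mulmxA.
Qed.

End FlagTopology.

Section Coordinates.
Context {R : realType} {r : nat} {e : 'I_r -> nat}.
Local Notation M := (ambient_dim e).
Local Notation X := (flag R e).
Local Notation mx := 'M[R]_M.
Local Notation K := (word e).
Implicit Types (F : X) (G H : mx) (i : 'I_r) (w v : K) (p q : 'I_M).

Definition ascending w : {pred 'I_M * 'I_M} :=
  [pred pq | (letter w pq.1 < letter w pq.2)%N].

Local Notation D w := #|ascending w|.

Definition position w (k : 'I_(D w)) : 'I_M * 'I_M := enum_val k.

Lemma positionP w (k : 'I_(D w)) : (letter w (position k).1 < letter w (position k).2)%N.
Proof. exact: (enum_valP k). Qed.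

Lemma position_inj w : injective (@position w).
Proof. exact: enum_val_inj. Qed.

Lemma position_surj w p q : (letter w p < letter w q)%N -> exists k, @position w k = (p, q).
Proof.
move=> pq; have pqA : (p, q) \in ascending w by [].
by exists (enum_rank_in pqA (p, q)); rewrite /position enum_rankK_in.
Qed.

Definition coord_mx w (x : 'rV[R]_(D w)) : mx :=
  \matrix_(p, q) ((p == q)%:R + \sum_k x 0 k * (position k == (p, q))%:R).

Definition mx_coord w H : 'rV[R]_(D w) := \row_k H (position k).1 (position k).2.

Lemma coord_mx_unipotent w x : unipotent w (@coord_mx w x).
Proof.
move=> p q qp; rewrite mxE big1 ?addr0// => k _; case: eqP => [kE|]; last by rewrite mulr0.
by have := positionP k; rewrite kE /= ltnNge qp.
Qed.

Lemma coord_mxK w x : mx_coord w (coord_mx x) = x.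
Proof.
apply/rowP => k; rewrite !mxE -surjective_pairing (bigD1 k)//= eqxx mulr1 big1 ?addr0.
  have := positionP k; case: eqP => [->|]; first by rewrite ltnn.
  by rewrite add0r.
by move=> l lk; rewrite (inj_eq (@position_inj w)) (negbTE lk) mulr0.
Qed.

Lemma mx_coordK w H : unipotent w H -> coord_mx (mx_coord w H) = H.
Proof.
move=> uH; apply/matrixP => p q; case: (leqP (letter w q) (letter w p)) => pq.
  by rewrite uH// coord_mx_unipotent.
have [k kE] := position_surj pq.
have := congr1 (fun x : 'rV[R]__ => x 0 k) (coord_mxK (mx_coord w H)).
by rewrite !mxE kE.
Qed.

Lemma coord_mx_unit w x : @coord_mx w x \in unitmx.
Proof. exact: unipotent_unit (coord_mx_unipotent x). Qed.

Definition chart_fun w (x : 'rV[R]_(D w)) : X := flagw w (coord_mx x).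

Lemma coord_mx_continuous w p q : continuous (fun x => @coord_mx w x p q : R).
Proof.
under eq_fun do rewrite mxE; apply: continuous_funD; first exact: cst_continuous.
apply: (@continuous_sum _ _ R^o) => k _; apply: continuous_funM; last exact: cst_continuous.
exact: continuous_entry.
Qed.

Lemma chart_fun_continuous w : continuous (@chart_fun w).
Proof.
apply: fspan_continuous => [|x]; last by rewrite row_perm_unit coord_mx_unit.
apply: continuous_mx => p q; under eq_fun do rewrite mxE; exact: coord_mx_continuous.
Qed.

Lemma chart_fun_inj w : injective (@chart_fun w).
Proof.
move=> x y /(unipotent_inj (coord_mx_unipotent x) (coord_mx_unipotent y)) xy.
by rewrite -(coord_mxK x) xy coord_mxK.
Qed.

Lemma chart_fun_transverse w x G : G \in unitmx -> flagw w G = @chart_fun w x ->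
  transverse w G.
Proof.
move=> Gu GE; apply: transverse_flagw GE _ => //; first exact: coord_mx_unit.
exact/unipotent_transverse/coord_mx_unipotent.
Qed.

Lemma transverse_chart_fun w G : G \in unitmx -> transverse w G ->
  chart_fun (mx_coord w (normalize w G)) = flagw w G.
Proof.
by move=> Gu tG; rewrite /chart_fun mx_coordK ?flagw_normalize//; exact: normalize_unipotent.
Qed.

Lemma minor_mx_continuous w i p q : continuous (fun G => minor_mx w i G p q : R).
Proof.
under eq_fun do rewrite mxE.
by case: (_ && _); [exact: continuous_entry|exact: cst_continuous].
Qed.

Lemma normalize_continuous w G : transverse w G ->
  {for G, continuous (fun G => mx_coord w (normalize w G))}.
Proof.
move=> tG; apply: continuous_mx_at => i k.
have -> : (fun G => mx_coord w (normalize w G) i k) =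
    (fun G => (\det (minor_mx w (letter w (position k).1) G))^-1) \*
    (fun G => \sum_(l | (letter w l <= letter w (position k).1)%N)
       (\adj (minor_mx w (letter w (position k).1) G)) (position k).1 l * G l (position k).2).
  by apply/funext => G'; rewrite !mxE.
apply: continuousM.
  apply: continuousV; first by have := tG (letter w (position k).1); rewrite unitmxE unitfE.
  by apply: continuous_det => p q; exact: minor_mx_continuous.
move: G {tG}; apply: (@continuous_sum _ _ R^o) => l _; apply: continuous_funM.
  by apply: continuous_adj => p q; exact: minor_mx_continuous.
exact: continuous_entry.
Qed.

Lemma transverse_near w G : transverse w G -> \forall G' \near G, transverse w G'.
Proof.
move=> tG.
apply: (@filter_forall _ _ (fun i G' => minor_mx w i G' \in unitmx) _ (nbhs_filter G)) => i.
have mc : continuous (fun G => minor_mx w i G).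
  by apply: continuous_mx => p q; exact: minor_mx_continuous.
exact: (mc G _ (unitmx_near (tG i))).
Qed.

Lemma chart_fun_open w (B : set 'rV[R]_(D w)) : open B -> open (@chart_fun w @` B).
Proof.
move=> oB; apply: open_flagP => G Gu [x Bx xG].
have pc : continuous (fun G : mx => row_perm (sorting w)^-1 G).
  by apply: continuous_mx => p q; under eq_fun do rewrite mxE; exact: continuous_entry.
have tG : transverse w (row_perm (sorting w)^-1 G).
  apply: (@chart_fun_transverse w x); first by rewrite row_perm_unit.
  by rewrite flagw_row_perm.
have NB : \forall G' \near row_perm (sorting w)^-1 G, B (mx_coord w (normalize w G')).
  apply: (normalize_continuous tG); apply: open_nbhs_nbhs; split=> //.
  rewrite (_ : mx_coord _ _ = x)//; apply: chart_fun_inj.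
  by rewrite transverse_chart_fun ?row_perm_unit// flagw_row_perm.
have NB' := pc G _ NB; have Nt := pc G _ (transverse_near tG).
near=> G' => G'u; exists (mx_coord w (normalize w (row_perm (sorting w)^-1 G'))).
  by near: G'.
rewrite transverse_chart_fun ?row_perm_unit ?flagw_row_perm//.
by near: G'.
Unshelve. all: by end_near. Qed.

Lemma schubert_chart_fun w F : schubert w F -> range (@chart_fun w) F.
Proof.
move=> [G eG ->]; exists (mx_coord w (normalize w G)) => //.
by apply: transverse_chart_fun; [exact: echelon_unit|exact: echelon_transverse].
Qed.

(** The free entries below the diagonal. An echelon matrix is zero there, so these are the
    coordinates normal to the cell. *)
Definition descents w : seq 'I_(D w) :=
  [seq k <- enum 'I_(D w) | ((position k).2 < (position k).1)%N].

Definition inversions w := #|[pred pq : 'I_M * 'I_M |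
  (pq.2 < pq.1)%N && (letter w pq.1 < letter w pq.2)%N]|.

Lemma size_descents w : size (descents w) = inversions w.
Proof.
rewrite size_filter -sum1_count big_enum_cond /= /inversions -[RHS]sum1_card.
rewrite [RHS](eq_bigl (fun pq => (pq \in ascending w) && (pq.2 < pq.1)%N)); last first.
  by move=> pq; rewrite !inE /= andbC.
by rewrite (big_enum_val_cond (A := ascending w) (fun pq => (pq.2 < pq.1)%N)).
Qed.

(** Row [p] of the unipotent frame is a combination of echelon rows with letters at most that of
    [p]. It leads in a column of such a letter, where its entries are those of the identity, so it
    leads at [p] and its entries to the left vanish. *)
Lemma schubert_chart_cell w x : schubert w (@chart_fun w x) <-> ~ punctured (descents w) x.
Proof.
split=> [[G eG wG] [k]|xd].
  rewrite mem_filter => /andP[kd _]; apply/negP; rewrite negbK.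
  have Gu := echelon_unit eG; set p := (position k).1; set q := (position k).2.
  have := memv_row_flagw (coord_mx_unit x) (leqnn (letter w p)).
  rewrite -/(chart_fun x) wG => /memv_flagw -/(_ Gu)[c cs pE].
  have c0 : c != 0.
    apply: contraPneq (unipotent_unit (coord_mx_unipotent x)) => c0.
    have /rowP/(_ p) := pE; rewrite c0 mul0mx [LHS]mxE [RHS]mxE coord_mx_unipotent// eqxx.
    by move=> /eqP; rewrite oner_eq0.
  have [q0 cq0] := leading_exists c0.
  have lead := leading_mul eG cq0; rewrite -pE in lead.
  have q0p : q0 = p.
    case: lead => + _; rewrite mxE coord_mx_unipotent; first by case: (eqVneq p q0) => [->|]//; rewrite mulr0n eqxx.
    by rewrite leqNgt; apply/negP => /cs E; case: cq0; rewrite E eqxx.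
  case: lead => _; rewrite q0p => /(_ q kd); rewrite mxE.
  have := congr1 (fun x : 'rV[R]__ => x 0 k) (coord_mxK x); rewrite mxE => <- ->.
  exact: eqxx.
exists (coord_mx x) => // p; split=> [|q qp].
  by rewrite mxE coord_mx_unipotent// eqxx oner_eq0.
rewrite mxE; case: (leqP (letter w q) (letter w p)) => pq.
  by rewrite coord_mx_unipotent//; case: eqP qp => // ->; rewrite ltnn.
have [k kE] := position_surj pq.
have := congr1 (fun x : 'rV[R]__ => x 0 k) (coord_mxK x); rewrite mxE kE /= => ->.
apply/eqP; apply: contrapT => /negP xk; apply: xd; exists k => //.
by rewrite mem_filter kE qp mem_enum.
Qed.

Lemma chart_fun_lift w n (s : singular_simplex R X n) :
  (forall x, range (@chart_fun w) (s x)) ->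
  exists s' : singular_simplex R 'rV[R]_(D w) n, forall x, chart_fun (s' x) = s x.
Proof.
move=> sr; pose g x := s2val (cid2 (sr x)).
have gE x : chart_fun (g x) = s x by exact: (s2valP' (cid2 (sr x))).
have gc : continuous g.
  apply/continuousP => B oB.
  suff -> : g @^-1` B = s @^-1` (@chart_fun w @` B).
    by have /continuousP := @cts_fun _ _ s; apply; exact: chart_fun_open.
  apply/seteqP; split=> x /= => [Bx|[y By yx]]; first by exists (g x).
  by rewrite (_ : g x = y)//; apply: chart_fun_inj; rewrite gE.
by exists (mkcts gc) => x; exact: gE.
Qed.

End Coordinates.

(** * Inversions and the order of the cells *)

Fixpoint ninv (l : seq nat) : nat :=
  if l is a :: l' then (count (fun b => b < a) l' + ninv l')%N else 0%N.

Lemma ninv_cat_cons l1 c l2 :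
  ninv (l1 ++ c :: l2) =
  (ninv (l1 ++ l2) + count (fun b => c < b) l1 + count (fun b => b < c) l2)%N.
Proof.
elim: l1 => [|a l1 IH] /=; first by rewrite addn0 addnC.
by rewrite IH !count_cat /=; lia.
Qed.

Lemma ninv_swap b c l1 l2 : (c < b)%N ->
  (ninv (c :: l1 ++ b :: l2) < ninv (b :: l1 ++ c :: l2))%N.
Proof.
move=> cb; have bc : (b < c)%N = false by rewrite ltnNge (ltnW cb).
rewrite /= !ninv_cat_cons !count_cat /= cb bc.
have le1 : (count (fun x => x < c)%N l1 <= count (fun x => x < b)%N l1)%N.
  by apply: sub_count => x xc; exact: ltn_trans cb.
have le2 : (count (fun x => b < x)%N l1 <= count (fun x => c < x)%N l1)%N.
  by apply: sub_count => x; exact: ltn_trans.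
lia.
Qed.

Lemma split_first (T : Type) (P : pred T) s : has P s ->
  exists s1 c s2, [/\ s = s1 ++ c :: s2, P c & all (predC P) s1].
Proof.
elim: s => //= a s IH; case Pa: (P a) => /=; first by exists [::], a, s.
by case/IH => s1 [c [s2 [-> Pc Ps1]]]; exists (a :: s1), c, s2; rewrite /= Pa.
Qed.

(** The Bruhat order on words with the same letters, expressed by counting small letters in
    prefixes. *)
Definition dominates (w v : seq nat) := forall m i,
  (count (fun z => z < i) (take m v) <= count (fun z => z < i) (take m w))%N.

(* If the first letters are a < b, exchanging b with the next letter c of v in
   [a, b) removes an inversion and preserves domination. *)
Lemma dominates_ninv w v : perm_eq w v -> dominates w v -> w = v \/ (ninv w < ninv v)%N.
Proof.
elim: w v => [|a w IHw] v; first by rewrite perm_sym => /perm_nilP ->; left.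
case: v => [/perm_nilP//|b v].
elim/ltn_ind: b v => b IHb v wv dom.
have ab : (a <= b)%N.
  by rewrite leqNgt; apply/negP => ba; have := dom 1%N a; rewrite /= !take0 /= ba ltnn.
have [ab'|] := eqVneq a b.
  subst b; have wv' : perm_eq w v by rewrite -(perm_cons a).
  case: (IHw v wv') => [m i||lt_wv]; [|by move=> ->; left|].
    by have := dom m.+1 i; rewrite /= leq_add2l.
  by right; rewrite /= (seq.permP wv') ltn_add2l.
rewrite eqn_leq ab /= -ltnNge => {}ab; right.
have /split_first[v1 [c [v2 [vE /andP[ac cb] /allP v1P]]]] : has (fun z => a <= z < b)%N v.
  apply/hasP; exists a; last by rewrite leqnn.
  have : a \in b :: v by rewrite -(perm_mem wv) mem_head.
  by rewrite inE (ltn_eqF ab).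
have sw : perm_eq (b :: v) (c :: v1 ++ b :: v2).
  by apply/seq.permP => P; rewrite vE /= !count_cat /=; lia.
have dom' : dominates (a :: w) (c :: v1 ++ b :: v2).
  move=> [|k] i //=; case: (leqP k (size v1)) => kv; last first.
    apply: leq_trans (dom k.+1 i); rewrite vE /= !take_cat !ltnNge (ltnW kv) /=.
    by case: (k - size v1)%N (subn_gt0 (size v1) k) => [|j _]; rewrite ?kv// !count_cat /=; lia.
  have tk x : take k (v1 ++ x) = take k v1 by rewrite takel_cat.
  rewrite tk; case: (ltnP c i) => ci; last first.
    have := dom k.+1 i; rewrite vE /= tk; apply: leq_trans.
    by rewrite leq_add2r.
  case: (ltnP b i) => bi.
    by have := dom k.+1 i; rewrite vE /= tk bi.
  rewrite (leq_ltn_trans ac ci) leq_add2l.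
  have := dom k.+1 a; rewrite vE /= tk ltnn ltnNge (ltnW ab) !add0n => H.
  apply: leq_trans (_ : (count (fun z => z < a) (take k w) <= _)%N); last first.
    by apply: sub_count => x xa; apply: ltn_trans xa (leq_ltn_trans ac ci).
  apply: leq_trans H; rewrite leq_eqVlt; apply/orP; left; apply/eqP.
  apply: eq_in_count => x /mem_take/v1P /=; rewrite negb_and -ltnNge -leqNgt.
  case: (ltnP x a) => [xa _|ax /= bx]; first by rewrite (ltn_trans xa (leq_ltn_trans ac ci)).
  by rewrite ltnNge (leq_trans bi bx).
rewrite vE -[ltnLHS]/(ninv (a :: w)) -[ltnRHS]/(ninv (b :: v1 ++ c :: v2)).
case: (IHb c cb _ (perm_trans wv sw) dom') => [->|lt]; first exact: ninv_swap.
by apply: ltn_trans lt _; exact: ninv_swap.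
Qed.

Lemma card_inversions n (f : 'I_n -> nat) :
  #|[pred pq : 'I_n * 'I_n | (pq.2 < pq.1)%N && (f pq.1 < f pq.2)%N]| =
  ninv [seq f p | p <- enum 'I_n].
Proof.
have -> : #|[pred pq : 'I_n * 'I_n | (pq.2 < pq.1)%N && (f pq.1 < f pq.2)%N]| =
    (\sum_(q < n) \sum_(p < n) ((q < p) && (f p < f q)))%N.
  rewrite -sum1_card big_mkcond /= exchange_big pair_big /=.
  by apply: eq_bigr => -[p q] _ /=; rewrite inE /=; case: (_ && _).
elim: n f => [|n IH] f; first by rewrite big_ord0 (size0nil (size_enum_ord 0)).
rewrite enum_ordSl /= -map_comp -IH big_ord_recl big_ord_recl /= add0n.
congr (_ + _)%N; last by apply: eq_bigr => q _; rewrite big_ord_recl.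
rewrite count_map -sum1_count big_enum_cond /= [RHS]big_mkcond.
by apply: eq_bigr => i _; case: (_ < _)%N.
Qed.

Section FlagCells.
Context {R : realType} {r : nat} {e : 'I_r -> nat}.
Local Notation M := (ambient_dim e).
Local Notation X := (flag R e).
Local Notation mx := 'M[R]_M.
Local Notation K := (word e).
Implicit Types (F : X) (G H : mx) (i : 'I_r) (w v : K) (p q : 'I_M).

Definition spell w : seq nat := [seq (letter w p : nat) | p <- enum 'I_M].

Lemma size_spell w : size (spell w) = M.
Proof. by rewrite size_map size_enum_ord. Qed.

Lemma nth_spell w p : nth 0%N (spell w) p = letter w p.
Proof. by rewrite (nth_map p) ?nth_ord_enum// size_enum_ord. Qed.

Lemma spell_inj : injective spell.
Proof.
by move=> w v wv; apply: letter_inj => p; apply/val_inj; rewrite /= -!nth_spell wv.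
Qed.

Lemma inversionsE w : inversions w = ninv (spell w).
Proof. exact: (card_inversions (fun p => letter w p : nat)). Qed.

Lemma count_spell w (P : pred nat) : count P (spell w) = #|[pred p | P (letter w p)]|.
Proof.
rewrite count_map -sum1_count big_enum_cond /= -sum1_card.
by apply: eq_bigl => p; rewrite !inE.
Qed.

Lemma perm_spell w v : perm_eq (spell w) (spell v).
Proof.
apply/seq.allP => a _ /=; rewrite !count_spell.
case: (ltnP a r) => ar; last first.
  have none (u : K) : #|[pred p | pred1 a (letter u p : nat)]| = 0%N.
    by apply: eq_card0 => p; rewrite !inE; apply/negbTE; apply: contraTN ar => /eqP <-; rewrite -ltnNge ltn_ord.
  by rewrite !none.
by rewrite !(card_letter _ (Ordinal ar)).
Qed.

(** Consider vectors of step [i] that are zero before column [m]. The echelon rows give as many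
    independent ones as the left side counts, and transversality for [v] embeds their span in the
    columns counted on the right. *)
Lemma schubert_rank v w F i (m : nat) : schubert w F -> range (@chart_fun R r e v) F ->
  (#|[pred q : 'I_M | (m <= q)%N && (letter w q <= i)%N]| <=
   #|[pred q : 'I_M | (m <= q)%N && (letter v q <= i)%N]|)%N.
Proof.
move=> [G eG FE] [x _ xF]; set A := [pred q : 'I_M | _ && (letter w q <= i)%N]; set B := [pred q : 'I_M | _ && _].
have Gu := echelon_unit eG; have Hu := coord_mx_unit x.
rewrite -(rank_indicator_mx R A) -(rank_indicator_mx R B).
rewrite -(mxrank_mul_ker (indicator_mx R A) (G *m indicator_mx R B)).
have -> : \rank (indicator_mx R A :&: kermx (G *m indicator_mx R B))%MS = 0%N.
  apply/eqP; rewrite mxrank_eq0; apply/eqP/row_matrixP => k; rewrite row0.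
  set c := row k _; have : (c <= indicator_mx R A :&: kermx (G *m indicator_mx R B))%MS by exact: row_sub.
  rewrite sub_capmx => /andP[/submxP[c' cA] /sub_kermxP cK].
  have c0 q : q \notin A -> c 0 q = 0.
    by move=> qA; rewrite cA mul_indicator_mxE (negbTE (qA : ~~ A q)) mulr0.
  suff cG : c *m G = 0 by rewrite -(mulmxK Gu c) cG mul0mx.
  apply: (transverse_inj (w := v) (i := i) Hu) => [||q qi].
  - exact/unipotent_transverse/coord_mx_unipotent.
  - rewrite -/(chart_fun x) xF FE; apply/memv_flagw => //; exists c => // q iq.
    by rewrite c0// inE negb_and -!ltnNge iq orbT.
  - case: (leqP m q) => mq.
      have := congr1 (fun y : 'rV[R]__ => y 0 q) cK.
      by rewrite mulmxA mul_indicator_mxE inE mq qi /= mulr1 => ->; rewrite mxE.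
    rewrite mxE big1// => l _; case: (leqP m l) => ml.
      case: (eG l) => _ /(_ q (leq_trans mq ml)); rewrite mxE => ->; exact: mulr0.
    by rewrite c0 ?mul0r// inE negb_and -!ltnNge ml.
rewrite addn0 mulmxA; exact: mxrankM_maxr.
Qed.

Lemma count_drop_spell w (m : nat) (P : pred nat) :
  count P (drop m (spell w)) = #|[pred q : 'I_M | (m <= q)%N && P (letter w q)]|.
Proof.
rewrite -map_drop count_map -sum1_count -sum1_card.
have -> : drop m (enum 'I_M) = [seq q : 'I_M <- enum 'I_M | (m <= q)%N].
  apply: (inj_map (@ord_inj M)); rewrite map_drop val_enum_ord.
  rewrite -(@filter_map _ _ (@nat_of_ord M) (fun q : nat => m <= q)%N) val_enum_ord drop_iota add0n.
  case: (leqP m M) => mM.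
    rewrite -[in RHS](subnKC mM) iotaD filter_cat add0n (@eq_in_filter _ _ pred0 (iota 0 m)).
      by rewrite filter_pred0; apply/esym/all_filterP/seq.allP => x; rewrite mem_iota => /andP[].
    by move=> x; rewrite mem_iota add0n => /andP[_ xm]; rewrite leqNgt xm.
  rewrite (eqP (ltnW mM : (M - m == 0)%N)) (@eq_in_filter _ _ pred0) ?filter_pred0// => x.
  by rewrite mem_iota add0n => /andP[_ xM]; rewrite leqNgt (ltn_trans xM mM).
by rewrite big_filter_cond big_enum_cond.
Qed.

Lemma schubert_order v w F : range (@chart_fun R r e v) F -> schubert w F ->
  w = v \/ (inversions w < inversions v)%N.
Proof.
move=> vF wF; rewrite !inversionsE.
have dom : dominates (spell w) (spell v).
  move=> m [|i]; first by rewrite (eq_count (a2 := pred0)) ?count_pred0.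
  (* Both words have the same total counts, so the inequality for prefixes is reversed into one for
     suffixes, to match the columns from [m] on in the rank bound. *)
  rewrite -(leq_add2r (count (fun z => z < i.+1)%N (drop m (spell v)))) -count_cat cat_take_drop.
  rewrite -(seq.permP (perm_spell w v)) -{1}(cat_take_drop m (spell w)) count_cat leq_add2l.
  case: (ltnP i r) => ir.
    by rewrite !count_drop_spell; exact: (schubert_rank (Ordinal ir) m wF vF).
  have all_lt u : count (fun z => z < i.+1)%N (drop m (spell u)) = (M - m)%N.
    rewrite -(size_spell u) -size_drop; apply/eqP; rewrite -all_count.
    apply/seq.allP => z /mem_drop/mapP[p _ ->] /=.
    by rewrite ltnS (leq_trans _ ir)// ltnW.
  by rewrite !all_lt.
by case: (dominates_ninv (perm_spell w v) dom) => [/spell_inj|]; [left|right].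
Qed.

End FlagCells.

Lemma continuous_idfun (T : topologicalType) : continuous (@id T).
Proof. by move=> x; exact: cvg_id. Qed.

(** * Sign changes acting on flags *)

Section FlagSymmetries.
Context {R : realType} {r : nat} {e : 'I_r -> nat}.
Variable hr : (0 < r)%N.
Local Notation M := (ambient_dim e).
Local Notation X := (flag R e).
Local Notation mx := 'M[R]_M.
Local Notation K := (word e).
Implicit Types (F : X) (G H : mx) (i : 'I_r) (w v : K) (p q : 'I_M) (eps : 'I_M -> bool).

Definition flag_cells : cellular R X K :=
  @Cellular R X K (@inversions r e) (@schubert R r e) (fun w => #|ascending w|)
    (fun w => mkcts (@chart_fun_continuous R r e w)) (@descents r e)
    (fun F => schubert_cover F hr) (@schubert_disjoint R r e) (@schubert_chart_fun R r e)
    (fun w => chart_fun_open openT) (@chart_fun_lift R r e) (@chart_fun_inj R r e)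
    (fun w => filter_uniq _ (enum_uniq _)) (@size_descents r e) (@schubert_chart_cell R r e)
    (@schubert_order R r e).

Definition sign_mx eps : mx := diag_mx (\row_p (-1) ^+ eps p).

Lemma sign_mx_unit eps : sign_mx eps \in unitmx.
Proof.
rewrite unitmxE det_diag unitfE; apply/prodf_neq0 => p _.
by rewrite mxE signr_eq0.
Qed.

Lemma sign_act_continuous eps : continuous (translate hr (sign_mx eps) : X -> X).
Proof.
have := @translate_continuous R r e hr R (fun=> sign_mx eps).
move=> /(_ (@cst_continuous _ _ _) (fun=> sign_mx_unit eps)) H.
have pc : continuous (fun F : X => (F, 0 : R)).
  by apply: continuous_pair; [exact: continuous_idfun|exact: cst_continuous].
exact: (@continuous_o _ _ _ _ (fun q : X * R => translate hr (sign_mx eps) q.1) pc H).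
Qed.

Lemma diag_mx_conjE (a b : 'rV[R]_M) G p q :
  (diag_mx a *m G *m diag_mx b) p q = a 0 p * G p q * b 0 q.
Proof. by rewrite mul_mx_diag mxE mul_diag_mx !mxE. Qed.

Lemma sign_mx_conjE eps G p q :
  (sign_mx eps *m G *m sign_mx eps) p q = (-1) ^+ eps p * G p q * (-1) ^+ eps q.
Proof. by rewrite diag_mx_conjE !mxE. Qed.

Definition coord_flip eps w (k : 'I_#|ascending w|) := eps (position k).1 (+) eps (position k).2.

(** Signs on the columns alone would spoil the unit diagonal; signs on the rows restore it and leave
    the flag unchanged. Hence each coordinate is multiplied by the signs of both its positions. *)
Lemma coord_mx_flip eps w (x : 'rV[R]_#|ascending w|) :
  coord_mx (flip (@coord_flip eps w) x) = sign_mx eps *m coord_mx x *m sign_mx eps.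
Proof.
rewrite -[RHS](@mx_coordK R r e w) => [|p q qp]; last first.
  rewrite sign_mx_conjE (coord_mx_unipotent x qp); case: eqVneq => [->|]; last by rewrite mulr0 mul0r.
  by rewrite mulr1 -signr_addb addbb.
congr coord_mx; apply/rowP => k; rewrite flipE mxE sign_mx_conjE /coord_flip signr_addb.
have := congr1 (fun y : 'rV[R]__ => y 0 k) (coord_mxK x); rewrite mxE => ->.
by rewrite mulrAC.
Qed.

Lemma flagw_sign_mx eps w G : G \in unitmx -> flagw w (sign_mx eps *m G) = flagw w G.
Proof.
move=> Gu; apply: flagw_eq => [|p]; first by rewrite unitmx_mul sign_mx_unit.
rewrite (_ : row p _ = (-1) ^+ eps p *: row p G); last first.
  by apply/rowP => q; rewrite [LHS]mxE /sign_mx mul_diag_mx !mxE.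
by apply: memvZ; exact: memv_row_flagw.
Qed.

Lemma sign_act_chart eps w (x : 'rV[R]_#|ascending w|) :
  translate hr (sign_mx eps) (chart_fun x) = chart_fun (flip (@coord_flip eps w) x).
Proof.
have xu := coord_mx_unit x.
rewrite /chart_fun flagw_translate ?sign_mx_unit// coord_mx_flip -mulmxA flagw_sign_mx//.
by rewrite unitmx_mul xu sign_mx_unit.
Qed.

Definition sign_symmetry eps : symmetry flag_cells :=
  @Symmetry R X K flag_cells (mkcts (@sign_act_continuous eps)) (@coord_flip eps)
    (@sign_act_chart eps).

Section Rotation.
Variables (p0 p1 : 'I_M).
Hypothesis p01 : p0 != p1.

(* A path from the sign change at p0 and p1 to the identity; the numbers
   2 t - 1 and t (1 - t) have no common zero. *)
Definition rotation (t : R) : mx :=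
  1%:M + (2 * t - 2) *: (delta_mx p0 p0 + delta_mx p1 p1)
  + (t * (1 - t)) *: (delta_mx p0 p1 - delta_mx p1 p0).

Lemma mul_rV_delta (v : 'rV[R]_M) p q l : (v *m delta_mx p q) 0 l = v 0 p * (l == q)%:R.
Proof.
rewrite mxE (bigD1 p)//= big1 ?addr0 => [|k kp]; first by rewrite mxE eqxx.
by rewrite mxE (negbTE kp) mulr0.
Qed.

(** On the plane of [p0] and [p1] the diagonal entries are 2 t - 1 and the others are t (1 - t) and
    its negative, so the determinant is a sum of two squares; a kernel vector is killed by applying
    the adjugate. The path is invertible for every real t, as [homotopy_bounds] takes homotopies
    over all of [R]. *)
Lemma rotation_unit t : rotation t \in unitmx.
Proof.
rewrite -row_free_unit; apply: inj_row_free => v vA.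
have vE l : v 0 l + ((2 * t - 2) * (v 0 p0 * (l == p0)%:R + v 0 p1 * (l == p1)%:R))
    + t * (1 - t) * (v 0 p0 * (l == p1)%:R - v 0 p1 * (l == p0)%:R) = 0.
  have := congr1 (fun y : 'rV[R]__ => y 0 l) vA.
  rewrite /rotation !mulmxDr mulmx1 -!scalemxAr mulmxDr mulmxBr [RHS]mxE => <-.
  by rewrite !mxE -!mul_rV_delta !mxE.
have := vE p0; have := vE p1; rewrite !eqxx (negbTE p01) eq_sym (negbTE p01) !mulr1 !mulr0.
move=> E1 E0.
have S0 : ((2 * t - 1) ^+ 2 + (t * (1 - t)) ^+ 2) != 0.
  rewrite paddr_eq0 ?sqr_ge0// !sqrf_eq0; apply/negP => /andP[/eqP a0 /eqP b0].
  have tE : t = 1 / 2 by lra.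
  by move: b0; rewrite tE; lra.
have v0 : v 0 p0 = 0.
  apply/eqP; suff /eqP : ((2 * t - 1) ^+ 2 + (t * (1 - t)) ^+ 2) * v 0 p0 = 0 by rewrite mulf_eq0 (negbTE S0).
  transitivity ((2 * t - 1) * (v 0 p0 + (2 * t - 2) * (v 0 p0 + 0) + t * (1 - t) * (0 - v 0 p1))
    + t * (1 - t) * (v 0 p1 + (2 * t - 2) * (0 + v 0 p1) + t * (1 - t) * (v 0 p0 - 0))).
    by ring.
  by rewrite E0 E1 !mulr0 addr0.
have v1 : v 0 p1 = 0.
  apply/eqP; suff /eqP : ((2 * t - 1) ^+ 2 + (t * (1 - t)) ^+ 2) * v 0 p1 = 0 by rewrite mulf_eq0 (negbTE S0).
  transitivity ((2 * t - 1) * (v 0 p1 + (2 * t - 2) * (0 + v 0 p1) + t * (1 - t) * (v 0 p0 - 0))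
    - t * (1 - t) * (v 0 p0 + (2 * t - 2) * (v 0 p0 + 0) + t * (1 - t) * (0 - v 0 p1))).
    by ring.
  by rewrite E0 E1 !mulr0 subr0.
by apply/rowP => l; have := vE l; rewrite v0 v1 !mul0r !addr0 subr0 !mulr0 !addr0 mxE.
Qed.

Lemma rotation0 : rotation 0 = sign_mx (pred2 p0 p1).
Proof.
apply/matrixP => p q; rewrite !mxE /= mul0r mul0r addr0 mulr0 sub0r.
have [<-|pq] := eqVneq p q.
  rewrite !mulr1n !andbb; have [->|_] := eqVneq p p0; first by rewrite (negbTE p01) /= expr1; ring.
  by have [_|_] := eqVneq p p1 => /=; rewrite ?expr1 ?expr0; ring.
have z a : (p == a) && (q == a) = false.
  by apply/negP => /andP[/eqP pE /eqP qE]; rewrite pE qE eqxx in pq.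
by rewrite !z !mulr0n; ring.
Qed.

Lemma rotation1 : rotation 1 = 1%:M.
Proof.
rewrite /rotation (_ : 2 * 1 - 2 = 0); last by ring.
by rewrite scale0r subrr mulr0 scale0r !addr0.
Qed.

Lemma rotation_continuous : continuous rotation.
Proof.
apply: continuous_mx => p q; under eq_fun do rewrite !mxE.
have idc : continuous (fun t : R => t) by exact: continuous_idfun.
have cc (c : R) : continuous (fun _ : R => c) by exact: cst_continuous.
apply: continuous_funD; [apply: continuous_funD => //|];
  apply: continuous_funM => //.
  by apply: continuous_funB => //; exact: continuous_funM.
by apply: continuous_funM => //; exact: continuous_funB.
Qed.

Lemma null_homotopic_sign : null_homotopic R (sym_act (sign_symmetry (pred2 p0 p1))).
Proof.
move=> n c dc.
have hc := @translate_continuous R r e hr R rotation rotation_continuous rotation_unit.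
have := @homotopy_bounds R X X set0 set0 (mkcts hc) (sym_act (sign_symmetry (pred2 p0 p1)))
  (mkcts (@continuous_idfun X)) n c _ _ _ _ dc.
have -> : pull (mkcts (@continuous_idfun X)) c = c.
  by apply/funext => s; rewrite /pull; congr c; exact/continuousEP.
apply=> //.
- by move=> x; rewrite /= /mkcts /= rotation0.
- move=> x; rewrite /= /mkcts /= rotation1 -{2}(frame_mxK hr x) -{1}(frame_mxK hr x).
  by rewrite translate_fspan ?unitmx1 ?frame_mx_unit// mulmx1.
Qed.

End Rotation.

Lemma det_minor_mx_diag w i (a b : 'rV[R]_M) G :
  \det (minor_mx w i (diag_mx a *m G *m diag_mx b)) =
  (\prod_(p | (letter w p <= i)%N) a 0 p) * \det (minor_mx w i G) *
  \prod_(p | (letter w p <= i)%N) b 0 p.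
Proof.
pose tr (c : 'rV[R]_M) : 'rV[R]_M := \row_p if (letter w p <= i)%N then c 0 p else 1.
have -> : minor_mx w i (diag_mx a *m G *m diag_mx b) =
    diag_mx (tr a) *m minor_mx w i G *m diag_mx (tr b).
  apply/matrixP => p q; rewrite diag_mx_conjE [LHS]mxE diag_mx_conjE !mxE.
  have [<-|pq] := eqVneq p q; first by case: (letter w p <= i)%N; rewrite /= ?mul1r ?mulr1.
  by case: (letter w p <= i)%N; case: (letter w q <= i)%N => //=; rewrite ?mulr0 ?mul0r.
rewrite !det_mulmx !det_diag.
by congr (_ * _ * _); rewrite [RHS]big_mkcond; apply: eq_bigr => p _; rewrite mxE.
Qed.

(** Take a position [p0] where the two words differ and a step [i] that separates the two letters.
    The sign at [p0] changes the minor of [w] at step [i] once through a row if the letter of [v] is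
    at most [i], and once through a column if that of [w] is; exactly one of these occurs. The minor
    has no zero on the cell of [w], which lies in the chart of [w]. *)
Lemma flag_del_even (u : K -> forall n, cochain R X n) (del : K -> K -> int) w v :
  cell_basis flag_cells 0 u del -> exists b, del w v = b + b.
Proof.
move=> uB; have [->|dwv] := eqVneq (del w v) 0; first by exists 0; rewrite addr0.
have [|_ cd] := basis_del uB (w := w) (v := v); first exact/eqP.
have [p0 wv] : exists p, letter w p != letter v p.
  apply: contrapT => nex; have /letter_inj E : letter w =1 letter v.
    by move=> p; apply/eqP; apply: contrapT => /negP wv; apply: nex; exists p.
  by move: cd; rewrite E => /eqP; rewrite -[X in X == _]addn0 -addn1 eqn_add2l.
have [i iE] : exists i : 'I_r, (letter v p0 <= i)%N = ~~ (letter w p0 <= i)%N.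
  case: (ltngtP (letter w p0) (letter v p0)) => [lt|lt|/val_inj E].
  - by exists (letter w p0); rewrite leqnn leqNgt lt.
  - by exists (letter v p0); rewrite leqnn -ltnNge lt.
  - by rewrite E eqxx in wv.
(* [s] matches rows sorted by [w] with rows sorted by [v], so a frame read with [v] becomes a frame
   of the same flag read with [w]. *)
pose s : 'S_M := ((sorting w)^-1 * sorting v)%g.
pose relabel H := row_perm s H.
pose f (x : 'rV[R]_#|ascending v|) : R := \det (minor_mx w i (relabel (coord_mx x))).
apply: (@del_even R X K flag_cells u del uB (sign_symmetry (pred1 p0)) w v f) => //.
- apply: continuous_det => p q.
  apply: (@continuous_o _ _ _ (fun x => relabel (coord_mx x)) (fun G => minor_mx w i G p q)).
    by apply: continuous_mx => k l; under eq_fun do rewrite mxE; exact: coord_mx_continuous.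
  exact: minor_mx_continuous.
- move=> x; rewrite /f -[flip _ x]/(flip (@coord_flip (pred1 p0) v) x) coord_mx_flip.
  have -> : relabel (sign_mx (pred1 p0) *m coord_mx x *m sign_mx (pred1 p0)) =
      diag_mx (\row_p (-1) ^+ (s p == p0)) *m relabel (coord_mx x) *m sign_mx (pred1 p0).
    by apply/matrixP => p q; rewrite diag_mx_conjE [LHS]mxE sign_mx_conjE !mxE.
  rewrite det_minor_mx_diag.
  have -> : \prod_(p | (letter w p <= i)%N) (\row_p (-1) ^+ (s p == p0)) 0 p =
      (-1) ^+ (letter v p0 <= i)%N :> R.
    have sE p : (letter w p <= i)%N = (letter v (s p) <= i)%N.
      by rewrite permM sortingE -(sortingE w) permKV.
    have p0E : s (s^-1%g p0) = p0 by rewrite permKV.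
    rewrite (eq_bigl (fun p => (letter v (s p) <= i)%N)) => [|p]; last exact: sE.
    have others (P : pred 'I_M) : \prod_(p | P p && (p != s^-1%g p0)) (\row_p (-1) ^+ (s p == p0)) 0 p = 1 :> R.
      by apply: big1 => p /andP[_ pp]; rewrite mxE -p0E (inj_eq perm_inj) (negbTE pp).
    case: (boolP (letter v p0 <= i)%N) => vp.
      by rewrite (bigD1 (s^-1%g p0)) ?p0E//= others mulr1 mxE p0E eqxx.
    rewrite (eq_bigl (fun p => (letter v (s p) <= i)%N && (p != s^-1%g p0))) ?others// => p.
    by case: eqP => [->|]; rewrite ?p0E ?(negbTE vp)// andbT.
  have -> : \prod_(p | (letter w p <= i)%N) (\row_p (-1) ^+ (pred1 p0) p) 0 p =
      (-1) ^+ (letter w p0 <= i)%N :> R.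
    have others (P : pred 'I_M) : \prod_(p | P p && (p != p0)) (\row_p (-1) ^+ (pred1 p0 p)) 0 p = 1 :> R.
      by apply: big1 => p /andP[_ pp]; rewrite mxE /= (negbTE pp).
    case: (boolP (letter w p0 <= i)%N) => wp.
      by rewrite (bigD1 p0)//= others mulr1 mxE /= eqxx.
    rewrite (eq_bigl (fun p => (letter w p <= i)%N && (p != p0))) ?others// => p.
    by case: eqP => [->|]; rewrite ?(negbTE wp)// andbT.
  rewrite iE; case: (letter w p0 <= i)%N => /=; rewrite ?expr0 ?expr1; ring.
- move=> x wx; rewrite /f.
  have [y _ yE] := schubert_chart_fun wx.
  suff /(_ i) : transverse w (relabel (coord_mx x)) by rewrite unitmxE unitfE.
  apply: (@chart_fun_transverse R r e w y).
    by rewrite row_perm_unit coord_mx_unit.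
  by rewrite yE /relabel row_permM flagw_row_perm.
Qed.

End FlagSymmetries.

(** * Inversions of words *)

Fixpoint duplicate (T : Type) (l : seq T) : seq T :=
  if l is a :: l' then [:: a, a & duplicate l'] else [::].

Lemma size_duplicate (T : Type) (l : seq T) : size (duplicate l) = (2 * size l)%N.
Proof. by elim: l => //= a l ->; rewrite mulnS. Qed.

Lemma count_duplicate (T : Type) (P : pred T) l : count P (duplicate l) = (2 * count P l)%N.
Proof. by elim: l => //= a l ->; case: (P a) => /=; lia. Qed.

Lemma duplicate_inj (T : Type) : injective (@duplicate T).
Proof. by move=> l; elim: l => [|a l IH] [|b k] //= [-> _ /IH ->]. Qed.

Lemma ninv_duplicate l : ninv (duplicate l) = (4 * ninv l)%N.
Proof. by elim: l => //= a l ->; rewrite count_duplicate ltnn; lia. Qed.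

Lemma count_even (l : seq nat) (P : pred nat) :
  (forall a, ~~ odd (count_mem a l)) -> ~~ odd (count P l).
Proof.
move=> ev; rewrite -sum1_count -big_undup_iterop_count /=.
elim/big_ind: _ => // [m n m0 n0|a _]; first by rewrite oddD (negbTE m0) (negbTE n0).
have := ev a; rewrite (_ : iterop _ _ _ _ = count_mem a l)//.
by elim: (count_mem a l) => //= -[|n] //= IH; rewrite -[in RHS]IH.
Qed.

(* The number of inversions of l that involve its k-th letter. *)
Fixpoint ninv_at (l : seq nat) (k : nat) : nat :=
  match l, k with
  | a :: l', 0 => count (fun b => b < a)%N l'
  | a :: l', k'.+1 => ((nth 0 l' k' < a) + ninv_at l' k')%N
  | [::], _ => 0%N
  end.

Lemma ninv_at_duplicate u k : ~~ odd (ninv_at (duplicate u) k).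
Proof.
elim: u k => [|a u IH] [|[|k]] //=; rewrite ?ltnn /= ?add0n ?count_duplicate ?oddM//.
by rewrite addnA oddD addnn odd_double /= IH.
Qed.

(** Even multiplicities make the parity at position 0 even, hence all parities are even. At position
    1, evenness of the count of letters below the second one forces the first two letters to be
    equal; removing both leaves a shorter word with the same properties. *)
Lemma duplicate_of_ninv_at l : (forall a, ~~ odd (count_mem a l)) ->
  (forall k, (k < size l)%N -> odd (ninv_at l k) = odd (ninv_at l 0)) ->
  exists u, l = duplicate u.
Proof.
move=> ev par; have h0 : ~~ odd (ninv_at l 0).
  case: l ev {par} => //= a l ev.
  by have := @count_even (a :: l) (fun b => b < a)%N ev; rewrite /= ltnn.
have {}par k : (k < size l)%N -> ~~ odd (ninv_at l k) by move=> /par ->.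
elim: (size l) {-2}l (leqnn (size l)) ev par {h0} => [|n IH] {}l ln ev par.
  by exists [::]; apply/size0nil/eqP; rewrite -leqn0.
case: l => [|a [|b l]] in ln ev par *; first by exists [::].
  by have := ev a; rewrite /= eqxx.
have ab : a = b.
  have := par 1%N isT; have := @count_even [:: a, b & l] (fun c => c < b)%N ev; rewrite /= ltnn add0n !oddD.
  by case: (ltngtP a b) => //=; case: (odd _).
subst b; have [||k kl|u ->] := IH l; last by exists (a :: u).
- exact: ltnW.
- by move=> c; have := ev c; rewrite /= addnA oddD addnn odd_double.
- by have := par k.+2 kl; rewrite /= addnA oddD addnn odd_double.
Qed.

(** * Generating functions of inversions *)

Section Qfactorial.
Variables (A : comNzRingType) (x : A).

(** The q-Pochhammer symbol (x; x)_n. *)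
Definition qpoch n := \prod_(1 <= j < n.+1) (1 - x ^+ j).

Lemma qpochS n : qpoch n.+1 = qpoch n * (1 - x ^+ n.+1).
Proof. by rewrite /qpoch big_nat_recr. Qed.

Definition inversion_gf (s : seq nat) := \sum_(l <- permutations s) x ^+ ninv l.

(** Each term is [x] to the number of letters below [a] minus [x] to the number of letters up to
    [a], so the sum telescopes. *)
Lemma telescope_letters r (s : seq nat) : all (fun a => a < r)%N s ->
  \sum_(a < r) x ^+ count (fun b => b < a)%N s * (1 - x ^+ count_mem (a : nat) s) =
  1 - x ^+ size s.
Proof.
rewrite all_count => /eqP sr; have step (a : nat) :
    x ^+ count (fun b => b < a)%N s * (1 - x ^+ count_mem a s) =
    x ^+ count (fun b => b < a)%N s - x ^+ count (fun b => b < a.+1)%N s.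
  rewrite mulrBr mulr1 -exprD; congr (_ - x ^+ _).
  rewrite -count_predUI (eq_count (a2 := fun b => b < a.+1)%N) => [|b]; last first.
    by rewrite /= ltnS [in RHS]leq_eqVlt orbC.
  rewrite [X in (_ + X)%N](eq_count (a2 := pred0)) ?count_pred0 ?addn0// => b /=.
  by case: eqP => [->|]; rewrite ?ltnn ?andbF.
under eq_bigr do rewrite step.
rewrite -(big_mkord xpredT (fun a => x ^+ count (fun b => b < a)%N s - x ^+ count (fun b => b < a.+1)%N s)).
rewrite (telescope_sumr_eq (fun a => - x ^+ count (fun b => b < a)%N s)) // => [|a _].
  by rewrite opprK sr addrC (eq_count (a2 := pred0)) ?count_pred0.
by rewrite opprK addrC.
Qed.

(* A word is its first letter a followed by a permutation of the rest, and a
   contributes one inversion for each smaller letter. *)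
Lemma inversion_gfE r (s : seq nat) : all (fun a => a < r)%N s ->
  inversion_gf s * \prod_(i < r) qpoch (count_mem (i : nat) s) = qpoch (size s).
Proof.
elim: (size s) {-2}s (erefl (size s)) => [|n IH] {}s sn sr.
  rewrite (size0nil sn) /inversion_gf /= big_seq1 mul1r.
  by rewrite /qpoch big_geq// big1// => i _; rewrite big_geq.
have s0 : (0 < size s)%N by rewrite sn.
have gfE : inversion_gf s = \sum_(a <- undup s)
    x ^+ count (fun b => b < a)%N s * inversion_gf (rem a s).
  rewrite /inversion_gf (perm_big _ (permutationsE s0)) big_allpairs_dep /=.
  apply: eq_big_seq => a; rewrite mem_undup => sa.
  rewrite big_distrr /=; apply: eq_big_seq => l; rewrite mem_permutations => sl.
  rewrite /= exprD; congr (x ^+ _ * _).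
  rewrite (seq.permP sl) (seq.permP (perm_to_rem sa)) /= ltnn; done.
rewrite gfE mulr_suml.
have termE a : a \in undup s ->
    x ^+ count (fun b => b < a)%N s * inversion_gf (rem a s) *
      \prod_(i < r) qpoch (count_mem (i : nat) s) =
    qpoch n * (x ^+ count (fun b => b < a)%N s * (1 - x ^+ count_mem a s)).
  rewrite mem_undup => sa; have ar : (a < r)%N by exact: (seq.allP sr).
  have srem : size (rem a s) = n by rewrite size_rem// sn.
  have rr : all (fun a => a < r)%N (rem a s).
    by apply/seq.allP => b /mem_rem; exact: (seq.allP sr).
  rewrite -srem -(IH _ srem rr) (bigD1 (Ordinal ar)) //= [in RHS](bigD1 (Ordinal ar)) //=.
  have ca : count_mem a s = (count_mem a (rem a s)).+1.
    by rewrite (seq.permP (perm_to_rem sa)) /= eqxx.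
  rewrite ca qpochS; have -> : \prod_(i < r | i != Ordinal ar) qpoch (count_mem (i : nat) s) =
      \prod_(i < r | i != Ordinal ar) qpoch (count_mem (i : nat) (rem a s)).
    apply: eq_bigr => i ia; rewrite (seq.permP (perm_to_rem sa)) /=.
    by rewrite (_ : a == i = false)//; apply: contraNF ia => /eqP E; apply/eqP/val_inj.
  ring.
rewrite (eq_big_seq _ termE) -mulr_sumr [in RHS]sn qpochS -[in RHS]sn -(telescope_letters sr).
congr (_ * _); pose F a := x ^+ count (fun b => b < a)%N s * (1 - x ^+ count_mem a s).
rewrite -[RHS](big_mkord xpredT F) /index_iota subn0.
transitivity (\sum_(a <- iota 0 r | a \in s) F a); last first.
  rewrite big_mkcond; apply: eq_bigr => a _; case: ifP => // /negbT /count_memPn a0.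
  by rewrite /F a0 subrr mulr0.
rewrite -[RHS]big_filter; apply: perm_big; apply: uniq_perm; rewrite ?undup_uniq ?filter_uniq ?iota_uniq//.
move=> a; rewrite mem_undup mem_filter mem_iota /=.
by case: (boolP (a \in s)) => //= /(seq.allP sr) ->.
Qed.

End Qfactorial.

Lemma card_ninv_at n (f : 'I_n -> nat) (a : 'I_n) :
  (\sum_(pq : 'I_n * 'I_n | (pq.2 < pq.1) && (f pq.1 < f pq.2)) ((pq.1 == a) + (pq.2 == a)))%N =
  ninv_at [seq f p | p <- enum 'I_n] a.
Proof.
have -> : (\sum_(pq : 'I_n * 'I_n | (pq.2 < pq.1) && (f pq.1 < f pq.2)) ((pq.1 == a) + (pq.2 == a)))%N
    = (\sum_(q < n) \sum_(p < n) ((q < p) && (f p < f q)) * ((p == a) + (q == a)))%N.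
  rewrite exchange_big pair_big /= big_mkcond; apply: eq_bigr => -[p q] _ /=.
  by case: (_ && _); rewrite ?mul1n.
elim: n f a => [|n IH] f a; first by case: a.
rewrite big_ord_recl big_ord_recl [in LHS]mul0n add0n enum_ordSl map_cons -map_comp.
case: (unliftP ord0 a) => [a' ->|->].
  rewrite lift0 /= -IH; congr (_ + _)%N.
    rewrite (bigD1 a') //= eqxx big1 ?addn0 => [|p pa]; last first.
      by rewrite (inj_eq lift_inj) (negbTE pa) muln0.
    by rewrite muln1 (nth_map a') ?size_enum_ord// nth_ord_enum.
  apply: eq_bigr => q _; rewrite big_ord_recl /= mul0n add0n.
  by apply: eq_bigr => p _; rewrite !(inj_eq lift_inj).
rewrite [X in (_ + X)%N]big1 ?addn0 => [|q _]; last first.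
  by rewrite big1// => p _; case: (eqVneq p ord0) => [->|_]; rewrite ?ltn0 ?mul0n// eq_sym eq_liftF muln0.
rewrite /= count_map -sum1_count big_enum_cond /= [RHS]big_mkcond.
by apply: eq_bigr => p _ /=; case: (_ < _)%N.
Qed.

Section StandardWord.
Context {r : nat}.
Implicit Types (c : 'I_r -> nat).

Definition standard c : seq nat := flatten [seq nseq (c i) (i : nat) | i <- enum 'I_r].

Lemma count_standard c (j : 'I_r) : count_mem (j : nat) (standard c) = c j.
Proof.
rewrite /standard count_flatten sumnE big_map big_map big_enum /= (bigD1 j) //= count_nseq /= eqxx mul1n.
rewrite big1 ?addn0// => i ij; rewrite count_nseq /=.
by rewrite (_ : (i : nat) == j = false) ?mul0n//; apply: contraNF ij => /eqP/val_inj ->.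
Qed.

Lemma standard_lt c : all (fun a => a < r)%N (standard c).
Proof. by apply/seq.allP => a /flatten_mapP[i _ /nseqP[-> _]]. Qed.

Lemma size_standard c : size (standard c) = ambient_dim c.
Proof.
rewrite /standard size_flatten /shape sumnE big_map big_map big_enum /=.
by apply: eq_bigr => i _; rewrite size_nseq.
Qed.

Lemma perm_standard c l :
  perm_eq l (standard c) <-> all (fun a => a < r)%N l /\ forall j : 'I_r, count_mem (j : nat) l = c j.
Proof.
split=> [pl|[lr lc]].
  by rewrite (perm_all _ pl) standard_lt; split=> // j; rewrite (seq.permP pl) count_standard.
apply/seq.allP => a; rewrite mem_cat /= => al; have ar : (a < r)%N.
  by case/orP: al => [/(seq.allP lr)|/(seq.allP (standard_lt c))].
by rewrite (lc (Ordinal ar)) (count_standard c (Ordinal ar)).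
Qed.

Lemma perm_spell_standard c (w : word c) : perm_eq (spell w) (standard c).
Proof.
apply/perm_standard; split; first by apply/seq.allP => _ /mapP[p _ ->].
by move=> j; rewrite count_spell -(card_letter w j).
Qed.

Lemma spell_surj c l : perm_eq l (standard c) -> exists w : word c, spell w = l.
Proof.
move=> /[dup] pl /perm_standard[lr lc]; have sl : size l = ambient_dim c.
  by rewrite (perm_size pl) size_standard.
have ltr (p : 'I_(ambient_dim c)) : (nth 0 l p < r)%N.
  by apply: (seq.allP lr); rewrite mem_nth// sl.
pose f : {ffun 'I_(ambient_dim c) -> 'I_r} := [ffun p => Ordinal (ltr p)].
have fl : [seq (f p : nat) | p <- enum 'I_(ambient_dim c)] = l.
  apply: (@eq_from_nth _ 0%N); first by rewrite size_map size_enum_ord sl.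
  rewrite size_map size_enum_ord => k kM.
  by rewrite (nth_map (Ordinal kM)) ?size_enum_ord// (nth_ord_enum _ (Ordinal kM)) ffunE.
have fc : has_content f.
  apply/forallP => i; rewrite -lc -fl count_map -sum1_count big_enum_cond /= -sum1_card.
  by apply/eqP; apply: eq_bigl => p; rewrite !inE.
by exists (exist _ f fc).
Qed.

Lemma sum_inversions (A : comNzRingType) (x : A) c :
  \sum_(w : word c) x ^+ inversions w = inversion_gf x (standard c).
Proof.
rewrite /inversion_gf (perm_big [seq spell w | w <- enum {: word c}]) /=; last first.
  rewrite perm_sym; apply: uniq_perm; rewrite ?permutations_uniq ?(map_inj_uniq (@spell_inj _ _)) ?enum_uniq//.
  move=> l; rewrite mem_permutations; apply/mapP/idP => [[w _ ->]|/spell_surj[w <-]].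
    exact: perm_spell_standard.
  by exists w; rewrite ?mem_enum.
by rewrite big_map big_enum; apply: eq_bigr => w _; rewrite inversionsE.
Qed.

(** Doubling is a bijection from the words of content [c] onto those selected by [T], and it
    multiplies the number of inversions by 4. *)
Lemma sum_inversions_duplicate (A : comNzRingType) (x : A) c (T : pred (word (fun i => 2 * c i)%N)) :
  (forall w, T w <-> exists u, spell w = duplicate u) ->
  \sum_(w | T w) x ^+ inversions w = inversion_gf (x ^+ 4) (standard c).
Proof.
move=> TP; transitivity (\sum_(l <- [seq duplicate u | u <- permutations (standard c)]) x ^+ ninv l).
  rewrite [RHS](perm_big [seq spell w | w <- enum T]) /=.
    by rewrite big_map big_enum; apply: eq_bigr => w _; rewrite inversionsE.
  rewrite perm_sym; apply: uniq_perm.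
  - by rewrite (map_inj_uniq (@spell_inj _ _)) enum_uniq.
  - by rewrite (map_inj_uniq (@duplicate_inj _)) permutations_uniq.
  move=> l; apply/mapP/mapP => [[w]|[u]].
    rewrite mem_enum => /TP[u wu] ->; exists u => //.
    rewrite mem_permutations; apply/perm_standard.
    have /perm_standard[wr wc] := perm_spell_standard w; split.
      move: wr; rewrite wu !all_count count_duplicate size_duplicate.
      by rewrite eqn_mul2l.
    by move=> j; have /eqP := wc j; rewrite wu count_duplicate eqn_mul2l => /eqP.
  rewrite mem_permutations => /perm_standard[ur uc] ->.
  have /spell_surj[w wE] : perm_eq (duplicate u) (standard (fun i => 2 * c i)%N).
    apply/perm_standard; split; last by move=> j; rewrite count_duplicate uc.
    by move: ur; rewrite !all_count count_duplicate size_duplicate eqn_mul2l.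
  by exists w; rewrite ?wE// mem_enum; apply/TP; exists u.
by rewrite big_map; apply: eq_bigr => u _; rewrite ninv_duplicate exprM.
Qed.

End StandardWord.

(** * Cells with trivial characters *)

Section TrivialCells.
Context {R : realType} {r : nat}.
Variables (d : 'I_r -> nat) (hr : (0 < r)%N).
Local Notation e := (fun i => 2 * d i)%N.
Local Notation M := (ambient_dim e).
Implicit Types (w : word e) (p : 'I_M).

Definition pair_flips (g : symmetry (@flag_cells R r e hr)) :=
  exists p0 p1, p0 != p1 /\ g = sign_symmetry hr (pred2 p0 p1).

(** The sign on a normal coordinate is the product of the signs at its two positions, so each chosen
    position contributes one factor -1 for every inversion that involves it. *)
Lemma character_pair w p0 p1 : p0 != p1 ->
  character (@sign_symmetry R r e hr (pred2 p0 p1)) w =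
  (-1) ^+ (ninv_at (spell w) p0 + ninv_at (spell w) p1).
Proof.
move=> p01; rewrite -!(card_ninv_at (fun p => letter w p : nat)) -big_split /= expr_sum.
rewrite /character /flip_sign /= big_filter big_enum_cond /=.
rewrite [RHS](eq_bigl (fun pq => (pq \in ascending w) && (pq.2 < pq.1)%N)); last first.
  by move=> pq; rewrite !inE /= andbC.
rewrite (big_enum_val_cond (A := ascending w) (fun pq => (pq.2 < pq.1)%N)) /=.
apply: eq_bigr => k _; rewrite /coord_flip signr_addb /= -/(position k).
have s2 p : (-1) ^+ ((p == p0) || (p == p1)) = (-1) ^+ (p == p0) * (-1) ^+ (p == p1) :> int.
  by have [->|_] := eqVneq p p0; rewrite ?(negbTE p01) ?mulr1 ?mul1r.
by rewrite !s2 !exprD mulrACA.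
Qed.

Lemma trivial_cellP w : trivial_cell pair_flips w <-> exists u, spell w = duplicate u.
Proof.
split=> [tw|[u wu] g [p0 [p1 [p01 ->]]]]; last first.
  by rewrite character_pair// wu -signr_odd oddD !(negbTE (ninv_at_duplicate _ _)).
have M_even a : ~~ odd (count_mem a (spell w)).
  case: (ltnP a r) => ar.
    have /perm_standard[_ /(_ (Ordinal ar)) /= ->] := perm_spell_standard w.
    by rewrite oddM.
  rewrite (_ : count_mem a _ = 0%N)//; apply/count_memPn.
  have /perm_standard[/seq.allP wr _] := perm_spell_standard w.
  by apply/negP => /wr; rewrite ltnNge ar.
apply: duplicate_of_ninv_at => // k; rewrite size_spell => kM.
have M0 : (0 < M)%N by exact: leq_ltn_trans kM.
(* Sign changes come in pairs, so the characters only show that every position has the same parity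
   as position 0. *)
have [k0|k0] := eqVneq (Ordinal kM) (Ordinal M0); first by rewrite (congr1 val k0 : k = 0%N).
have := tw _ (ex_intro _ _ (ex_intro _ _ (conj k0 erefl))).
rewrite character_pair//= -signr_odd oddD.
by case: (odd (ninv_at _ k)); case: (odd (ninv_at _ 0)).
Qed.

End TrivialCells.

(** Beyond the largest codimension the counts are zero, and so are both summands; hence [a] is the
    coefficient sequence of a polynomial. The factor ['X] on the right accounts for the index shift
    and for [a 0 = 0]. *)
Lemma poly_of_consecutive_sums (K : finType) (cd : K -> nat) (B : pred K) (a : nat -> nat) :
  a 0%N = 0%N -> (forall n, (a n + a n.+1)%N = #|[pred w | B w & cd w == n]|) ->
  exists2 P : {poly int}, forall i, P`_i = (a i)%:Z &
    (1 + 'X) * P = 'X * \sum_(w | B w) 'X^(cd w).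
Proof.
move=> a0 aE; pose m := \max_w cd w.
have a_big n : (m < n)%N -> a n = 0%N.
  move=> mn; have /eqP := aE n; rewrite eq_card0 ?addn_eq0 => [/andP[/eqP //]|w].
  rewrite !inE; case: eqP => [E|]; rewrite ?andbF// -E in mn *.
  by move: mn; rewrite ltnNge leq_bigmax.
have coefP i : (\poly_(n < m.+1) (a n)%:Z)`_i = (a i)%:Z.
  by rewrite coef_poly ltnS; case: leqP => // /a_big ->.
exists (\poly_(n < m.+1) (a n)%:Z) => //.
apply/polyP => -[|n]; rewrite mulrDl mul1r coefD !coefXM /= !coefP ?a0//.
rewrite -PoszD addnC aE coef_sum -sum1_card (big_morph Posz PoszD (erefl (Posz 0))).
rewrite (eq_bigl (fun w => B w && (cd w == n))) => [|w]; last by rewrite !inE.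
rewrite big_mkcondr; apply: eq_bigr => w _; rewrite coefXn [n == _]eq_sym.
by case: (cd w == n).
Qed.

(** * Quotients in the fraction field *)

Section FractionField.
Local Notation t := (tofrac 'X : {fraction {poly int}}).

Lemma one_sub_tXn n : (0 < n)%N -> 1 - t ^+ n != 0.
Proof.
move=> n0; rewrite -tofracXn -tofrac1 -tofracB tofrac_eq0 subr_eq0.
apply/eqP => /(congr1 (fun p : {poly int} => size p)); rewrite size_poly1 size_polyXn.
by case: n n0.
Qed.

Lemma one_add_t : 1 + t != 0.
Proof.
rewrite -tofrac1 -tofracD tofrac_eq0.
apply/eqP => /(congr1 (fun p : {poly int} => p`_0)); rewrite coefD coef1 coefX coef0.
exact/eqP.
Qed.

Lemma qpoch_neq0 k n : (0 < k)%N -> qpoch (t ^+ k) n != 0.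
Proof.
move=> k0; rewrite /qpoch big_seq_cond prodf_seq_neq0; apply/seq.allP => j.
rewrite mem_index_iota => jn; apply/implyP => _.
by rewrite -exprM one_sub_tXn// muln_gt0 k0; case/andP: jn.
Qed.

Lemma inversion_gf_quotient r (c : 'I_r -> nat) k : (0 < k)%N ->
  inversion_gf (t ^+ k) (standard c) =
  qpoch (t ^+ k) (\sum_i c i) / \prod_(i < r) qpoch (t ^+ k) (c i).
Proof.
move=> k0; have nz : \prod_(i < r) qpoch (t ^+ k) (c i) != 0.
  by apply/prodf_neq0 => i _; exact: qpoch_neq0.
apply: (mulIf nz); rewrite mulfVK//.
have := inversion_gfE (t ^+ k) (standard_lt c).
by rewrite size_standard (eq_bigr (fun i => qpoch (t ^+ k) (c i))) // => i _; rewrite count_standard.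
Qed.

End FractionField.

Theorem proposition6p2 (R : realType) (r : nat) (hr : (0 < r)%N)
    (d : 'I_r -> nat) (hd : forall i : 'I_r, (0 < d i)%N) :
  let N := (\sum_(i < r) d i)%N in
  let t : {fraction {poly int}} := tofrac 'X in
  exists2 P : {poly int},
    is_torsion_poincare R (flag R (fun i : 'I_r => 2 * d i)%N) P &
    tofrac P =
      t / (t + 1) *
      ((\prod_(1 <= j < (2 * N).+1) (1 - t ^+ j))
         / (\prod_(i < r) \prod_(1 <= j < (2 * d i).+1) (1 - t ^+ j))
       - (\prod_(1 <= j < N.+1) (1 - t ^+ (4 * j)))
         / (\prod_(i < r) \prod_(1 <= j < (d i).+1) (1 - t ^+ (4 * j)))).
Proof.
move=> N t; set e := fun i => (2 * d i)%N.
pose S := @flag_cells R r e hr.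
have [u [del uB]] := cell_basis_exists S.
have even w v : exists b, del w v = b + b := flag_del_even w v uB.
have null g : @pair_flips R r d hr g -> null_homotopic R (sym_act g).
  by move=> [p0 [p1 [p01 ->]]]; exact: null_homotopic_sign.
have codim4 w : trivial_cell (@pair_flips R r d hr) w -> (4 %| codim S w)%N.
  by move=> /trivial_cellP[l wl]; rewrite /= inversionsE wl ninv_duplicate dvdn_mulr.
have rank0 : del_rank S even 0 = 0%N.
  by rewrite /del_rank /= (_ : map_mx _ _ = 0) ?mxrank0//; apply/matrixP => i j; rewrite !mxE.
have [P PE PX] := poly_of_consecutive_sums rank0 (del_rank_count uB even null codim4).
exists P; first by move=> i; exists (del_rank S even i); [exact: (cohomology_Z2_rank uB even null codim4)|].
have := congr1 (@tofrac {poly int}) PX; rewrite !tofracM tofracD tofrac1 -/t rmorph_sum /=.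
set triv := trivialb _ => PX'.
(* Nondoubled words are all words minus the doubled ones. Writing [t ^+ 1] makes both sums instances
   of the same q-multinomial formula. *)
have sumE : \sum_(w | ~~ triv w) tofrac 'X^(inversions w) =
    inversion_gf (t ^+ 1) (standard e) - inversion_gf (t ^+ 4) (standard d).
  rewrite -(sum_inversions_duplicate t (T := triv)); last first.
    by move=> w; rewrite -(@trivial_cellP R r d hr w); split=> [/asboolP|?]; last exact/asboolP.
  rewrite -(sum_inversions (t ^+ 1) e) [X in _ = X - _](bigID triv) /= expr1 addrAC subrr add0r.
  by apply: eq_bigr => w _; rewrite tofracXn.
rewrite {}sumE !inversion_gf_quotient// in PX'.
rewrite (_ : (_ / _ - _ / _) = qpoch (t ^+ 1) (\sum_i e i) / (\prod_i qpoch (t ^+ 1) (e i)) -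
    qpoch (t ^+ 4) (\sum_i d i) / (\prod_i qpoch (t ^+ 4) (d i))).
  apply: (mulfI one_add_t); rewrite PX' [t + 1]addrC mulrA mulrCA mulfV ?mulr1//.
  exact: one_add_t.
have qpoch4 n : \prod_(1 <= j < n.+1) (1 - t ^+ (4 * j)) = qpoch (t ^+ 4) n.
  by apply: eq_bigr => j _; rewrite exprM.
rewrite qpoch4 expr1 -big_distrr; congr (_ / _ - _ / _).
by apply: eq_bigr => i _; rewrite qpoch4.
Qed.
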